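(* Let $X,X_1,X_2,\dots$ be i.i.d. random vectors in $\mathbb{R}^p$ with $\mathbb{E}X=0$ and covariance matrix $\Sigma\neq 0$ with eigenvalues $\lambda_1\ge\dots\ge\lambda_p\ge0$. Let $0<\delta\le 1$, $q=2+\delta$, and assume $K_\delta<\infty$ and $D_\delta<\infty$. Let $\eta_1,\dots,\eta_p$ be i.i.d. $\chi^2_1$ random variables and $V=\sum_{j=1}^p \frac{\lambda_j}{f}(\eta_j-1)$. Let $R_n=(n|\bar X_n|_2^2-f_1)/f$ with $\bar X_n=n^{-1}\sum_{i=1}^nX_i$. Define, for $\psi>0$, $$L_\delta(n,\psi)=\psi^2\Big(\frac{\tilde K_0^2}{n}+\frac{\tilde K_0}{n^{1/2}}\Big)+\psi^q\Big[\frac{\tilde K_\delta^q}{n^{q-1}}+\frac{\mathbb{E}(X_1^T\Sigma X_1)^{q/2}}{n^{\delta/2}f^q}+\frac{\tilde D_\delta^q}{n^\delta}\Big],$$ where $\tilde K_\delta=K_\delta+c_\delta$, $\tilde K_0=K_0+c_0$, $\tilde D_\delta=D_\delta+d_\delta$, and let $\psi_n$ be the solution of $L_\delta(n,\psi)=\psi^{-1/2}$. Then there is a constant $C$ depending only on $\delta$ such that $$\sup_{t\in\mathbb{R}}|\mathbb{P}(R_n\le t)-\mathbb{P}(V\le t)|\le C\psi_n^{-1/2}.$$ In particular, in the asymptotic regime $n\to\infty$ with $p=p_n$ and the distribution of $X$ allowed to depend on $n$, if $$\frac{\tilde K_0^2}{n}+\frac{\tilde K_\delta^q}{n^{q-1}}+\frac{\mathbb{E}(X_1^T\Sigma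 X_1)^{q/2}}{n^{\delta/2}f^q}+\frac{\tilde D_\delta^q}{n^\delta}\to0,$$ then $\psi_n\to\infty$ and $\sup_t|\mathbb{P}(R_n\le t)-\mathbb{P}(V\le t)|\to0$.
   Context: For $k\ge1$, $f_k=[\mathrm{tr}(\Sigma^k)]^{1/k}$ and $f=f_2$. $|x|_2=(x^Tx)^{1/2}$. For $\delta\ge0$: $K_\delta^{2+\delta}=\mathbb{E}|(X_1^TX_1-f_1)/f|^{2+\delta}$ and $D_\delta^{2+\delta}=\mathbb{E}|X_1^TX_2/f|^{2+\delta}$ (so $K_0=\|X_1^TX_1-f_1\|_2/f$). $c_\delta=(1+\delta)^{1/2}\|\xi^2-1\|_{2+\delta}$ and $d_\delta=(1+\delta)^{1/2}\|\xi\|_{2+\delta}^2$ with $\xi\sim N(0,1)$, where $\|Z\|_q=(\mathbb{E}|Z|^q)^{1/q}$. *)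

(* Defs.v *)
From HB Require Import structures.
From mathcomp Require Import all_boot all_order all_algebra.
From mathcomp Require Import all_classical all_reals all_analysis.
Set Implicit Arguments. Unset Strict Implicit. Unset Printing Implicit Defensive.
Import Order.TTheory GRing.Theory Num.Theory numFieldNormedType.Exports.
Local Open Scope classical_set_scope.
Local Open Scope ring_scope.

Section defs.
Context {R : realType}.

Definition sumsq {p : nat} (x : 'I_p -> R) : R := \sum_(a < p) x a ^+ 2.
Definition dotv {p : nat} (x y : 'I_p -> R) : R := \sum_(a < p) x a * y a.
Definition quadf {p : nat} (S : 'M[R]_p) (x : 'I_p -> R) : R :=
  \sum_(a < p) \sum_(b < p) x a * S a b * x b.

Definition vec_borel (p : nat) : set (set ('I_p -> R)) :=
  <<s [set B | exists (a : 'I_p) (A : set R), measurable A /\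
               B = (fun v : 'I_p -> R => v a) @^-1` A] >>.

Context {d : measure_display} {T : measurableType d}.

(* Expectation of a real function (finite value; use only for integrable f). *)
Definition Ex (P : probability T R) (f : T -> R) : R := fine (\int[P]_w (f w)%:E)%E.

(* X_1, X_2, ... (indexed 0, 1, ...) are i.i.d. random vectors in R^p. *)
Definition iid_vec (P : probability T R) {p : nat} (X : nat -> T -> 'I_p -> R) : Prop :=
  [/\ (forall i a, measurable_fun setT (fun w => X i w a)),
      (forall i B, @vec_borel p B -> P (X i @^-1` B) = P (X 0%N @^-1` B)) &
      (forall (s : seq nat) (B : nat -> set ('I_p -> R)), uniq s ->
         (forall i, @vec_borel p (B i)) ->
         P (\big[setI/setT]_(i <- s) (X i @^-1` B i)) =
         (\prod_(i <- s) P (X i @^-1` B i))%E)].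

(* xi_1, ..., xi_p i.i.d. N(0,1); eta_j := xi_j^2 are then i.i.d. chi^2_1. *)
Definition iid_std_normal (Q : probability T R) {p : nat} (xi : 'I_p -> T -> R) : Prop :=
  [/\ (forall j, measurable_fun setT (xi j)),
      (forall j (B : set R), measurable B -> Q (xi j @^-1` B) = normal_prob 0 1 B) &
      (forall (s : seq 'I_p) (B : 'I_p -> set R), uniq s ->
         (forall j, measurable (B j)) ->
         Q (\big[setI/setT]_(j <- s) (xi j @^-1` B j)) =
         (\prod_(j <- s) Q (xi j @^-1` B j))%E)].

Section model.
Variables (P : probability T R) (p : nat) (X : nat -> T -> 'I_p -> R).

(* covariance matrix Sigma of X = X_1 (which has mean zero) *)
Definition Sigma : 'M[R]_p := \matrix_(a, b) Ex P (fun w => X 0%N w a * X 0%N w b).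
Definition f1 : R := \tr Sigma.
Definition ff : R := Num.sqrt (\tr (Sigma *m Sigma)).

Definition Kint (r : R) : \bar R :=
  (\int[P]_w (`| (sumsq (X 0%N w) - f1) / ff | `^ r)%:E)%E.
Definition Dint (r : R) : \bar R :=
  (\int[P]_w (`| dotv (X 0%N w) (X 1%N w) / ff | `^ r)%:E)%E.
Definition Kmom (delta : R) : R := fine (Kint (2 + delta)) `^ (2 + delta)^-1.
Definition Dmom (delta : R) : R := fine (Dint (2 + delta)) `^ (2 + delta)^-1.
Definition Mquad (q : R) : R :=
  fine (\int[P]_w ((quadf Sigma (X 0%N w)) `^ (q / 2))%:E)%E.

Definition Rn (n : nat) (w : T) : R :=
  (n%:R * sumsq (fun a => (\sum_(i < n) X i w a) / n%:R) - f1) / ff.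

Definition model_hyps (delta : R) (lam : 'I_p -> R) : Prop :=
  iid_vec P X /\
  (forall a, P.-integrable setT (fun w => (X 0%N w a ^+ 2)%:E)) /\
  (forall a, (\int[P]_w (X 0%N w a)%:E = 0)%E) /\
  Sigma != 0 /\
  char_poly Sigma = \prod_(j < p) ('X - (lam j)%:P) /\
  (forall i j : 'I_p, (i <= j)%N -> lam j <= lam i) /\
  (Kint (2 + delta) < +oo)%E /\
  (Dint (2 + delta) < +oo)%E.

End model.
End defs.

Definition cconst {R : realType} (delta : R) : R :=
  Num.sqrt (1 + delta) *
  fine (\int[normal_prob 0 1]_x (`| x ^+ 2 - 1 | `^ (2 + delta))%:E)%E `^ (2 + delta)^-1.
Definition dconst {R : realType} (delta : R) : R :=
  Num.sqrt (1 + delta) *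
  (fine (\int[normal_prob 0 1]_x (`| x | `^ (2 + delta))%:E)%E `^ (2 + delta)^-1) ^+ 2.

Section L.
Context {R : realType} {d : measure_display} {T : measurableType d}.
Variables (P : probability T R) (p : nat) (X : nat -> T -> 'I_p -> R) (delta : R).

Definition K0t : R := Kmom P X 0 + cconst (0 : R).
Definition Kdt : R := Kmom P X delta + cconst delta.
Definition Ddt : R := Dmom P X delta + dconst delta.

Definition Ldelta (n : nat) (psi : R) : R :=
  let q := 2 + delta in
  psi ^+ 2 * (K0t ^+ 2 / n%:R + K0t / Num.sqrt n%:R) +
  psi `^ q * (Kdt `^ q / n%:R `^ (q - 1)
              + Mquad P X q / (n%:R `^ (delta / 2) * ff P X `^ q)
              + Ddt `^ q / n%:R `^ delta).

Definition Acond (n : nat) : R :=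
  let q := 2 + delta in
  K0t ^+ 2 / n%:R + Kdt `^ q / n%:R `^ (q - 1)
  + Mquad P X q / (n%:R `^ (delta / 2) * ff P X `^ q)
  + Ddt `^ q / n%:R `^ delta.
End L.

Definition KSdist {R : realType} {d : measure_display} {T : measurableType d}
  (P : probability T R) {p : nat} (X : nat -> T -> 'I_p -> R)
  {d' : measure_display} {T' : measurableType d'} (Q : probability T' R)
  (xi : 'I_p -> T' -> R) (lam : 'I_p -> R) (n : nat) : R :=
  sup (range (fun t : R =>
    `| fine (P [set w | Rn P X n w <= t]) -
       fine (Q [set w | \sum_(j < p) lam j / ff P X * (xi j w ^+ 2 - 1) <= t]) |)).

(* Main.v *)
(* The sharp indicator of [R_n <= t] is replaced by h(S) = cutoff (psi * ((|S|^2/n - f_1)/f - t)),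
   a spline of transition width 3/psi, and Lindeberg's method exchanges the summands X_i one by
   one for Gaussian vectors of covariance Sigma.  Adding Z to S changes |S|^2 by 2 S.Z + |Z|^2;
   the terms that survive a second order expansion depend only on the mean and covariance of Z,
   the cross term between S.Z and |Z|^2 - f_1 is split by AM-GM with weight (K_0 + 1)/sqrt n, and
   the remainder needs E|S.z|^(2+delta), bounded by a Rosenthal inequality.  The Gaussian part of
   the hybrid sum is a single vector sqrt(n-k) Y, from which rotation invariance splits off one
   summand.  Terms of order n^(-1/2) and n^(-delta/2) without a factor from X are absorbed because
   E(X^T Sigma X)^(q/2) >= f^q by Jensen.

   Returning to sharp indicators costs P(|V - t| <= 3/psi) <= C psi^(-1/2).  For this average over
   the rotations sqrt(1-s) xi + sqrt s xi' of the Gaussian vector: in s, the quadratic form is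
   strongly concave or convex with constant |g|, g the polar form at (xi, xi'), so it spends a
   fraction O(sqrt(h/|g|)) of the time within h of a level, and E|g|^(-1/2) is bounded since g is
   conditionally Gaussian.  Both errors equal psi^(-1/2) up to constants when L(n, psi) = psi^(-1/2). *)
Require Import Defs.
From HB Require Import structures.
From mathcomp Require Import all_boot all_order all_algebra.
From mathcomp Require Import all_classical all_reals all_analysis.
From mathcomp Require Import measurable_realfun lebesgue_measure ring lra.
Set Implicit Arguments. Unset Strict Implicit. Unset Printing Implicit Defensive.
Import Order.TTheory GRing.Theory Num.Theory numFieldNormedType.Exports.
Local Open Scope classical_set_scope.
Local Open Scope ring_scope.

(** * Independence and Tonelli splitting *)


(** The law of V ranges from nearly Gaussian to a single centred chi-square, whose density is
    unbounded like x^(-1/2) at its left end. A bound free of p and of the spectrum can therefore be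
    no better than sqrt h for an interval of length h, and this is where the exponent 1/2 of psi
    comes from. The rotation argument attains this rate from the single fact that the squares of
    lambda_j / f sum to 1: they are the weights of a Jensen inequality reducing E |g|^(-1/2) to one
    coordinate, so no eigenvalue has to be large. The rotation parameter s runs over a grid of about
    h^(-1/2) points, which turns the time spent near a level into a count.

    The cutoff is piecewise cubic because a bounded, Lipschitz second derivative makes the Taylor
    remainder at most a multiple of min(D^2, |D|^3), hence of |D|^(2+delta) for every delta in (0,
    1]. Error terms are integrals of nonnegative functions with values in [0, +oo], so the moments
    of the hybrid sums need no separate proof of finiteness. *)

Section vectors.
Context {R : realType} (p : nat).

Definition vec_cylinder : set (set ('I_p -> R)) :=
  [set B | exists (a : 'I_p) (A : set R), measurable A /\
           B = (fun v : 'I_p -> R => v a) @^-1` A].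

(** Its measurable sets are those of [vec_borel] by conversion, so the identities of [iid_vec] apply
    to it directly. *)
Definition vec := g_sigma_algebraType vec_cylinder.
HB.instance Definition _ := Measurable.on vec.

Lemma measurable_coord (a : 'I_p) : measurable_fun setT (fun v : vec => v a).
Proof.
move=> _ A mA; rewrite setTI; apply: sub_sigma_algebra.
by exists a, A.
Qed.

Lemma measurable_vec d (T : measurableType d) (f : T -> vec) :
  (forall a, measurable_fun setT (fun w => f w a)) -> measurable_fun setT f.
Proof.
move=> mf; apply: (@measurability _ _ T vec setT f vec_cylinder) => //.
move=> _ [_ [a [A [mA ->]]] <-]; rewrite -comp_preimage.
exact: (mf a).
Qed.

End vectors.
Arguments vec : clear implicits.

Lemma measurable_bigI d (T : measurableType d) (I : Type) (s : seq I)
    (A : I -> set T) : (forall i, measurable (A i)) ->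
  measurable (\big[setI/setT]_(i <- s) A i).
Proof.
by move=> mA; elim/big_ind: _ => //; exact: measurableI.
Qed.

Section independence.
Context {R : realType} d (T : measurableType d) (P : probability T R).
Local Open Scope ereal_scope.

(* [V] is independent of [U] and has the law of [V']. *)
Definition joint_split d1 d2 (E1 : measurableType d1) (E2 : measurableType d2)
    (U : T -> E1) (V V' : T -> E2) :=
  [/\ measurable_fun setT U, measurable_fun setT V, measurable_fun setT V' &
  forall A B, measurable A -> measurable B ->
    P (U @^-1` A `&` V @^-1` B) = P (U @^-1` A) * P (V' @^-1` B)].

(** On rectangles the law of (U, V) is the product of the laws of [U] and [V'], so the two measures
    coincide and Tonelli applies. The inner variable [w1] acts as an independent copy, without any
    enlargement of the probability space. *)
Lemma joint_split_integral d1 d2 (E1 : measurableType d1)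
    (E2 : measurableType d2) (U : T -> E1) (V V' : T -> E2)
    (phi : E1 * E2 -> \bar R) :
  joint_split U V V' -> measurable_fun [set: E1 * E2] phi -> (forall x, 0 <= phi x) ->
  \int[P]_w phi (U w, V w) = \int[P]_w \int[P]_w1 phi (U w, V' w1).
Proof.
move=> [mU mV mV' UV] mphi phi0.
pose U_ : {mfun T >-> E1} := HB.pack U (isMeasurableFun.Build _ _ _ _ _ mU).
pose V_ : {mfun T >-> E2} := HB.pack V' (isMeasurableFun.Build _ _ _ _ _ mV').
have mUV : measurable_fun setT (fun w => (U w, V w)).
  exact: measurable_fun_pair.
pose W_ : {mfun T >-> (E1 * E2)%type} :=
  HB.pack (fun w => (U w, V w)) (isMeasurableFun.Build _ _ _ _ _ mUV).
pose m1 := distribution P U_.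
pose m2 := distribution P V_.
pose m := distribution P W_.
have E : forall X, measurable X -> (m1 \x m2) X = m X.
  apply: product_measure_unique => A B mA mB.
  rewrite /m /m1 /m2 /distribution /pushforward /= -UV//.
transitivity (\int[m]_z phi z).
  by rewrite ge0_integral_distribution.
rewrite (eq_measure_integral (m1 \x m2)); last by move=> A mA _; exact/esym/E.
rewrite fubini_tonelli1//.
rewrite ge0_integral_distribution//; last 2 first.
  exact: measurable_fun_fubini_tonelli_F.
  by move=> x; apply: integral_ge0.
apply: eq_integral => w _ /=; rewrite /fubini_F ge0_integral_distribution//.
exact: measurableT_comp.
Qed.

Context d' (E : measurableType d') (I : eqType) (Z : I -> T -> E).
Hypothesis mZ : forall i, measurable_fun setT (Z i).
Hypothesis indepZ : forall (s : seq I) (B : I -> set E), uniq s ->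
  (forall i, measurable (B i)) ->
  P (\big[setI/setT]_(i <- s) (Z i @^-1` B i)) =
  \prod_(i <- s) P (Z i @^-1` B i).

Definition past_sets (s : seq I) : set (set T) :=
  [set A | exists B : I -> set E, (forall i, measurable (B i)) /\
           A = \big[setI/setT]_(i <- s) (Z i @^-1` B i)].

(** The space [T] with the smaller sigma-algebra of the variables indexed by [s]: a measurable map
    out of [past s] is a function of the past. The generators [past_sets s] are closed under
    intersection, as uniqueness of measures requires. *)
Definition past (s : seq I) := g_sigma_algebraType (past_sets s).

Let mZB i B : measurable B -> measurable (Z i @^-1` B).
Proof. by move=> mB; rewrite -[X in measurable X]setTI; exact: mZ. Qed.

Lemma measurable_past (s : seq I) i : i \in s ->
  measurable_fun setT (Z i : past s -> E).
Proof.
move=> si _ A mA; rewrite setTI; apply: sub_sigma_algebra.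
exists (fun j => if j == i then A else setT); split.
  by move=> j; case: ifP.
rewrite (eq_bigr (fun j => if j == i then Z i @^-1` A else setT)); last first.
  by move=> j _; case: eqP => [->|_]//; rewrite preimage_setT.
rewrite -big_mkcond/= (eq_bigr (fun=> Z i @^-1` A))//.
elim: s si => // j s IH; rewrite inE big_cons.
case: (eqVneq j i) => [->|_] /=.
  have [/IH <- _|/negbTE si _] := boolP (i \in s); first by rewrite setIid.
  by rewrite big1_seq ?setIT// => k /andP[/eqP ->]; rewrite si.
by move=> /IH.
Qed.

(** For fixed [B], the finite measures sending A to P(A and Z_i in B) and to P(A) P(Z_i in B) agree
    on the intersection-stable generators of the past, hence on all of it. *)
Lemma past_split d1 (E1 : measurableType d1) (s : seq I) i (U : T -> E1) Z' :
  uniq (i :: s) -> measurable_fun setT (U : past s -> E1) ->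
  measurable_fun setT Z' ->
  (forall B, measurable B -> P (Z i @^-1` B) = P (Z' @^-1` B)) ->
  joint_split U (Z i) Z'.
Proof.
move=> /= /andP[si us] mU mZ' ZZ'.
have sub : past_sets s `<=` measurable.
  by move=> _ [B [mB ->]]; apply: measurable_bigI => j; exact: mZB.
have sub' : <<s past_sets s >> `<=` measurable.
  by apply: smallest_sub => //; exact: sigma_algebra_measurable.
have mUA A : measurable A -> <<s past_sets s >> (U @^-1` A).
  by move=> mA; rewrite -[U @^-1` A]setTI; exact: mU.
split; [|exact: mZ|exact: mZ'|].
  by move=> _ A mA; rewrite setTI; apply: sub'; exact: mUA.
move=> A B mA mB; rewrite -ZZ'//.
have mB' := mZB i mB.
pose m1 : {measure set T -> \bar R} := mrestr P mB'.
have fP : P (Z i @^-1` B) \is a fin_num by exact: fin_num_measure.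
pose m2 : {measure set T -> \bar R} :=
  mscale (NngNum (fine_ge0 (measure_ge0 P (Z i @^-1` B)))) P.
have m2E X : m2 X = P X * P (Z i @^-1` B).
  by rewrite /m2 /= /mscale /= fineK// muleC.
rewrite -m2E -[LHS]/(m1 (U @^-1` A)).
apply: (g_sigma_algebra_measure_unique (past_sets s) sub (fun=> setT)) => //.
- move=> _; exists (fun=> setT); split => //.
  by rewrite big1// => j _; rewrite preimage_setT.
- by rewrite bigcup_const.
- move=> _ _ [B1 [mB1 ->]] [B2 [mB2 ->]].
  exists (fun j => B1 j `&` B2 j); split; first by move=> j; exact: measurableI.
  by rewrite -big_split; apply: eq_bigr => j _; rewrite preimage_setI.
- move=> _ [B1 [mB1 ->]]; rewrite m2E /m1 /= /mrestr.
  (* Inserting [B] in slot [i] leaves the other slots unchanged because [i] is not in [s];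
     independence for [i :: s] then gives the product. *)
  pose B2 j := if j == i then B else B1 j.
  have mB2 j : measurable (B2 j) by rewrite /B2; case: ifP.
  have ne j : j \in s -> B2 j = B1 j.
    by rewrite /B2; case: eqP => // -> js; rewrite js in si.
  have -> : \big[setI/setT]_(j <- s) (Z j @^-1` B1 j) =
            \big[setI/setT]_(j <- s) (Z j @^-1` B2 j).
    by apply: eq_big_seq => j /ne ->.
  rewrite [RHS]muleC.
  have := @indepZ (i :: s) B2; rewrite /= si us => /(_ isT mB2).
  rewrite !big_cons {1 3}/B2 eqxx setIC => ->; congr (_ * _).
  by rewrite indepZ.
- move=> _; rewrite /m1 /= /mrestr setTI.
  by apply: le_lt_trans (probability_le1 P mB') _; rewrite ltry.
- exact: mUA.
Qed.

End independence.

(** * Rosenthal-type moment bounds *)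

Ltac mfun := repeat first
  [ assumption
  | exact: measurable_cst
  | exact: measurable_id
  | exact: measurable_fst
  | exact: measurable_snd
  | exact: measurable_coord
  | solve [match goal with H : forall _, measurable_fun _ _ |- _ => exact: H end]
  | match goal with
    | |- measurable_fun _ (fun _ => EFin _) => apply/measurable_EFinP
    | |- measurable_fun _ (EFin \o _) => apply/measurable_EFinP
    end
  | apply: measurable_funD
  | apply: measurable_funB
  | apply: measurable_funM
  | apply: measurable_funN
  | apply: measurable_funX
  | apply: measurable_sum => ?
  | apply: (measurableT_comp (@normr_measurable _ setT))
  | apply: (measurableT_comp (measurable_powR _)) ].

Ltac nneg := repeat first
  [ assumption
  | exact: ler01
  | exact: ler0n
  | exact: powR_ge0
  | exact: sqr_ge0
  | exact: normr_ge0
  | exact: sqrtr_ge0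
  | rewrite lee_fin
  | apply: integral_ge0 => ? _
  | apply: addr_ge0
  | apply: mulr_ge0
  | rewrite invr_ge0
  | apply: adde_ge0
  | apply: mule_ge0
  | apply: exprn_ge0
  | apply: ltW; assumption
  | done ].

Section nonneg_integrals.
Import HBNNSimple.
Context {R : realType} d (T : measurableType d) (P : {measure set T -> \bar R}).
Local Open Scope ereal_scope.

(* Unlike [ge0_le_integral], no measurability: the integral is a supremum of simple functions. *)
Lemma ge0_integral_mono (f g : T -> \bar R) :
  (forall x, 0 <= f x) -> (forall x, f x <= g x) ->
  \int[P]_x f x <= \int[P]_x g x.
Proof.
move=> f0 fg.
have g0 x : 0 <= g x by exact: le_trans (f0 x) (fg x).
rewrite !ge0_integralTE//; apply: ereal_sup_le => _ [h hf <-].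
exists h => // x.
exact: le_trans (hf x) (fg x).
Qed.

End nonneg_integrals.

Section nonneg_real_integrals.
Context {R : realType} d (T : measurableType d) (P : {measure set T -> \bar R}).
Implicit Types f g : T -> R.

Lemma integral_addr f g :
  measurable_fun setT f -> measurable_fun setT g ->
  (forall w, 0 <= f w) -> (forall w, 0 <= g w) ->
  (\int[P]_w (f w + g w)%:E = \int[P]_w (f w)%:E + \int[P]_w (g w)%:E)%E.
Proof.
move=> mf mg f0 g0; under eq_integral do rewrite EFinD.
apply: ge0_integralD => //; try exact/measurable_EFinP.
  by move=> w _; rewrite lee_fin.
by move=> w _; rewrite lee_fin.
Qed.

Lemma integral_scaler f (c : R) :
  measurable_fun setT f -> (forall w, 0 <= f w) -> 0 <= c ->
  (\int[P]_w (c * f w)%:E = c%:E * \int[P]_w (f w)%:E)%E.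
Proof.
move=> mf f0 c0; under eq_integral do rewrite EFinM.
apply: ge0_integralZl_EFin => //; last exact/measurable_EFinP.
by move=> w _; rewrite lee_fin.
Qed.

End nonneg_real_integrals.

Lemma prob_integral_cst {R : realType} d (T : measurableType d)
  (P : probability T R) (c : \bar R) : (\int[P]_w c = c)%E.
Proof. by rewrite integral_cst//= probability_setT mule1. Qed.

Section iterated.
Context {R : realType} d1 d2 (T1 : measurableType d1) (T2 : measurableType d2).
Local Open Scope ereal_scope.

Lemma measurable_integral_snd (m2 : {sigma_finite_measure set T2 -> \bar R})
    (f : T1 * T2 -> \bar R) :
  measurable_fun setT f -> (forall x, 0 <= f x) ->
  measurable_fun setT (fun x => \int[m2]_y f (x, y)).
Proof. by move=> mf f0; exact: (measurable_fun_fubini_tonelli_F f). Qed.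

End iterated.

Lemma measurable_sum_in {R : realType} d (T : measurableType d) (I : eqType)
    (s : seq I) (h : I -> T -> R) :
  (forall i, i \in s -> measurable_fun setT (h i)) ->
  measurable_fun setT (fun x => \sum_(i <- s) h i x).
Proof.
elim: s => [_|i s IH mh].
  by rewrite (_ : (fun _ => _) = cst 0)//; apply/funext => x; rewrite big_nil.
rewrite (_ : (fun _ => _) = fun x => h i x + \sum_(j <- s) h j x); last first.
  by apply/funext => x; rewrite big_cons.
apply: measurable_funD.
  by apply: mh; rewrite mem_head.
by apply: IH => j js; apply: mh; rewrite inE js orbT.
Qed.

Section centered.
Context {R : realType} d (T : measurableType d) (P : probability T R).
Local Open Scope ereal_scope.

(** This is how expansions are integrated: [c] is the constant part, [b] the signed part of mean
    zero, [g] a nonnegative remainder. If [g] has infinite integral the bound is trivial; otherwise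
    [f] is dominated by an integrable function and the integral is linear. *)
Lemma ge0_integral_le_centered (f g b : T -> R) (c : R) :
  measurable_fun setT f -> measurable_fun setT g ->
  (forall w, (0 <= f w)%R) -> (forall w, (0 <= g w)%R) ->
  P.-integrable setT (EFin \o b) -> \int[P]_w (b w)%:E = 0 ->
  (forall w, (f w <= c + b w + g w)%R) ->
  \int[P]_w (f w)%:E <= c%:E + \int[P]_w (g w)%:E.
Proof.
move=> mf mg f0 g0 ib b0 fle.
have [goo|] := ltP (\int[P]_w (g w)%:E) +oo; last first.
  by rewrite leye_eq => /eqP ->; rewrite addey// leey.
have ig : P.-integrable setT (EFin \o g).
  apply/integrableP; split; first exact/measurable_EFinP.
  by under eq_integral do rewrite /= ger0_norm//.
have ic : P.-integrable setT (EFin \o cst c).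
  by apply: finite_measure_integrable_cst.
have icb : P.-integrable setT ((EFin \o cst c) \+ (EFin \o b)).
  exact: integrableD.
have icbg : P.-integrable setT ((EFin \o cst c) \+ (EFin \o b) \+ (EFin \o g)).
  exact: integrableD.
have if_ : P.-integrable setT (EFin \o f).
  apply: le_integrable icbg => //; first exact/measurable_EFinP.
  move=> w _ /=; rewrite lee_fin ger0_norm//.
  by apply: le_trans (fle w) _; exact: ler_norm.
apply: (@le_trans _ _ (\int[P]_w (((EFin \o cst c) \+ (EFin \o b) \+ (EFin \o g)) w))).
  by apply: le_integral => // w _ /=; rewrite lee_fin.
rewrite integralD// integralD//= b0 adde0 integral_cst//= probability_setT mule1.
exact: lexx.
Qed.

End centered.

Section power_inequalities.
Context {R : realType}.
Implicit Types (x y a b r : R).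

(** Young's inequality for the product of y^r and 1, with exponents 1/r and 1/(1-r). *)
Lemma powR_le_affine r y : 0 < r <= 1 -> 0 <= y -> y `^ r <= 1 + r * (y - 1).
Proof.
move=> /andP[r0]; rewrite le_eqVlt => /predU1P[->|r1] y0.
  by rewrite powRr1//; lra.
have r1' : 0 < 1 - r by lra.
have := @conjugate_powR R (y `^ r) 1 r^-1 (1 - r)^-1 (powR_ge0 _ _) ler01.
rewrite !invr_gt0 !invrK => /(_ r0 r1') H.
have := H ltac:(ring); rewrite -powRrM mulfV ?gt_eqF// powRr1// powR1.
by move=> H'; lra.
Qed.

Lemma powR2D a r : 0 <= a -> 0 < r -> a `^ (2 + r) = a ^+ 2 * a `^ r.
Proof.
by move=> a0 r0; rewrite powRD ?powR_mulrn//; apply/implyP => /eqP; lra.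
Qed.

(** For |x| <= 1, factor out (1 + x)^2 and use concavity of the power delta; what remains is
    polynomial. For x > 1 the last term dominates, with 8 = 2^3 from |1 + x| <= 2 |x|. The exact
    linear term is what vanishes later on integration. *)
Lemma powR_norm1D (delta x : R) : 0 < delta <= 1 ->
  `|1 + x| `^ (2 + delta) <=
    1 + (2 + delta) * x + 4 * x ^+ 2 + 8 * `|x| `^ (2 + delta).
Proof.
move=> /andP[d0 d1].
have q0 : 0 <= 2 + delta by lra.
have X0 := powR_ge0 `|x| (2 + delta).
have [x1|x1] := ltP x (-1).
  have : `|1 + x| `^ (2 + delta) <= `|x| `^ (2 + delta).
    apply: ge0_ler_powR; rewrite ?nnegrE ?normr_ge0//.
    by rewrite !ltr0_norm; lra.
  by move=> H; nra.
have [x2|x2] := ltP 1 x.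
  have : `|1 + x| `^ (2 + delta) <= (2 * `|x|) `^ (2 + delta).
    apply: ge0_ler_powR; rewrite ?nnegrE ?normr_ge0//.
    by rewrite !gtr0_norm; lra.
  rewrite powRM//.
  have : (2 : R) `^ (2 + delta) <= 2 `^ 3%:R by apply: ler_powR; lra.
  rewrite powR_mulrn// => H1 H2.
  by nra.
rewrite ger0_norm; last lra.
rewrite powR2D//; last lra.
have H := @powR_le_affine delta (1 + x) ltac:(by rewrite d0 d1) ltac:(lra).
apply: (@le_trans _ _ ((1 + x) ^+ 2 * (1 + delta * x))).
  by apply: ler_wpM2l; [exact: sqr_ge0|lra].
rewrite -subr_ge0.
have -> : 1 + (2 + delta) * x + 4 * x ^+ 2 + 8 * `|x| `^ (2 + delta)
  - (1 + x) ^+ 2 * (1 + delta * x) =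
  x ^+ 2 * (3 - 2 * delta - delta * x) + 8 * `|x| `^ (2 + delta) by ring.
by apply: addr_ge0; [apply: mulr_ge0; [exact: sqr_ge0|nra]|lra].
Qed.

(* The coefficient of [b] is q |a|^(q-1) sgn a; at [a = 0] it is 0 since Rocq has [/ 0 = 0]. *)
Lemma powR_normD (delta a b : R) : 0 < delta <= 1 ->
  `|a + b| `^ (2 + delta) <=
    `|a| `^ (2 + delta) + ((2 + delta) * `|a| `^ (2 + delta) / a) * b
    + (4 * `|a| `^ delta * b ^+ 2 + 8 * `|b| `^ (2 + delta)).
Proof.
move=> dl; have /andP[d0 d1] := dl.
have q0 : 2 + delta != 0 by lra.
have [->|a0] := eqVneq a 0.
  rewrite add0r normr0 !powR0//; last lra.
  by have := powR_ge0 `|b| (2 + delta); rewrite !(mulr0, mul0r, add0r); lra.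
have -> : a + b = a * (1 + b / a) by field.
rewrite normrM powRM//.
have H := powR_norm1D (b / a) dl.
apply: le_trans (ler_wpM2l (powR_ge0 `|a| _) H) _.
have E1 : `|a| `^ (2 + delta) * (b / a) ^+ 2 = `|a| `^ delta * b ^+ 2.
  rewrite powR2D// real_normK ?num_real// expr_div_n.
  by rewrite mulrACA mulrCA mulrA -mulrA [_ ^+ 2 * _]mulrC; field.
have E2 : `|a| `^ (2 + delta) * `|b / a| `^ (2 + delta) = `|b| `^ (2 + delta).
  by rewrite -powRM// -normrM mulrCA mulfV// mulr1.
rewrite -E2 -(mulrA 4) -E1.
by rewrite le_eqVlt; apply/orP; left; apply/eqP; field.
Qed.

Lemma powR_le1D y r : 0 <= r <= 1 -> 0 <= y -> y `^ r <= 1 + y.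
Proof.
move=> /andP[r0 r1] y0; have [y1|y1] := leP 1 y.
  by apply: le_trans (ler1_powR y1 r1) _; lra.
have : y `^ r <= 1 `^ r by apply: ge0_ler_powR; rewrite ?nnegrE//; lra.
by rewrite powR1; lra.
Qed.

Lemma powR_sqr_half x r : 0 <= x -> (x ^+ 2) `^ (r / 2) = x `^ r.
Proof.
by move=> x0; rewrite -powR_mulrn// -powRrM; congr (_ `^ _); field.
Qed.

(** Trades the power delta for a square at the scale of a variance bound [v], since the second
    moment of a partial sum is what the Rosenthal induction controls directly. *)
Lemma powR_le_scaled (delta v s : R) : 0 < delta <= 1 -> 0 < v ->
  `|s| `^ delta <= v `^ (delta / 2) * (1 + s ^+ 2 / v).
Proof.
move=> /andP[d0 d1] v0.
have -> : `|s| `^ delta = v `^ (delta / 2) * (s ^+ 2 / v) `^ (delta / 2).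
  rewrite -powRM ?divr_ge0 ?sqr_ge0 ?(ltW v0)// mulrC divfK ?gt_eqF//.
  by rewrite -[s ^+ 2]real_normK ?num_real// powR_sqr_half.
apply: ler_wpM2l; first exact: powR_ge0.
by apply: powR_le1D; [apply/andP; split; lra|rewrite divr_ge0 ?sqr_ge0 ?ltW].
Qed.

End power_inequalities.

Section independent_sums.
Context {R : realType} d (T : measurableType d) (P : probability T R).
Context d' (E : measurableType d') (I : eqType) (Z : I -> T -> E).
Hypothesis mZ : forall i, measurable_fun setT (Z i).
Hypothesis indepZ : forall (s : seq I) (B : I -> set E), uniq s ->
  (forall i, measurable (B i)) ->
  P (\big[setI/setT]_(i <- s) (Z i @^-1` B i)) =
  (\prod_(i <- s) P (Z i @^-1` B i))%E.
Variable phi : I -> E -> R.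
Hypothesis mphi : forall i, measurable_fun setT (phi i).

Let S s w := \sum_(i <- s) phi i (Z i w).

Let mpZ i : measurable_fun setT (fun w => phi i (Z i w)).
Proof. exact: measurableT_comp. Qed.

Lemma measurable_indep_sum s : measurable_fun setT (S s).
Proof. by apply: measurable_sum. Qed.

Lemma indep_sum_split i s : uniq (i :: s) -> joint_split P (S s) (Z i) (Z i).
Proof.
move=> u; apply: (past_split mZ indepZ u) => //.
apply: measurable_sum_in => j js.
by apply: measurableT_comp => //; exact: measurable_past.
Qed.

Lemma indep_sum_integral i s (psi : R -> \bar R) : uniq (i :: s) ->
  measurable_fun setT psi -> (forall x, 0 <= psi x)%E ->
  (\int[P]_w psi (S (i :: s) w) =
   \int[P]_w \int[P]_w1 psi (S s w + phi i (Z i w1))%R)%E.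
Proof.
move=> u mpsi psi0.
rewrite -(@joint_split_integral _ _ _ _ _ _ _ _ _ _ _
  (fun z : R * E => psi (z.1 + phi i z.2)) (indep_sum_split u))//.
- by apply: eq_integral => w _; rewrite /S big_cons addrC.
- apply: measurableT_comp => //; apply: measurable_funD => //.
  exact: measurableT_comp.
Qed.

Hypothesis iphi : forall i, P.-integrable setT (fun w => (phi i (Z i w))%:E).
Hypothesis phi0 : forall i, (\int[P]_w (phi i (Z i w))%:E = 0)%E.
Variable sigma2 : I -> R.
Hypothesis phi2 : forall i,
  (\int[P]_w ((phi i (Z i w)) ^+ 2)%:E <= (sigma2 i)%:E)%E.

Let linear_integrable c i :
  P.-integrable setT (EFin \o (fun w => c * phi i (Z i w))).
Proof.
rewrite (_ : _ \o _ = fun w => (c%:E * (phi i (Z i w))%:E)%E).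
  exact: integrableZl.
by apply/funext => w /=; rewrite EFinM.
Qed.

Let linear_int0 c i : (\int[P]_w (c * phi i (Z i w))%:E = 0)%E.
Proof.
under eq_integral do rewrite EFinM.
by rewrite integralZl// phi0 mule0.
Qed.

(** The cross term is linear in the newest summand, which is centred and independent of the
    others. *)
Lemma indep_sum_sqr s : uniq s ->
  (\int[P]_w ((S s w) ^+ 2)%:E <= (\sum_(i <- s) sigma2 i)%:E)%E.
Proof.
elim: s => [_|i s IH u].
  rewrite big_nil; under eq_integral do rewrite /S big_nil expr0n.
  by rewrite integral0.
rewrite (indep_sum_integral (psi := fun x => (x ^+ 2)%:E) u)//; last first.
- by move=> x; rewrite lee_fin sqr_ge0.
- by mfun.
apply: (@le_trans _ _ (\int[P]_w (((S s w) ^+ 2)%:E + (sigma2 i)%:E))%E).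
  apply: ge0_integral_mono => w; first by apply: integral_ge0 => *; rewrite lee_fin sqr_ge0.
  apply: (@le_trans _ _ (((S s w) ^+ 2)%:E +
    \int[P]_w1 ((phi i (Z i w1)) ^+ 2)%:E)%E); last first.
    by rewrite leeD2l.
  apply: (@ge0_integral_le_centered _ _ _ _ _ _
    (fun w1 => 2 * S s w * phi i (Z i w1))) => //.
  - by apply: measurable_funX; apply: measurable_funD.
  - exact: measurable_funX.
  - by move=> w1; rewrite sqr_ge0.
  - by move=> w1; rewrite sqr_ge0.
  - by move=> w1; rewrite le_eqVlt; apply/orP; left; apply/eqP; ring.
have s0 : (0 <= (sigma2 i)%:E)%E.
  by apply: le_trans (phi2 i); apply: integral_ge0 => *; rewrite lee_fin sqr_ge0.
rewrite ge0_integralD//; last 2 first.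
- by move=> w _; rewrite lee_fin sqr_ge0.
- by apply/measurable_EFinP; apply: measurable_funX; exact: measurable_indep_sum.
rewrite prob_integral_cst big_cons addrC EFinD.
by apply: leeD => //; apply: IH; case/andP: u.
Qed.

(** Induction on the summands through [powR_normD]: the linear term integrates to 0, and 4 |S|^delta
    sigma_i^2 is at most 4 sigma_i^2 v^(delta/2) (1 + S^2/v), of mean at most 8 sigma_i^2
    v^(delta/2) since E S^2 <= v. Keeping [v] fixed along the induction makes these contributions
    add up. *)
Lemma indep_sum_powR (delta v : R) s : 0 < delta <= 1 -> 0 < v -> uniq s ->
  \sum_(i <- s) sigma2 i <= v ->
  (\int[P]_w (`|S s w| `^ (2 + delta))%:E <=
   (8 * v `^ (delta / 2) * \sum_(i <- s) sigma2 i)%:E +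
   8%:E * \sum_(i <- s) \int[P]_w (`|phi i (Z i w)| `^ (2 + delta))%:E)%E.
Proof.
move=> dl v0; have /andP[d0 d1] := dl.
have s0 i : 0 <= sigma2 i.
  rewrite -lee_fin; apply: le_trans (phi2 i).
  by apply: integral_ge0 => *; rewrite lee_fin sqr_ge0.
have mabs r (f : T -> R) : measurable_fun setT f -> measurable_fun setT (fun w => `|f w| `^ r).
  by move=> mf; mfun.
have mS := measurable_indep_sum.
elim: s => [_ _|i s IH u].
  under eq_integral do rewrite /S big_nil normr0 powR0 ?lt0r_neq0 ?addr_gt0//.
  by rewrite integral0 !big_nil mulr0 mule0 adde0.
rewrite !big_cons => iv.
have sv : \sum_(j <- s) sigma2 j <= v by apply: le_trans iv; rewrite lerDr.
have us : uniq s by case/andP: u.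
rewrite (indep_sum_integral (psi := fun x => (`|x| `^ (2 + delta))%:E) u)//; last first.
- by mfun.
set B := (\int[P]_w (`|phi i (Z i w)| `^ (2 + delta))%:E)%E.
have B0 : (0 <= B)%E by apply: integral_ge0.
apply: (@le_trans _ _ (\int[P]_w ((`|S s w| `^ (2 + delta))%:E +
   ((4 * sigma2 i * v `^ (delta / 2) * (1 + (S s w) ^+ 2 / v))%:E + 8%:E * B)))%E).
  apply: ge0_integral_mono => w; first by apply: integral_ge0.
  apply: (@le_trans _ _ ((`|S s w| `^ (2 + delta))%:E +
    \int[P]_w1 (4 * `|S s w| `^ delta * (phi i (Z i w1)) ^+ 2 +
                8 * `|phi i (Z i w1)| `^ (2 + delta))%:E)%E).
    apply: (@ge0_integral_le_centered _ _ _ _ _ _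
      (fun w1 => (2 + delta) * `|S s w| `^ (2 + delta) / S s w * phi i (Z i w1))) => //.
    - by apply: mabs; exact: measurable_funD.
    - by apply: measurable_funD; apply: measurable_funM => //; [exact: measurable_funX|exact: mabs].
    - by move=> w1; nneg.
    - by move=> w1; exact: powR_normD.
  apply: leeD => //.
  rewrite integral_addr; [|by mfun; apply: mpZ|by mfun; apply: mpZ|by move=> *; nneg|by move=> *; nneg].
  rewrite integral_scaler; [|by mfun; apply: mpZ|by move=> *; nneg|by nneg].
  rewrite integral_scaler; [|by mfun; apply: mpZ|by move=> *; nneg|by nneg].
  rewrite leeD2r//.
  apply: (@le_trans _ _ ((4 * `|S s w| `^ delta)%:E * (sigma2 i)%:E)%E).
    by rewrite lee_wpmul2l//; nneg.
  rewrite -EFinM lee_fin.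
  have H := powR_le_scaled (S s w) dl v0.
  have := s0 i.
  set X := _ `^ delta in H *; set Y := _ `^ (delta / 2) in H *.
  move: H; set W := 1 + _ => H Si.
  have -> : 4 * sigma2 i * Y * W = 4 * (Y * W) * sigma2 i by ring.
  by rewrite ler_wpM2r// ler_wpM2l.
rewrite ge0_integralD; [|by []|by move=> *; nneg| | |]; last 3 first.
- by mfun; apply: mS.
- by move=> w _; nneg.
- by apply: emeasurable_funD => //; mfun; apply: mS.
rewrite ge0_integralD; [|by []|by move=> *; nneg| |by move=> *; nneg|]; last 2 first.
- by mfun; apply: mS.
- exact: measurable_cst.
rewrite prob_integral_cst.
have K : (\int[P]_w (4 * sigma2 i * v `^ (delta / 2) * (1 + (S s w) ^+ 2 / v))%:E
   <= (8 * v `^ (delta / 2) * sigma2 i)%:E)%E.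
  rewrite integral_scaler; [|by mfun; apply: mS|by move=> *; nneg|by nneg].
  have -> : 8 * v `^ (delta / 2) * sigma2 i = (4 * sigma2 i * v `^ (delta / 2)) * 2 by ring.
  rewrite [leRHS]EFinM lee_wpmul2l//; first by nneg.
  rewrite integral_addr; [|by []|by mfun; apply: mS|by []|by move=> *; nneg].
  rewrite prob_integral_cst.
  under eq_integral do rewrite mulrC.
  rewrite integral_scaler; [|by mfun; apply: mS|by move=> *; nneg|by nneg].
  have -> : (2 : R)%:E = (1 + v^-1%:E * v%:E)%E.
    by rewrite -EFinM mulVf ?gt_eqF// -EFinD.
  rewrite leeD2l// lee_wpmul2l//; first by nneg.
  by apply: le_trans (indep_sum_sqr us) _; rewrite lee_fin.
have IH' := IH us sv.
apply: le_trans (leeD IH' (leeD K (lexx _))) _.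
rewrite mulrDr (EFinD (8 * v `^ (delta / 2) * sigma2 i)).
have BS0 : (0 <= \sum_(j <- s) \int[P]_w (`|phi j (Z j w)| `^ (2 + delta))%:E)%E.
  by apply: sume_ge0 => j _; exact: integral_ge0.
rewrite (ge0_muleDr 8%:E B0 BS0).
rewrite addeACA.
rewrite le_eqVlt; apply/orP; left; apply/eqP.
by congr (_ + _)%E; rewrite addeC.
Qed.

End independent_sums.

(** * Gaussian measure *)

Section density.
Import HBNNSimple.
Context {R : realType} d (T : measurableType d).
Variables (mu nu : {measure set T -> \bar R}) (rho : T -> R).
Hypotheses (mrho : measurable_fun setT rho) (rho0 : forall x, 0 <= rho x).
Hypothesis nuE : forall A, measurable A ->
  (nu A = \int[mu]_(x in A) (rho x)%:E)%E.
Local Open Scope ereal_scope.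

Let integral_density_nnsfun (f : {nnsfun T >-> R}) :
  \int[nu]_x (f x)%:E = \int[mu]_x (f x * rho x)%:E.
Proof.
under [LHS]eq_integral do rewrite fimfunE -fsumEFin//.
rewrite [LHS]ge0_integral_fsum//; last 2 first.
- by move=> r; exact/measurable_EFinP/measurableT_comp.
- by move=> n x _; rewrite EFinM nnfun_muleindic_ge0.
under [RHS]eq_integral.
  move=> x _; rewrite fimfunE EFinM -fsumEFin// ge0_mule_fsuml; last first.
    by move=> r; rewrite EFinM nnfun_muleindic_ge0.
  over.
rewrite [RHS]ge0_integral_fsum//; last 2 first.
- move=> r; apply: emeasurable_funM; last exact/measurable_EFinP.
  exact/measurable_EFinP/measurableT_comp.
- move=> r x _; rewrite mule_ge0 ?lee_fin//.
  by have := nnfun_muleindic_ge0 f r x; rewrite -EFinM lee_fin.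
apply: eq_fsbigr => r _.
rewrite integralZl_indic_nnsfun// integral_indic//= setIT nuE//.
have [r0|r0] := ltP r 0%R.
  rewrite preimage_nnfun0// integral_set0 mule0.
  by under eq_integral do rewrite indic0 mulr0 mul0e; rewrite integral0.
rewrite (integral_mkcond (f @^-1` [set r])).
rewrite -ge0_integralZl_EFin//; last 2 first.
- by move=> x _; rewrite erestrict_ge0// => y _; rewrite lee_fin.
- by apply/(measurable_restrictT _ _).1 => //; apply/measurable_funTS/measurable_EFinP.
apply: eq_integral => x _; rewrite /restrict/= /patch indicE.
by case: ifPn => _; rewrite ?mulr1 ?mulr0 ?mul0e ?mule0.
Qed.

Lemma integral_density (f : T -> \bar R) :
  measurable_fun setT f -> (forall x, 0 <= f x) ->
  \int[nu]_x f x = \int[mu]_x (f x * (rho x)%:E).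
Proof.
move=> mf f0; pose f_ := nnsfun_approx measurableT mf.
transitivity (lim (\int[nu]_x (f_ n x)%:E @[n --> \oo])).
  rewrite -monotone_convergence//=.
  - apply: eq_integral => ? /[!inE] xD; apply/esym/cvg_lim => //=.
    exact: cvg_nnsfun_approx.
  - by move=> n; exact/measurable_EFinP/measurable_funTS.
  - by move=> n ? _; rewrite lee_fin.
  - by move=> ? _ ? ? mn; rewrite lee_fin; exact/lefP/nd_nnsfun_approx.
transitivity (lim (\int[mu]_x ((f_ n x)%:E * (rho x)%:E) @[n --> \oo])).
  by apply: congr_lim; apply/funext => n /=; rewrite integral_density_nnsfun.
rewrite -monotone_convergence//=.
- apply: eq_integral => x _; apply/cvg_lim => //=.
  apply: cvgeZr => //; exact: cvg_nnsfun_approx.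
- move=> n; apply: emeasurable_funM; last exact/measurable_EFinP.
  exact/measurable_EFinP/measurable_funTS.
- by move=> n ? _; rewrite mule_ge0 ?lee_fin.
- move=> x _ ? ? mn; rewrite lee_wpmul2r ?lee_fin//; exact/lefP/nd_nnsfun_approx.
Qed.

End density.

Section affine_substitution.
Context {R : realType}.
Local Notation mu := (@lebesgue_measure R).
Local Open Scope ereal_scope.

Let aff (c b : R) (y : R) : measurableTypeR R := (c + b * y)%R.

Let maff c b : measurable_fun setT (aff c b : measurableTypeR R -> measurableTypeR R).
Proof. by apply: measurable_funD => //; exact: measurable_funM. Qed.

Lemma lebesgue_measure_affine (c b : R) (A : set R) : (0 < b)%R ->
  measurable A -> mu A = b%:E * mu (aff c b @^-1` A).
Proof.
move=> b0 mA.
pose aff_ : {mfun measurableTypeR R >-> measurableTypeR R} :=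
  HB.pack (aff c b) (isMeasurableFun.Build _ _ _ _ _ (maff c b)).
pose nu0 : {measure set (measurableTypeR R) -> \bar R} :=
  mscale (NngNum (ltW b0)) (pushforward mu aff_).
pose nu := nu0 (maff c b).
suff H : forall X, ocitv X -> mu X = nu X.
  by rewrite (@lebesgue_measure_unique R nu H).
move=> _ [[u v]] _ <-.
rewrite /nu /nu0 /= /mscale /= /pushforward /=.
have -> : aff c b @^-1` `]u, v]%classic = `]((u - c) / b)%R, ((v - c) / b)%R]%classic.
  apply/seteqP; split => y /=; rewrite /aff !in_itv/=.
    by rewrite ltr_pdivrMr// ler_pdivlMr// ltrBlDl lerBrDl (mulrC y).
  by rewrite ltr_pdivrMr// ler_pdivlMr// ltrBlDl lerBrDl (mulrC y).
rewrite !lebesgue_measure_itv/= !lte_fin ltr_pM2r ?invr_gt0// ltrD2r.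
case: ifPn => _; last by rewrite mule0.
by rewrite -EFinB -EFinB -EFinM; congr (_%:E); field; rewrite gt_eqF.
Qed.

Lemma integral_affine (c b : R) (f : R -> \bar R) : (0 < b)%R ->
  measurable_fun setT f -> (forall x, 0 <= f x) ->
  \int[mu]_x f x = b%:E * \int[mu]_y f (c + b * y)%R.
Proof.
move=> b0 mf f0.
pose aff_ : {mfun measurableTypeR R >-> measurableTypeR R} :=
  HB.pack (aff c b) (isMeasurableFun.Build _ _ _ _ _ (maff c b)).
pose nu0 : {measure set (measurableTypeR R) -> \bar R} :=
  mscale (NngNum (ltW b0)) (pushforward mu aff_).
pose nu := nu0 (maff c b).
rewrite (eq_measure_integral nu); last first.
  by move=> A mA _; rewrite /= (@lebesgue_measure_affine c b).
rewrite ge0_integral_mscale//=; congr (_ * _).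
by rewrite ge0_integral_pushforward.
Qed.

End affine_substitution.

Section gaussian.
Context {R : realType}.
Local Notation mu := (@lebesgue_measure R).
Local Notation gamma := (@normal_prob R 0 1).
Local Notation pdf := (@normal_pdf R).
Local Open Scope ereal_scope.

Lemma integral_normal_prob m s (f : R -> \bar R) :
  measurable_fun setT f -> (forall x, 0 <= f x) ->
  \int[normal_prob m s]_x f x = \int[mu]_x (f x * (pdf m s x)%:E).
Proof.
move=> mf f0; apply: integral_density => //; first exact: measurable_normal_pdf.
by move=> x; exact: normal_pdf_ge0.
Qed.

(** Both sides are the density at (x, u) of a centred Gaussian pair with unit variances and
    correlation [a], which is symmetric in the two variables. *)
Lemma normal_pdf_conv (a b x u : R) : (0 < b)%R -> (a ^+ 2 + b ^+ 2 = 1)%R ->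
  (pdf 0 1 x * pdf (a * x) b u = pdf 0 1 u * pdf (a * u) b x)%R.
Proof.
move=> b0 ab; rewrite !normal_pdfE ?oner_neq0 ?gt_eqF//.
rewrite mulrACA [RHS]mulrACA; congr (_ * _)%R.
rewrite /normal_fun -!expRD; congr expR.
have a2 : (a ^+ 2 = 1 - b ^+ 2)%R by rewrite -ab addrK.
have : (b != 0)%R by rewrite gt_eqF.
rewrite !subr0 => b1.
apply: (@mulfI _ (b ^+ 2 * 2)%R); first by rewrite mulf_neq0// expf_neq0.
rewrite -(mulr_natl (1 ^+ 2)%R 2) -(mulr_natl (b ^+ 2)%R 2) expr1n.
have -> : (b ^+ 2 * 2 * (- x ^+ 2 / (2 * 1) + - (u - a * x) ^+ 2 / (2 * b ^+ 2)) =
  - x ^+ 2 * b ^+ 2 - u ^+ 2 + 2 * a * u * x - a ^+ 2 * x ^+ 2)%R by field.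
have -> : (b ^+ 2 * 2 * (- u ^+ 2 / (2 * 1) + - (x - a * u) ^+ 2 / (2 * b ^+ 2)) =
  - u ^+ 2 * b ^+ 2 - x ^+ 2 + 2 * a * u * x - a ^+ 2 * u ^+ 2)%R by field.
by rewrite a2; ring.
Qed.

Lemma normal_pdf_affine (c b y : R) : (0 < b)%R ->
  (b * pdf c b (c + b * y) = pdf 0 1 y)%R.
Proof.
move=> b0; rewrite !normal_pdfE ?oner_neq0 ?gt_eqF// /normal_peak /normal_fun.
rewrite subr0 addrAC subrr add0r expr1n mul1r mulrA.
congr (_ * expR _)%R.
  rewrite -mulrnAr sqrtrM ?sqr_ge0// sqrtr_sqr gtr0_norm//.
  by rewrite invfM mulrA mulfV ?mul1r// gt_eqF.
by rewrite -(mulr_natl (b ^+ 2)%R 2) -(mulr_natl 1%R 2); field; rewrite gt_eqF.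
Qed.

(* Integrate out [y] by completing the square. *)
Lemma gaussian_rotation (a b : R) (f : R -> \bar R) :
  (0 < b)%R -> (a ^+ 2 + b ^+ 2 = 1)%R ->
  measurable_fun setT f -> (forall x, 0 <= f x) ->
  \int[gamma]_x \int[gamma]_y f (a * x + b * y)%R = \int[gamma]_u f u.
Proof.
move=> b0 ab mf f0.
have mpdf m s : measurable_fun setT (pdf m s) by exact: measurable_normal_pdf.
have pdf0 m s x : (0 <= pdf m s x)%R by exact: normal_pdf_ge0.
have E1 x : \int[gamma]_y f (a * x + b * y)%R =
    \int[mu]_u (f u * (pdf (a * x) b u)%:E).
  rewrite integral_normal_prob; [|by apply: measurableT_comp => //; mfun|by []].
  rewrite (@integral_affine R (a * x) b (fun u => f u * (pdf (a * x) b u)%:E))//; last 2 first.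
  - by apply: emeasurable_funM => //; exact/measurable_EFinP.
  - by move=> u; rewrite mule_ge0 ?lee_fin.
  rewrite -ge0_integralZl_EFin//; last 3 first.
  - by move=> y _; rewrite mule_ge0 ?lee_fin.
  - apply: emeasurable_funM; last by apply/measurable_EFinP/measurableT_comp => //; mfun.
    by apply: measurableT_comp => //; mfun.
  - exact: ltW.
  apply: eq_integral => y _; rewrite muleCA -EFinM normal_pdf_affine//.
rewrite integral_normal_prob; last 2 first.
- rewrite (_ : (fun _ => _) = (fun x => \int[gamma]_y f (a * x + b * y)%R))//.
  apply: (@measurable_integral_snd _ _ _ _ _ gamma (fun z : R * R => f (a * z.1 + b * z.2)%R)) => //.
  by apply: measurableT_comp => //; mfun.
- by move=> x; exact: integral_ge0.
(* By [normal_pdf_conv] the joint density can be read with [u] as the first variable; the inner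
   integral over [x] is then that of the N(a u, b^2) density, which is 1. *)
pose g (z : R * R) := f z.2 * (pdf 0 1 z.2)%:E * (pdf (a * z.2) b z.1)%:E.
have mpdf2 : measurable_fun setT (fun z : R * R => pdf (a * z.2) b z.1).
  rewrite (_ : (fun _ => _) = (fun z : R * R => pdf 0 b (z.1 - a * z.2))).
    by apply: measurableT_comp => //; mfun.
  apply/funext => z; rewrite !normal_pdfE ?gt_eqF// /normal_fun.
  by rewrite subr0.
have mg : measurable_fun setT g.
  apply: emeasurable_funM; last by apply/measurable_EFinP.
  apply: emeasurable_funM; first by apply: measurableT_comp => //; mfun.
  by apply/measurable_EFinP/measurableT_comp => //; mfun.
have g0 z : 0 <= g z by rewrite /g !mule_ge0 ?lee_fin.
transitivity (\int[mu]_x \int[mu]_u g (x, u)).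
  apply: eq_integral => x _; rewrite E1.
  rewrite muleC -ge0_integralZl_EFin; [|by []|by move=> u _; rewrite mule_ge0 ?lee_fin| |exact: pdf0]; last first.
    apply: emeasurable_funM; first exact: mf.
    by apply/measurable_EFinP; exact: mpdf.
  apply: eq_integral => u _; rewrite /g /= muleCA -muleA -!EFinM.
  by rewrite normal_pdf_conv.
rewrite fubini_tonelli// [RHS]integral_normal_prob//.
apply: eq_integral => u _; rewrite /g /=.
rewrite ge0_integralZl; [|by []| | |by rewrite mule_ge0 ?lee_fin]; last 2 first.
- by apply/measurable_EFinP; exact: mpdf.
- by move=> x _; rewrite lee_fin; exact: pdf0.
by rewrite integral_normal_pdf mule1.
Qed.

Let K := Num.sqrt (2 * pi)%R : R.

Let pdfE s x : (0 < s)%R -> (pdf 0 s x = (s * K)^-1 * expR (- x ^+ 2 / (s ^+ 2 * 2)))%R.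
Proof.
move=> s0; rewrite normal_pdfE ?gt_eqF// /normal_peak /normal_fun subr0 mulr_natr.
rewrite -mulrnAr sqrtrM ?sqr_ge0// sqrtr_sqr gtr0_norm//.
by rewrite /K mulr_natl.
Qed.

Let K1 : (1 <= K)%R.
Proof.
rewrite -sqrtr1 ler_sqrt; first by have := @pi_ge2 R; lra.
by have := @pi_ge2 R; lra.
Qed.

Lemma normal_pdf_le1 x : (pdf 0 1 x <= 1)%R.
Proof.
rewrite pdfE// mul1r mulr_ile1 ?invr_ge0 ?expR_ge0//.
- by apply: le_trans K1.
- by rewrite invf_le1//; apply: lt_le_trans K1.
- rewrite -[leRHS]expR0 ler_expR expr1n mul1r mulNr oppr_le0.
  by rewrite mulr_ge0 ?sqr_ge0.
Qed.

(* For s near 1, e^(-x^2/2s^2) >= e^(-x^2/2) (1 - (1/s^2 - 1) x^2/2); integrating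
   bounds the second moment from below when s < 1 and from above when s > 1. *)
Let pdf_scale s x : (0 < s)%R ->
  (pdf 0 1 x <= s * pdf 0 s x + (s ^- 2 - 1) / 2 * (x ^+ 2 * pdf 0 1 x))%R.
Proof.
move=> s0; rewrite !pdfE//.
have K0 : (0 < K)%R by apply: lt_le_trans K1.
have -> : (s * ((s * K)^-1 * expR (- x ^+ 2 / (s ^+ 2 * 2))) =
  K^-1 * expR (- x ^+ 2 / (s ^+ 2 * 2)))%R by field; rewrite !gt_eqF.
rewrite mul1r expr1n mul1r.
have -> : ((- x ^+ 2 / (s ^+ 2 * 2)) = - x ^+ 2 / 2 + - ((s ^- 2 - 1) / 2 * x ^+ 2))%R.
  by field; rewrite gt_eqF.
rewrite expRD.
have := expR_ge1Dx (- ((s ^- 2 - 1) / 2 * x ^+ 2)).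
set E := expR (- x ^+ 2 / 2); set F := expR (- _).
have E0 : (0 < K^-1 * E)%R by rewrite mulr_gt0 ?invr_gt0 ?expR_gt0.
move=> H.
have := ler_wpM2l (ltW E0) H.
set c := ((s ^- 2 - 1) / 2)%R; lra.
Qed.

Let m2 := \int[gamma]_x (x ^+ 2)%:E.

Let m2E : m2 = \int[mu]_x (x ^+ 2 * pdf 0 1 x)%:E.
Proof.
rewrite /m2 integral_normal_prob//; first by mfun.
by move=> x; rewrite lee_fin sqr_ge0.
Qed.

Let mx2 : measurable_fun setT (fun x : R => x ^+ 2 * pdf 0 1 x)%R.
Proof. by apply: measurable_funM; [mfun|exact: measurable_normal_pdf]. Qed.

Let x20 (x : R) : (0 <= x ^+ 2 * pdf 0 1 x)%R.
Proof. by rewrite mulr_ge0 ?sqr_ge0 ?normal_pdf_ge0. Qed.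

Let int_spdf s : (0 < s)%R -> \int[mu]_x (s * pdf 0 s x)%:E = s%:E.
Proof.
move=> s0; rewrite integral_scaler ?ltW//; last 2 first.
- exact: measurable_normal_pdf.
- by move=> x; exact: normal_pdf_ge0.
by rewrite integral_normal_pdf mule1.
Qed.

Let m2_lower s : (0 < s < 1)%R -> 1 <= s%:E + ((s ^- 2 - 1) / 2)%:E * m2.
Proof.
move=> /andP[s0 s1].
have c0 : (0 <= (s ^- 2 - 1) / 2)%R.
  rewrite mulr_ge0 ?invr_ge0// subr_ge0 invf_ge1 ?exprn_gt0//.
  by rewrite expr_le1// ltW.
rewrite m2E -integral_scaler// -(int_spdf s0) -integral_addr//; last 4 first.
- by apply: measurable_funM => //; exact: measurable_normal_pdf.
- exact: measurable_funM.
- by move=> x; rewrite mulr_ge0 ?normal_pdf_ge0 ?ltW.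
- by move=> x; rewrite mulr_ge0.
rewrite -(@integral_normal_pdf R 0 1).
apply: ge0_integral_mono => x; first by rewrite lee_fin normal_pdf_ge0.
by rewrite lee_fin; exact: pdf_scale.
Qed.

Let m2_upper s : (1 < s)%R -> 1 + ((1 - s ^- 2) / 2)%:E * m2 <= s%:E.
Proof.
move=> s1; have s0 : (0 < s)%R by apply: lt_trans s1.
have c0 : (0 <= (1 - s ^- 2) / 2)%R.
  rewrite mulr_ge0 ?invr_ge0// subr_ge0 invf_le1 ?exprn_gt0//.
  by rewrite expr_ge1// ltW.
rewrite m2E -integral_scaler// -(int_spdf s0) -(@integral_normal_pdf R 0 1).
rewrite -integral_addr//; last 4 first.
- exact: measurable_normal_pdf.
- exact: measurable_funM.
- by move=> x; exact: normal_pdf_ge0.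
- by move=> x; rewrite mulr_ge0.
apply: ge0_integral_mono => x.
  by rewrite lee_fin addr_ge0 ?normal_pdf_ge0// mulr_ge0.
by rewrite lee_fin; have := pdf_scale x s0; lra.
Qed.

Lemma gaussian_moment2 : m2 = 1.
Proof.
have m20 : 0 <= m2 by apply: integral_ge0 => x _; rewrite lee_fin sqr_ge0.
have fm2 : m2 \is a fin_num.
  rewrite ge0_fin_numE//; have := m2_upper (ltr1n R 2).
  have [//|] := ltP m2 +oo; rewrite leye_eq => /eqP ->.
  by rewrite gt0_muley ?addey// lte_fin; lra.
have [m mE] : exists m, m2 = m%:E by exists (fine m2); rewrite fineK.
rewrite mE; congr (_%:E); apply/eqP; rewrite eq_le; apply/andP; split.
- apply/ler_addgt0Pr => e e0.
  (* For this [s] the bound amounts to m <= 2 s^2 / (s + 1), which is at most 2 s - 1 = 1 + e. The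
     other half is the mirror image with s = 1 - e / 2. *)
  have := @m2_upper (1 + e / 2)%R ltac:(lra).
  rewrite mE -EFinM -EFinD lee_fin.
  set s := (1 + e / 2)%R => H.
  have s1 : (1 < s)%R by rewrite /s; lra.
  have s0 : (0 < s)%R by lra.
  have -> : (e = 2 * (s - 1))%R by rewrite /s; field.
  move: H.
  have -> : (1 + (1 - s ^- 2) / 2 * m = 1 + (s - 1) * ((s + 1) * m / (2 * s ^+ 2)))%R.
    by field; rewrite gt_eqF.
  rewrite -lerBrDl -[leRHS]mulr1 ler_pM2l ?subr_gt0// ler_pdivrMr; last by nra.
  by rewrite mul1r; nra.
- apply/ler_addgt0Pr => e e0.
  have [e2|e2] := leP 1%R e.
    by move: m20; rewrite mE lee_fin; lra.
  have := @m2_lower (1 - e / 2)%R ltac:(apply/andP; split; lra).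
  rewrite mE -EFinM -EFinD lee_fin.
  set s := (1 - e / 2)%R => H.
  have s1 : (s < 1)%R by rewrite /s; lra.
  have s0 : (0 < s)%R by rewrite /s; lra.
  have -> : (e = 2 * (1 - s))%R by rewrite /s; field.
  move: H.
  have -> : (s + (s ^- 2 - 1) / 2 * m = s + (1 - s) * ((s + 1) * m / (2 * s ^+ 2)))%R.
    by field; rewrite gt_eqF.
  rewrite -lerBlDl -[leLHS]mulr1 ler_pM2l ?subr_gt0// ler_pdivlMr; last by nra.
  by rewrite mul1r; nra.
Qed.

End gaussian.

(** * Symmetry and moments of the standard Gaussian *)

Section gaussian_moments.
Context {R : realType}.
Local Notation mu := (@lebesgue_measure R).
Local Notation gamma := (@normal_prob R 0 1).
Local Notation pdf := (@normal_pdf R).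
Local Open Scope ereal_scope.

Lemma lebesgue_integral_reflect (f : R -> \bar R) :
  measurable_fun setT f -> (forall x, 0 <= f x) ->
  \int[mu]_x f (- x)%R = \int[mu]_x f x.
Proof.
move=> mf f0.
have mN : measurable_fun setT (-%R : measurableTypeR R -> measurableTypeR R).
  exact: (@measurable_funN _ R _ setT id).
pose N_ : {mfun measurableTypeR R >-> measurableTypeR R} :=
  HB.pack (-%R : measurableTypeR R -> measurableTypeR R) (isMeasurableFun.Build _ _ _ _ _ mN).
pose nu0 : {measure set (measurableTypeR R) -> \bar R} := pushforward mu N_.
pose nu := nu0 mN.
rewrite [RHS](eq_measure_integral nu); last first.
  by move=> A mA _; exact/esym/lebesgue_measureN.
by rewrite /nu /nu0 ge0_integral_pushforward.
Qed.

Let mpdf m s : measurable_fun setT (pdf m s).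
Proof. exact: measurable_normal_pdf. Qed.

Let pdf0 m s x : (0 <= pdf m s x)%R.
Proof. exact: normal_pdf_ge0. Qed.

Lemma gaussian_reflect (f : R -> \bar R) :
  measurable_fun setT f -> (forall x, 0 <= f x) ->
  \int[gamma]_x f (- x)%R = \int[gamma]_x f x.
Proof.
move=> mf f0.
rewrite integral_normal_prob; [|by apply: measurableT_comp => //; exact: measurable_funN|by []].
rewrite [RHS]integral_normal_prob//.
rewrite -[RHS]lebesgue_integral_reflect.
- apply: eq_integral => x _; congr (_ * (_)%:E).
  by rewrite !normal_pdfE ?oner_neq0// /normal_fun !subr0 sqrrN.
- by apply: emeasurable_funM => //; apply/measurable_EFinP; exact: mpdf.
- by move=> x; rewrite mule_ge0 ?lee_fin.
Qed.

(** On [0, 1] the density is at most 1 and the integrand has the primitive 2 sqrt (x + e), which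
    contributes at most 2; likewise on [-1, 0]; elsewhere the integrand is at most 1. Hence 5 = 2 +
    2 + 1, uniformly in [e], whose role is to keep the integrand continuous at 0. *)
Lemma gaussian_integral_sqrt (e : R) : (0 < e)%R ->
  \int[gamma]_x ((Num.sqrt (`|x| + e))^-1)%:E <= 5%:E.
Proof.
move=> e0.
have mk : measurable_fun setT (fun x : R => (Num.sqrt (`|x| + e))^-1)%R.
  rewrite (_ : (fun x : R => _) = (fun x : R => (`|x| + e) `^ (- 2^-1))%R).
    by mfun.
  apply/funext => x; rewrite powRN powR12_sqrt//.
  by rewrite addr_ge0// ltW.
pose g (x : R) := ((Num.sqrt (`|x| + e))^-1 * \1_(`[0%R, 1%R]%classic : set R) x)%R.
have g0 x : (0 <= g x)%R by rewrite /g mulr_ge0 ?invr_ge0 ?sqrtr_ge0.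
have mg : measurable_fun setT g.
  by apply: measurable_funM => //; exact: measurable_indic.
have mgN : measurable_fun setT (fun x : R => g (- x)%R).
  by apply: measurableT_comp => //; exact: measurable_funN.
have Ig : \int[mu]_x (g x)%:E <= 2%:E.
  have -> : \int[mu]_x (g x)%:E = \int[mu]_(x in `[0%R, 1%R]) ((Num.sqrt (x + e))^-1)%:E.
    rewrite [RHS]integral_mkcond; apply: eq_integral => x _.
    rewrite /g /restrict /patch indicE; case: ifPn => x01; rewrite ?mulr1 ?mulr0//.
    move: x01; rewrite inE/= in_itv/= => /andP[x0 _].
    by rewrite ger0_norm.
  have pos x : x \in `[0%R, 1%R] -> (0 < x + e)%R.
    by rewrite in_itv/= => /andP[x0 _]; lra.
  have cS (x : R) : (0 < x + e)%R -> {for x, continuous (fun x : R => Num.sqrt (x + e))}.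
    move=> xe; apply: continuous_comp; last exact: sqrt_continuous.
    by apply: cvgD; [exact: cvg_id|exact: cvg_cst].
  have dF (x : R) : (0 < x + e)%R ->
      is_derive x (1%R : R) (fun x : R => 2 * Num.sqrt (x + e))%R (Num.sqrt (x + e))^-1%R.
    move=> xe.
    have H : is_derive x (1%R:R) (fun x : R => x + e)%R 1%R.
      by rewrite -[X in is_derive _ _ _ X]addr0; apply: is_deriveD.
    have H1 : is_derive (x + e)%R (1%R:R) Num.sqrt (2 * Num.sqrt (x + e))^-1%R by exact: is_derive1_sqrt.
    have H2 := @is_derive1_comp _ Num.sqrt (fun x : R => x + e)%R x _ _ H1 H.
    have H3 := is_deriveZ 2 H2.
    rewrite (_ : (Num.sqrt (x + e))^-1 = 2 *: ((2 * Num.sqrt (x + e))^-1 * 1))%R//.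
    by rewrite mulr1 /GRing.scale/= invfM mulrA mulfV ?mul1r.
  rewrite (@continuous_FTC2 _ _ (fun x : R => 2 * Num.sqrt (x + e))%R)//.
  - rewrite -EFinB lee_fin add0r.
    have : (Num.sqrt (1 + e) <= Num.sqrt e + 1)%R.
      have sqe := sqr_sqrtr (ltW e0); have s0 := sqrtr_ge0 e.
      by rewrite -[leRHS]ger0_norm -?sqrtr_sqr ?ler_wsqrtr//; nra.
    by lra.
  - apply: continuous_in_subspaceT => x /set_mem /= /pos xe.
    apply: cvgV; first by rewrite gt_eqF// sqrtr_gt0.
    exact: cS.
  - have cF x : x \in `[0%R, 1%R] -> {for x, continuous (fun x : R => (2 * Num.sqrt (x + e))%R : R)}.
      move=> /pos xe; apply: cvgM; first exact: cvg_cst.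
      exact: cS.
    split.
    + move=> x x01; have xe : (0 < x + e)%R by apply: pos; exact: subset_itv_oo_cc.
      exact: (@ex_derive _ _ _ _ _ _ _ (dF _ xe)).
    + by apply: cvg_at_right_filter; apply: cF; rewrite in_itv/= lexx ler01.
    + by apply: cvg_at_left_filter; apply: cF; rewrite in_itv/= lexx ler01.
  - move=> x x01; have xe : (0 < x + e)%R by apply: pos; exact: subset_itv_oo_cc.
    by rewrite derive1E (@derive_val _ _ _ _ _ _ _ (dF _ xe)).
have gle (x : R) : ((Num.sqrt (`|x| + e))^-1 <= g x + g (- x) + 1)%R.
  rewrite /g normrN !indicE !mem_setE !in_itv/=.
  set k := (Num.sqrt _)^-1%R.
  have k0 : (0 <= k)%R by rewrite invr_ge0.
  have [x1|x1] := leP `|x|%R 1%R.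
    have [x0|x0] := leP 0%R x.
      rewrite ger0_norm// in x1; rewrite x1/= mulr1.
      have : (0 <= k * (0 <= - x <= 1)%R%:R)%R by rewrite mulr_ge0.
      by lra.
    rewrite ltr0_norm// in x1; rewrite x1 oppr_ge0 (ltW x0)/= mulr1 mulr0.
    by lra.
  have : (k <= 1)%R.
    rewrite /k invf_le1 ?sqrtr_gt0 ?ltr_wpDl//.
    by rewrite -[leLHS]sqrtr1 ler_wsqrtr//; lra.
  have : (0 <= k * (0 <= x <= 1)%R%:R)%R by rewrite mulr_ge0.
  have : (0 <= k * (0 <= - x <= 1)%R%:R)%R by rewrite mulr_ge0.
  by lra.
apply: (@le_trans _ _ (\int[gamma]_x (g x)%:E + \int[gamma]_x (g (- (x : R))%R)%:E + \int[gamma]_x 1)).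
  have A x : (0 <= g x + g (- x))%R by rewrite addr_ge0.
  rewrite -integral_addr// -integral_addr//; last first.
    by apply: measurable_funD.
  apply: ge0_integral_mono => x; rewrite lee_fin ?invr_ge0 ?sqrtr_ge0//.
rewrite (gaussian_reflect (f := fun x => (g x)%:E)); [|exact/measurable_EFinP|by move=> x; rewrite lee_fin].
rewrite prob_integral_cst.
have Jg : \int[gamma]_x (g x)%:E <= 2%:E.
  apply: le_trans Ig; rewrite integral_normal_prob; [|by apply/measurable_EFinP|by move=> x; rewrite lee_fin].
  apply: ge0_integral_mono => x; first by rewrite mule_ge0 ?lee_fin.
  by rewrite -EFinM lee_fin ler_piMr//; exact: normal_pdf_le1.
have -> : (5 : R)%:E = 2%:E + 2%:E + 1 by rewrite -!EFinD; congr (_%:E); ring.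
by apply: leeD => //; exact: leeD.
Qed.

(** Comparison with the density of variance 2: splitting exp(-x^2/2) in two equal factors, one
    absorbs x^8 because exp y >= y^4 / 4! at y = x^2/4, and the other is that density up to the
    ratio sqrt 2 of the peaks. *)
Lemma gaussian_moment8 : exists2 M : R, (0 <= M)%R &
  \int[gamma]_x (1 + x ^+ 8)%:E <= M%:E.
Proof.
pose s := Num.sqrt (2 : R).
have s0 : (0 < s)%R by rewrite sqrtr_gt0.
exists (1 + 16 ^+ 2 * 24 * s)%R; first by rewrite addr_ge0// !mulr_ge0// ltW.
rewrite integral_addr; [|by mfun|by mfun|by []|by move=> x; rewrite exprn_even_ge0].
rewrite prob_integral_cst EFinD leeD2l//.
rewrite integral_normal_prob; [|by mfun|by move=> x; rewrite lee_fin exprn_even_ge0].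
rewrite -[leRHS]mule1 -(@integral_normal_pdf R 0 s) -integral_scaler; last 3 first.
- exact: mpdf.
- exact: pdf0.
- by rewrite !mulr_ge0// ltW.
apply: ge0_integral_mono => x.
  by rewrite mule_ge0 ?lee_fin// exprn_even_ge0.
rewrite -EFinM lee_fin !normal_pdfE ?oner_neq0 ?gt_eqF// /normal_peak.
rewrite -mulrnAr sqrtrM ?sqr_ge0// sqrtr_sqr normr1 mul1r.
rewrite -mulrnAr sqrtrM ?sqr_ge0// sqrtr_sqr (gtr0_norm s0).
set p := Num.sqrt (pi *+ 2).
have p0 : (0 < p)%R by rewrite sqrtr_gt0 pmulrn_lgt0// pi_gt0.
have -> : (16 ^+ 2 * 24 * s * ((s * p)^-1 * normal_fun 0 s x) = p^-1 * (16 ^+ 2 * 24 * normal_fun 0 s x))%R.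
  by field; rewrite !gt_eqF.
rewrite mulrCA; apply: ler_wpM2l; first by rewrite invr_ge0 ltW.
rewrite /normal_fun subr0 /s sqr_sqrtr// expr1n.
have -> : (- x ^+ 2 / (1 *+ 2) = - x ^+ 2 / (2 *+ 2) - x ^+ 2 / 4)%R.
  have -> : (2 *+ 2 = 4 :> R)%R by rewrite -mulrnA.
  by field.
rewrite expRD mulrCA mulrC; apply: ler_wpM2r; first exact: expR_ge0.
rewrite expRN ler_pdivrMr ?expR_gt0//.
have x2 : (0 <= x ^+ 2 / 4)%R by rewrite mulr_ge0 ?sqr_ge0.
have := @expR_ge1Dxn R _ 3 x2.
rewrite (_ : 4`!%:R = 24 :> R)%R; last by rewrite !factS fact0.
set E := expR _.
have -> : ((x ^+ 2 / 4) ^+ 4 / 24 = x ^+ 8 / (16 ^+ 2 * 24) :> R)%R.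
  by rewrite expr_div_n -exprM; field.
by move=> H; lra.
Qed.

Lemma gaussian_le_moment8 (f : R -> R) (c M : R) : measurable_fun setT f ->
  (0 <= c)%R -> \int[gamma]_x (1 + x ^+ 8)%:E <= M%:E ->
  (forall x, 0 <= f x <= c * (1 + x ^+ 8))%R ->
  \int[gamma]_x (f x)%:E <= (c * M)%:E.
Proof.
move=> mf c0 HM fle.
have x8 (x : R) : (0 <= x ^+ 8)%R by rewrite exprn_even_ge0.
apply: (@le_trans _ _ (\int[gamma]_x (c * (1 + x ^+ 8))%:E)).
  by apply: ge0_integral_mono => x; rewrite lee_fin; case/andP: (fle x).
rewrite integral_scaler//; last 2 first.
- by mfun.
- by move=> x; rewrite addr_ge0.
by rewrite EFinM lee_wpmul2l.
Qed.

Lemma gaussian_integrable_id : gamma.-integrable setT (EFin \o (id : R -> R)).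
Proof.
have [M M0 HM] := gaussian_moment8.
apply/integrableP; split; first by apply/measurable_EFinP; exact: measurable_id.
apply: (@le_lt_trans _ _ (1 * M)%:E); last by rewrite ltry.
apply: (gaussian_le_moment8 (f := fun x => `|x|%R) _ _ HM) => //.
move=> x; rewrite normr_ge0/= mul1r.
have [x1|x1] := leP `|x|%R 1%R; first by have := @exprn_even_ge0 R 8 x isT; lra.
have -> : (x ^+ 8 = `|x| ^+ 8)%R by rewrite -normrX ger0_norm// exprn_even_ge0.
have : (`|x| <= `|x| ^+ 8)%R by rewrite ler_eXnr// ltW.
by lra.
Qed.

Lemma gaussian_mean : \int[gamma]_x x%:E = 0.
Proof.
have H := gaussian_integrable_id.
have f1 := integrable_pos_fin_num measurableT H.
rewrite [LHS]integralE.
have -> : \int[gamma]_x ((EFin \o (id : R -> R))^\- x) = \int[gamma]_x ((EFin \o (id : R -> R))^\+ x).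
  rewrite -(gaussian_reflect (f := (EFin \o (id : R -> R))^\+)).
  - by apply: eq_integral => x _; rewrite funenegE funeposE /= EFinN.
  - by apply: measurable_funepos; apply/measurable_EFinP; exact: measurable_id.
  - by move=> x; rewrite funeposE le_max lexx orbT.
by rewrite subee.
Qed.

End gaussian_moments.

(** * Rotations and linear forms of a standard Gaussian vector *)

Section gaussian_vectors.
Context {R : realType} d (T : measurableType d) (Q : probability T R) (p : nat).
Variable xi : 'I_p -> T -> R.
Hypothesis hxi : iid_std_normal Q xi.
Local Notation gamma := (@normal_prob R 0 1).
Local Open Scope ereal_scope.

Let mxi j : measurable_fun setT (xi j). Proof. by case: hxi. Qed.

Let lawxi j (B : set R) : measurable B -> Q (xi j @^-1` B) = gamma B.
Proof. by case: hxi => _ + _; exact. Qed.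

Let indepxi (s : seq 'I_p) (B : 'I_p -> set R) : uniq s ->
  (forall j, measurable (B j)) ->
  Q (\big[setI/setT]_(j <- s) (xi j @^-1` B j)) =
  \prod_(j <- s) Q (xi j @^-1` B j).
Proof. by case: hxi => _ _; exact. Qed.

Definition gauss_vec (w : T) : vec R p := fun j => xi j w.

Lemma measurable_gauss_vec : measurable_fun setT gauss_vec.
Proof. by apply: measurable_vec => a; exact: mxi. Qed.

Lemma integral_std_normal j (f : R -> \bar R) :
  measurable_fun setT f -> (forall x, 0 <= f x) ->
  \int[Q]_w f (xi j w) = \int[gamma]_x f x.
Proof.
move=> mf f0.
have mX : measurable_fun setT (xi j : T -> measurableTypeR R) by exact: mxi.
pose X_ : {mfun T >-> measurableTypeR R} :=
  HB.pack (xi j : T -> measurableTypeR R) (isMeasurableFun.Build _ _ _ _ _ mX).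
rewrite -(@ge0_integral_distribution _ _ _ _ _ Q X_ f)//.
by apply: eq_measure_integral => A mA _; exact: lawxi.
Qed.

Lemma integral_prod_std_normal (s : seq 'I_p) (k : 'I_p -> R -> \bar R) :
  uniq s -> (forall j, measurable_fun setT (k j)) ->
  (forall j x, 0 <= k j x) ->
  \int[Q]_w \prod_(j <- s) k j (xi j w) = \prod_(j <- s) \int[gamma]_x k j x.
Proof.
move=> us mk k0.
have prod0 (r : seq 'I_p) w : 0 <= \prod_(j <- r) k j (xi j w).
  by elim/big_ind: _ => // x y; exact: mule_ge0.
elim: s us => [_|i s IH].
  under eq_integral do rewrite big_nil.
  by rewrite big_nil prob_integral_cst.
move=> u; pose U w := \prod_(j <- s) k j (xi j w).
have mU : measurable_fun setT (U : past xi s -> \bar R).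
  suff H (r : seq 'I_p) : {subset r <= s} ->
      measurable_fun setT ((fun w => \prod_(j <- r) k j (xi j w)) : past xi s -> \bar R).
    exact: H.
  elim: r => [_|j r IHr jr].
    rewrite (_ : (fun _ => _) = cst 1); first exact: measurable_cst.
    by apply/funext => x; rewrite big_nil.
  rewrite (_ : (fun _ => _) = (fun w => k j (xi j w) * \prod_(j <- r) k j (xi j w))); last first.
    by apply/funext => x; rewrite big_cons.
  apply: emeasurable_funM; last by apply: IHr => x xr; apply: jr; rewrite inE xr orbT.
  have mj : measurable_fun setT (xi j : past xi s -> R).
    by apply: measurable_past; apply: jr; rewrite mem_head.
  exact: measurableT_comp (mk j) mj.
have spl := past_split mxi indepxi u mU (mxi i) (fun _ _ => erefl).
have [mU' _ _ _] := spl.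
(* The absolute value changes nothing on the products at hand but makes the function of the pair
   nonnegative everywhere, as [joint_split_integral] demands. *)
transitivity (\int[Q]_w (fun z : \bar R * R => k i z.2 * `|z.1|) (U w, xi i w)).
  by apply: eq_integral => w _; rewrite big_cons /= gee0_abs; last exact: prod0.
rewrite (joint_split_integral (phi := fun z : \bar R * R => k i z.2 * `|z.1|) spl); [|apply: emeasurable_funM|by move=> z; rewrite mule_ge0]; last 2 first.
- exact: measurableT_comp.
- by apply: measurableT_comp => //; exact: measurable_fst.
rewrite big_cons -IH; last by case/andP: u.
have ki : 0 <= \int[gamma]_x k i x by exact: integral_ge0.
rewrite -ge0_integralZl; [|by []|exact: mU'|by move=> w _; exact: prod0|by []].
apply: eq_integral => w _ /=.
rewrite ge0_integralZr; [|by []|by apply: measurableT_comp => //; exact: mxi|by move=> *; exact: k0|by []].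
by rewrite integral_std_normal// gee0_abs//; exact: prod0.
Qed.

Definition rectangles : set (set (vec R p)) :=
  [set A | exists B : 'I_p -> set R, (forall j, measurable (B j)) /\
    A = \big[setI/setT]_(j <- index_enum 'I_p) ((fun v : vec R p => v j) @^-1` B j)].

Let measurable_rectangle A : rectangles A -> measurable A.
Proof.
move=> [B [mB ->]]; apply: measurable_bigI => j.
by rewrite -[X in measurable X]setTI; exact: measurable_coord.
Qed.

Lemma vec_measurable_rectangles : @measurable _ (vec R p) = <<s rectangles >>.
Proof.
apply/seteqP; split; last first.
  apply: smallest_sub; first exact: sigma_algebra_measurable.
  exact: measurable_rectangle.
apply: smallest_sub; first exact: smallest_sigma_algebra.
move=> _ [a [A [mA ->]]]; apply: sub_sigma_algebra.
exists (fun j => if j == a then A else setT); split; first by move=> j; case: ifP.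
rewrite (bigD1_seq a) ?mem_index_enum ?index_enum_uniq//= eqxx big1 ?setIT//.
by move=> j /negbTE ->; rewrite preimage_setT.
Qed.

Lemma vec_measure_unique (m1 m2 : {measure set (vec R p) -> \bar R}) :
  m1 setT < +oo ->
  (forall B : 'I_p -> set R, (forall j, measurable (B j)) ->
   let A := \big[setI/setT]_(j <- index_enum 'I_p) ((fun v : vec R p => v j) @^-1` B j) in
   m1 A = m2 A) ->
  forall A, measurable A -> m1 A = m2 A.
Proof.
move=> fm H A mA.
apply: (measure_unique rectangles (fun=> setT)) => //.
- exact: vec_measurable_rectangles.
- move=> _ _ [B1 [mB1 ->]] [B2 [mB2 ->]].
  exists (fun j => B1 j `&` B2 j); split; first by move=> j; exact: measurableI.
  by rewrite -big_split; apply: eq_bigr => j _; rewrite preimage_setI.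
- move=> _; exists (fun=> setT); split => //.
  by rewrite big1// => j _; rewrite preimage_setT.
- by rewrite bigcup_const.
- by move=> _ [B [mB ->]]; exact: H.
Qed.

(** Finite measures that agree on rectangles agree everywhere, and on a rectangle both laws factor
    over the coordinates, where [gaussian_rotation] applies. *)
Lemma gauss_vec_rotation (a b : R) (f : vec R p -> \bar R) :
  (0 < b)%R -> (a ^+ 2 + b ^+ 2 = 1)%R ->
  measurable_fun setT f -> (forall v, 0 <= f v) ->
  \int[Q]_w \int[Q]_w1 f (fun j => (a * xi j w + b * xi j w1)%R) =
  \int[Q]_w f (gauss_vec w).
Proof.
move=> b0 ab mf f0.
pose rot (z : T * T) : vec R p := fun j => (a * xi j z.1 + b * xi j z.2)%R.
have mrot : measurable_fun setT rot.
  apply: measurable_vec => j; apply: measurable_funD; apply: measurable_funM => //.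
    by apply: measurableT_comp => //; exact: mxi.
  by apply: measurableT_comp => //; exact: mxi.
pose rot_ : {mfun (T * T)%type >-> vec R p} := HB.pack rot (isMeasurableFun.Build _ _ _ _ _ mrot).
pose xi_ : {mfun T >-> vec R p} :=
  HB.pack gauss_vec (isMeasurableFun.Build _ _ _ _ _ measurable_gauss_vec).
pose m10 : {measure set (vec R p) -> \bar R} := pushforward (Q \x Q)%E rot_.
pose m1 := m10 mrot.
pose m2 : {measure set (vec R p) -> \bar R} := distribution Q xi_.
have m12 A : measurable A -> m1 A = m2 A.
  apply: vec_measure_unique.
    rewrite (_ : m1 setT = (Q \x Q)%E ([set: T] `*` [set: T])); last by rewrite setXTT.
    by rewrite product_measure1E//= !probability_setT mule1 ltry.
  move=> B mB /=.
  set A1 := \big[_/_]_(j <- _) _.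
  have mA1 : measurable A1 by apply: measurable_rectangle; exists B.
  pose k j x := \int[gamma]_y (\1_(B j) (a * x + b * y)%R)%:E.
  have mlin x : measurable_fun setT (fun y : R => a * x + b * y)%R by mfun.
  have kE j x : k j x = Q (xi j @^-1` ((fun y => a * x + b * y)%R @^-1` B j)).
    have mC : measurable ((fun y => a * x + b * y)%R @^-1` B j).
      by rewrite -[X in measurable X]setTI; exact: mlin.
    rewrite lawxi// -[in RHS](setIT (_ @^-1` _)) -integral_indic//.
  rewrite /m1 /m10 /m2 /distribution /pushforward /= /product_measure1 /=.
  have -> : gauss_vec @^-1` A1 = \big[setI/setT]_(j <- index_enum 'I_p) (xi j @^-1` B j).
    rewrite /A1; elim: (index_enum _) => [|j r IH]; first by rewrite !big_nil preimage_setT.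
    by rewrite !big_cons preimage_setI IH.
  rewrite indepxi ?index_enum_uniq//.
  transitivity (\int[Q]_w \prod_(j <- index_enum 'I_p) k j (xi j w)).
    apply: eq_integral => w _.
    under eq_bigr do rewrite kE.
    rewrite -indepxi ?index_enum_uniq//; last first.
      by move=> j; rewrite -[X in measurable X]setTI; exact: mlin.
    congr (Q _); apply/seteqP; split => w1 /=; rewrite /xsection/= inE/=.
      rewrite /A1; elim: (index_enum _) => [|j r IH]; first by rewrite !big_nil.
      by rewrite !big_cons => -[h /IH h']; split.
    rewrite /A1; elim: (index_enum _) => [|j r IH]; first by rewrite !big_nil.
    by rewrite !big_cons => -[h /IH h']; split.
  rewrite integral_prod_std_normal ?index_enum_uniq//; last 2 first.
  - move=> j.
    apply: (@measurable_integral_snd _ _ _ _ _ gamma (fun z : R * R => (\1_(B j) (a * z.1 + b * z.2)%R)%:E)).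
      apply/measurable_EFinP; apply: (measurableT_comp (measurable_indic (mB j))).
      by mfun.
    by move=> z; rewrite lee_fin.
  - by move=> j x; apply: integral_ge0 => y _; rewrite lee_fin.
  apply: eq_bigr => j _.
  rewrite /k (gaussian_rotation (f := fun x => (\1_(B j) x)%:E))//; last first.
    by apply/measurable_EFinP; exact: measurable_indic.
  rewrite integral_indic; [|by []|exact: mB]; rewrite setIT; exact/esym/lawxi.
transitivity (\int[(Q \x Q)%E]_z f (rot z)).
  by rewrite fubini_tonelli1//; exact: measurableT_comp.
transitivity (\int[m1]_v f v).
  by rewrite /m1 /m10 ge0_integral_pushforward.
rewrite (eq_measure_integral m2); last by move=> A mA _; exact: m12.
by rewrite ge0_integral_distribution.
Qed.

(** The form is Gaussian with variance the sum of the c_j^2. Each new coordinate is merged with the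
    Gaussian obtained so far by a rotation, after dividing by the new standard deviation [s']. *)
Lemma integral_linear_form (c : 'I_p -> R) (s : seq 'I_p) (f : R -> \bar R) :
  uniq s -> measurable_fun setT f -> (forall x, 0 <= f x) ->
  \int[Q]_w f (\sum_(j <- s) c j * xi j w)%R =
  \int[gamma]_x f (Num.sqrt (\sum_(j <- s) c j ^+ 2) * x)%R.
Proof.
elim: s f => [|i s IH] f.
  move=> _ mf f0; rewrite big_nil sqrtr0.
  under eq_integral do rewrite big_nil.
  under [RHS]eq_integral do rewrite mul0r.
  by rewrite !prob_integral_cst.
move=> u mf f0.
have us : uniq s by case/andP: u.
have mphi j : measurable_fun setT (fun x : R => c j * x)%R by mfun.
have mf2 (g : R -> R) : measurable_fun setT g -> measurable_fun setT (fun x => f (g x)).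
  by move=> mg; exact: measurableT_comp mf mg.
rewrite (@indep_sum_integral _ _ _ _ _ _ _ _ mxi indepxi (fun j x => c j * x)%R mphi i s f)//.
set sg := Num.sqrt (\sum_(j <- s) c j ^+ 2).
have s2 : (0 <= \sum_(j <- s) c j ^+ 2)%R by apply: sumr_ge0 => j _; rewrite sqr_ge0.
transitivity (\int[gamma]_x \int[gamma]_y f (sg * x + c i * y)%R).
  have mg : measurable_fun setT (fun z : R * R => f (z.1 + c i * z.2)%R).
    by apply: measurableT_comp => //; mfun.
  rewrite -(IH (fun s => \int[gamma]_y f (s + c i * y)%R))//; last 2 first.
  - exact: (@measurable_integral_snd _ _ _ _ _ gamma _ mg).
  - by move=> x; exact: integral_ge0.
  apply: eq_integral => w _.
  rewrite (@integral_std_normal i (fun y => f (_ + c i * y)%R))//.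
  by apply: mf2; mfun.
rewrite big_cons.
(* [gaussian_rotation] asks for a positive second coefficient: a vanishing [c i] is treated apart
   and a negative one is reflected below. *)
have [ci0|ci0] := eqVneq (c i) 0%R.
  rewrite ci0 expr0n/= add0r; apply: eq_integral => x _.
  by under eq_integral do rewrite mul0r addr0; rewrite prob_integral_cst.
set s' := Num.sqrt (c i ^+ 2 + \sum_(j <- s) c j ^+ 2).
have ci2 : (0 < c i ^+ 2)%R by rewrite exprn_even_gt0.
have s'2 : (s' ^+ 2 = c i ^+ 2 + \sum_(j <- s) c j ^+ 2)%R.
  by rewrite sqr_sqrtr// addr_ge0// ltW.
have s'0 : (0 < s')%R by rewrite sqrtr_gt0 ltr_pwDl.
have E x : \int[gamma]_y f (sg * x + c i * y)%R = \int[gamma]_y f (sg * x + `|c i| * y)%R.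
  have [c0|c0] := leP 0%R (c i); first by rewrite ger0_norm.
  rewrite ltr0_norm// -[RHS]gaussian_reflect//; last by apply: mf2; mfun.
  by apply: eq_integral => y _; rewrite mulrNN.
under eq_integral do rewrite E.
rewrite -(@gaussian_rotation _ (sg / s') (`|c i| / s') (fun x => f (s' * x)%R)).
- apply: eq_integral => x _; apply: eq_integral => y _; congr f.
  by field; rewrite gt_eqF.
- by rewrite divr_gt0// normr_gt0.
- rewrite !expr_div_n real_normK ?num_real// -mulrDl /sg sqr_sqrtr//.
  by rewrite addrC -s'2 divff// expf_neq0// gt_eqF.
- by apply: mf2; mfun.
- by [].
Qed.

End gaussian_vectors.

(** * Anticoncentration of Gaussian quadratic forms *)

Section concave_count.
Context {R : realType}.

Lemma card_le_diameter (N : nat) (A : {set 'I_N}) (D : R) : 0 <= D ->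
  (forall i j : 'I_N, i \in A -> j \in A -> (i <= j)%N -> (j - i)%:R <= D) ->
  #|A|%:R <= D + 1.
Proof.
move=> D0 H; have [->|[i0 iA]] := set_0Vmem A; first by rewrite cards0 addr_ge0.
case: (arg_minnP (fun i : 'I_N => nat_of_ord i) iA) => m mA mle.
case: (arg_maxnP (fun i : 'I_N => nat_of_ord i) iA) => M MA Mge.
have mM : (m <= M)%N by exact: mle.
apply: (@le_trans _ _ (M - m).+1%:R); last by rewrite -natr1 lerD2r; exact: H.
rewrite ler_nat cardE -(size_map val) -(size_iota m (M - m).+1).
apply: uniq_leq_size; first by rewrite map_inj_uniq ?enum_uniq//; exact: val_inj.
move=> x /mapP[i]; rewrite mem_enum => Ai -> {x}.
rewrite mem_iota addnS ltnS subnKC//.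
by apply/andP; split; [exact: mle|exact: Mge].
Qed.

(** The product of the rotation weights sqrt (1 - s) and sqrt s; its graph is a semicircle of radius
    1/2. *)
Definition half_circle (s : R) := Num.sqrt (s * (1 - s)).

(** Compare squares. Let k be the half circle and m its chord value: the square of k at the
    intermediate point exceeds m^2 by l (1 - l) ((s - u)^2 + (k(s) - k(u))^2). Both values are at
    most 1/2, so their sum is at most 1 and the difference of squares is at most the difference. *)
Lemma sqrt_parabola_concave (s u l : R) : 0 <= s <= 1 -> 0 <= u <= 1 -> 0 <= l <= 1 ->
  (1 - l) * half_circle s + l * half_circle u + l * (1 - l) * (s - u) ^+ 2 <=
  half_circle ((1 - l) * s + l * u).
Proof.
move=> /andP[s0 s1] /andP[u0 u1] /andP[l0 l1].
set r := (1 - l) * s + l * u.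
have r0 : 0 <= r by rewrite /r addr_ge0// mulr_ge0//; lra.
have r1 : r <= 1 by rewrite /r; nra.
have K2 x : 0 <= x -> x <= 1 -> half_circle x ^+ 2 = x * (1 - x).
  by move=> x0 x1; rewrite sqr_sqrtr// mulr_ge0//; lra.
have K0 x : 0 <= half_circle x by exact: sqrtr_ge0.
have Kh x : 0 <= x -> x <= 1 -> half_circle x <= 1 / 2.
  move=> x0 x1; rewrite -(@ler_pXn2r _ 2)// ?nnegrE ?divr_ge0// K2//.
  by have := sqr_ge0 (x - 1 / 2); lra.
have As := K2 _ s0 s1; have Au := K2 _ u0 u1; have Ar := K2 _ r0 r1.
have Bs := Kh _ s0 s1; have Bu := Kh _ u0 u1; have Br := Kh _ r0 r1.
have Cs := K0 s; have Cu := K0 u; have Cr := K0 r.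
move: As Au Ar Bs Bu Br Cs Cu Cr.
set ks := half_circle s; set ku := half_circle u; set kr := half_circle r => As Au Ar Bs Bu Br Cs Cu Cr.
set m := (1 - l) * ks + l * ku.
have m0 : 0 <= m by rewrite /m addr_ge0// mulr_ge0//; lra.
have mh : m <= 1 / 2 by rewrite /m; nra.
have E : kr ^+ 2 - m ^+ 2 = l * (1 - l) * ((s - u) ^+ 2 + (ks - ku) ^+ 2).
  rewrite Ar /m.
  have -> : ((1 - l) * ks + l * ku) ^+ 2 =
    (1 - l) ^+ 2 * ks ^+ 2 + l ^+ 2 * ku ^+ 2 + 2 * l * (1 - l) * (ks * ku) by ring.
  have -> : (ks - ku) ^+ 2 = ks ^+ 2 + ku ^+ 2 - 2 * (ks * ku) by ring.
  by rewrite As Au /r; ring.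
have l01 : 0 <= l * (1 - l) by rewrite mulr_ge0//; lra.
have P : l * (1 - l) * (s - u) ^+ 2 <= kr ^+ 2 - m ^+ 2.
  by rewrite E ler_wpM2l// lerDl sqr_ge0.
have P0 : 0 <= l * (1 - l) * (s - u) ^+ 2 by rewrite mulr_ge0// sqr_ge0.
have mk : m <= kr by rewrite -(@ler_pXn2r _ 2)// -subr_ge0 (le_trans P0).
rewrite -/m -lerBrDl; apply: le_trans P _.
rewrite subr_sqr ler_piMr ?subr_ge0//; lra.
Qed.

(* q(sqrt(1-s) x + sqrt s y) for a quadratic form q with polar form g, A = q x, B = q y. *)
Definition arc_quad (A B g s : R) := (1 - s) * A + s * B + 2 * half_circle s * g.

(** Applied with [u] a maximiser over the grid. Writing F for the form along the arc and r = (1 - l)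
    s + l u, strong concavity and F(r) <= F(u) give F(r) - F(s) >= 2 g l (s - u)^2, and l >= l^2. *)
Lemma concave_gap (A B g s r u : R) : 0 < g -> 0 <= s -> 0 <= u -> s <= 1 -> u <= 1 ->
  (s < r < u) || (u < r < s) -> arc_quad A B g r <= arc_quad A B g u ->
  2 * g * (r - s) ^+ 2 <= arc_quad A B g r - arc_quad A B g s.
Proof.
move=> g0 s0 u0 s1 u1 sru Fru.
have us0 : u - s != 0.
  by apply/eqP => us; move: sru => /orP[/andP[? ?]|/andP[? ?]]; lra.
pose l := (r - s) / (u - s).
have rE : r = (1 - l) * s + l * u by rewrite /l; field.
have l01 : 0 < l < 1.
  rewrite /l; move: sru => /orP[/andP[h1 h2]|/andP[h1 h2]].
    by rewrite divr_gt0 ?subr_gt0//=; [rewrite ltr_pdivrMr; lra|lra].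
  have -> : (r - s) / (u - s) = (s - r) / (s - u) by field; lra.
  by rewrite divr_gt0 ?subr_gt0//=; [rewrite ltr_pdivrMr; lra|lra].
have /andP[l0 l1] := l01.
have := @sqrt_parabola_concave s u l ltac:(by rewrite s0) ltac:(by rewrite u0) ltac:(apply/andP; split; lra).
rewrite -rE => C.
have C' : (1 - l) * arc_quad A B g s + l * arc_quad A B g u + 2 * g * (l * (1 - l) * (s - u) ^+ 2) <= arc_quad A B g r.
  have -> : arc_quad A B g r = (1 - l) * ((1 - s) * A + s * B) + l * ((1 - u) * A + u * B) + 2 * g * half_circle r.
    by rewrite /arc_quad {1 2}rE; ring.
  have -> : (1 - l) * arc_quad A B g s + l * arc_quad A B g u + 2 * g * (l * (1 - l) * (s - u) ^+ 2) =
    (1 - l) * ((1 - s) * A + s * B) + l * ((1 - u) * A + u * B) + 2 * g *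
    ((1 - l) * half_circle s + l * half_circle u + l * (1 - l) * (s - u) ^+ 2) by rewrite /arc_quad; ring.
  by rewrite lerD2l ler_wpM2l// mulr_ge0// ltW.
have -> : (r - s) ^+ 2 = l ^+ 2 * (s - u) ^+ 2 by rewrite rE; ring.
have P : 0 <= g * (s - u) ^+ 2 by rewrite mulr_ge0 ?sqr_ge0// ltW.
set Fs := arc_quad A B g s in C' *; set Fr := arc_quad A B g r in C' Fru *; set Fu := arc_quad A B g u in C' Fru.
have : (1 - l) * (2 * l * (g * (s - u) ^+ 2)) <= (1 - l) * (Fr - Fs) by nra.
rewrite ler_pM2l; last lra.
apply: le_trans.
have -> : 2 * g * (l ^+ 2 * (s - u) ^+ 2) = 2 * l * (l * (g * (s - u) ^+ 2)) by ring.
apply: ler_wpM2l; first by rewrite mulr_ge0// ltW.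
by rewrite ler_piMl// ltW.
Qed.

Definition near_level (t h x : R) : bool := `|x - t| <= h.

(** On either side of a maximiser, two grid points within [h] of the level differ in value by at
    most 2 h, hence by [concave_gap] in position by at most sqrt (h / g). Each side contributes N
    sqrt (h / g) + 1 points, the maximiser one more. *)
Lemma concave_count (N : nat) (A B g t h : R) : 0 < g -> 0 < h ->
  (#|[set k : 'I_N | near_level t h (arc_quad A B g (k.+1%:R / N%:R))]%SET|%:R <=
    2 * (N%:R * Num.sqrt (h / g)) + 3 :> R).
Proof.
move=> g0 h0; set K := finset _.
have D0 : 0 <= N%:R * Num.sqrt (h / g) by rewrite mulr_ge0 ?sqrtr_ge0.
have [->|[k0 _]] := set_0Vmem K; first by rewrite cards0; lra.
have N0 : (0 < N)%N by case: (N) k0 => [[]|].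
have N0' : (0 : R) < N%:R by rewrite ltr0n.
pose s (k : 'I_N) : R := k.+1%:R / N%:R.
have s0 k : 0 <= s k by rewrite divr_ge0.
have s1 k : s k <= 1 by rewrite ler_pdivrMr// mul1r ler_nat.
have slt i j : (s i < s j) = (i < j)%N by rewrite ltr_pM2r ?invr_gt0// ltr_nat.
have [m _ mmax] := arg_maxP (fun k => arc_quad A B g (s k)) (isT : predT k0).
pose Kl := [set k in K | (k < m)%N]%SET; pose Kr := [set k in K | (m < k)%N]%SET.
have gap (i j : 'I_N) : i \in K -> j \in K ->
    (s i < s j < s m) || (s m < s j < s i) -> `|s j - s i| <= Num.sqrt (h / g).
  rewrite !inE => iK jK ij.
  have := @concave_gap A B g (s i) (s j) (s m) g0 (s0 _) (s0 _) (s1 _) (s1 _) ij (mmax j isT).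
  move: iK; rewrite /near_level -/(s i) ler_norml => /andP[i1 i2].
  move: jK; rewrite /near_level -/(s j) ler_norml => /andP[j1 j2] H.
  have : g * (s j - s i) ^+ 2 <= h by lra.
  rewrite mulrC -ler_pdivlMr// => H'.
  by rewrite -sqrtr_sqr ler_wsqrtr.
have sub (i j : 'I_N) : (i <= j)%N -> s j - s i = (j - i)%:R / N%:R.
  by move=> ij; rewrite /s -mulrBl -natrB ?ltnS// subSS.
have Kl1 : #|Kl|%:R <= N%:R * Num.sqrt (h / g) + 1.
  apply: card_le_diameter => // i j; rewrite !inE => /andP[iK im] /andP[jK jm].
  rewrite leq_eqVlt => /orP[/eqP ->|ij]; first by rewrite subnn.
  have := gap i j; rewrite !inE => /(_ iK jK); rewrite !slt ij jm => /(_ isT).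
  rewrite (sub _ _ (ltnW ij)) ger0_norm ?divr_ge0//.
  by rewrite ler_pdivrMr// mulrC.
have Kr1 : #|Kr|%:R <= N%:R * Num.sqrt (h / g) + 1.
  apply: card_le_diameter => // i j; rewrite !inE => /andP[iK im] /andP[jK jm].
  rewrite leq_eqVlt => /orP[/eqP ->|ij]; first by rewrite subnn.
  have := gap j i; rewrite !inE => /(_ jK iK); rewrite !slt ij im orbT => /(_ isT).
  rewrite distrC (sub _ _ (ltnW ij)) ger0_norm ?divr_ge0//.
  by rewrite ler_pdivrMr// mulrC.
have : (#|K| <= #|Kl| + #|Kr| + 1)%N.
  have sK : K \subset Kl :|: Kr :|: [set m]%SET.
    apply/fintype.subsetP => k; rewrite !inE => ->/=.
    by rewrite -val_eqE/=; case: ltngtP.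
  apply: leq_trans (subset_leq_card sK) _.
  apply: leq_trans (leq_card_setU _ _) _; rewrite cards1 leq_add2r.
  exact: leq_card_setU.
rewrite -(@ler_nat R) !natrD => H.
by lra.
Qed.

(** For |g| >= h the previous count applies, to the opposite form if g < 0, and h / |g| <= 2 h /
    (|g| + h). For |g| < h the right side exceeds the trivial count [N]. The shift by [h] keeps the
    weight (|g| + h)^(-1/2) bounded. *)
Lemma quadratic_count (N : nat) (A B g t h : R) : 0 < h ->
  \sum_(k < N) (near_level t h (arc_quad A B g (k.+1%:R / N%:R)))%:R <=
    N%:R * (2 * Num.sqrt 2 * Num.sqrt h * (Num.sqrt (`|g| + h))^-1) + 3.
Proof.
move=> h0.
have sq (x : R) : 0 <= x -> Num.sqrt x ^+ 2 = x by exact: sqr_sqrtr.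
have main (A' B' g' t' : R) : h <= g' ->
    \sum_(k < N) (near_level t' h (arc_quad A' B' g' (k.+1%:R / N%:R)))%:R <=
    N%:R * (2 * Num.sqrt 2 * Num.sqrt h * (Num.sqrt (g' + h))^-1) + 3.
  move=> hg; have g0 : 0 < g' by exact: lt_le_trans hg.
  have := @concave_count N A' B' g' t' h g0 h0.
  rewrite -sum1_card natr_sum big_mkcond/=.
  rewrite (eq_bigr (fun k : 'I_N => (near_level t' h (arc_quad A' B' g' (k.+1%:R / N%:R)))%:R)); last first.
    by move=> k _; rewrite inE; case: (near_level _ _ _).
  move=> /le_trans; apply; rewrite lerD2r mulrCA ler_wpM2l// -!mulrA ler_wpM2l//.
  have gh0 : 0 < g' + h by rewrite addr_gt0.
  rewrite -sqrtrV ?(ltW gh0)// -sqrtrM ?(ltW h0)// -sqrtrM// ler_wsqrtr//.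
  by rewrite ler_pdivrMr// mulrA mulrAC ler_pdivlMr//; nra.
have [hg|hg] := leP h `|g|.
  have [g0|g0] := leP 0 g; first by rewrite ger0_norm// in hg *; exact: main.
  rewrite ltr0_norm// in hg *.
  have := main (- A) (- B) (- g) (- t) hg.
  rewrite (eq_bigr (fun k : 'I_N => (near_level t h (arc_quad A B g (k.+1%:R / N%:R)))%:R))// => k _.
  congr (_%:R : R); congr nat_of_bool; rewrite /near_level.
  have -> : arc_quad (- A) (- B) (- g) (k.+1%:R / N%:R) = - arc_quad A B g (k.+1%:R / N%:R).
    by rewrite /arc_quad; ring.
  by rewrite -opprD normrN.
apply: (@le_trans _ _ N%:R).
  rewrite -[leRHS]mulr_natl mulr1 -[X in _ <= X%:R](card_ord N) -sum1_card natr_sum.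
  by apply: ler_sum => k _; case: (near_level _ _ _).
apply: (@le_trans _ _ (N%:R * 1)); first by rewrite mulr1.
have gh : 0 < `|g| + h by rewrite ltr_wpDl.
rewrite -[leLHS]addr0 lerD// ler_wpM2l// ler_pdivlMr ?sqrtr_gt0// mul1r.
apply: (@le_trans _ _ (Num.sqrt 2 * Num.sqrt h)); last first.
  by rewrite -mulrA ler_peMl ?mulr_ge0 ?sqrtr_ge0// ler1n.
by rewrite -sqrtrM// ler_wsqrtr//; lra.
Qed.

End concave_count.

(** * Moments of order -1/2 of Gaussian forms *)

Section inverse_sqrt.
Context {R : realType}.

Let isq (x : R) := (Num.sqrt x)^-1.

(** The left side is the tangent at [m] of the convex function y^(-1/2). *)
Lemma inv_sqrt_tangent (m y : R) : 0 < m -> 0 < y ->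
  isq m * (3 / 2 - y / (2 * m)) <= isq y.
Proof.
move=> m0 y0; rewrite /isq.
have sm : 0 < Num.sqrt m by rewrite sqrtr_gt0.
have sy : 0 < Num.sqrt y by rewrite sqrtr_gt0.
rewrite -{2}(sqr_sqrtr (ltW m0)) -{1}(sqr_sqrtr (ltW y0)).
move: sm sy; set a := Num.sqrt m; set b := Num.sqrt y => a0 b0.
rewrite -subr_ge0.
have -> : b^-1 - a^-1 * (3 / 2 - b ^+ 2 / (2 * a ^+ 2)) =
  (b - a) ^+ 2 * (b + 2 * a) / (2 * a ^+ 3 * b) by field; rewrite !gt_eqF.
apply: divr_ge0; first by rewrite mulr_ge0 ?sqr_ge0// addr_ge0 ?mulr_ge0// ltW.
by rewrite !mulr_ge0 ?exprn_ge0// ltW.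
Qed.

Lemma weighted_mean_sqr (I : finType) (w x : I -> R) :
  (forall j, 0 <= w j) -> \sum_j w j = 1 ->
  (\sum_j w j * x j) ^+ 2 <= \sum_j w j * x j ^+ 2.
Proof.
move=> w0 w1; set m := \sum_j w j * x j.
have : 0 <= \sum_j w j * (x j - m) ^+ 2.
  by apply: sumr_ge0 => j _; rewrite mulr_ge0 ?sqr_ge0.
have -> : \sum_j w j * (x j - m) ^+ 2 =
    \sum_j w j * x j ^+ 2 - 2 * m * (\sum_j w j * x j) + m ^+ 2 * \sum_j w j.
  rewrite (eq_bigr (fun j => w j * x j ^+ 2 + - (2 * m * (w j * x j)) + m ^+ 2 * w j)); last first.
    by move=> j _; ring.
  by rewrite !big_split/= sumrN -!mulr_sumr.
by rewrite w1 -/m; lra.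
Qed.

(** Jensen for y^(-1/2), with the tangent taken at the root mean square plus [h]: the weighted mean
    of |x_j| lies below the root mean square, and y^(-1/2) is decreasing. *)
Lemma inv_sqrt_mean (I : finType) (w x : I -> R) (h : R) : 0 < h ->
  (forall j, 0 <= w j) -> \sum_j w j = 1 ->
  isq (Num.sqrt (\sum_j w j * x j ^+ 2) + h) <= \sum_j w j * isq (`|x j| + h).
Proof.
move=> h0 w0 w1; set m := Num.sqrt _ + h.
have m0 : 0 < m by rewrite ltr_wpDl ?sqrtr_ge0.
have im : 0 <= isq m by rewrite invr_ge0 sqrtr_ge0.
apply: (@le_trans _ _ (\sum_j w j * (isq m * (3 / 2 - (`|x j| + h) / (2 * m))))); last first.
  apply: ler_sum => j _; apply: ler_wpM2l => //.
  by apply: inv_sqrt_tangent => //; rewrite ltr_wpDl.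
have -> : \sum_j w j * (isq m * (3 / 2 - (`|x j| + h) / (2 * m))) =
    isq m * (3 / 2 * (\sum_j w j) - (\sum_j w j * `|x j| + h * \sum_j w j) / (2 * m)).
  rewrite (eq_bigr (fun j => isq m * (3 / 2) * w j + - (isq m * (2 * m)^-1 * (w j * `|x j|))
      + - (isq m * (2 * m)^-1 * h * w j))); last first.
    by move=> j _; field; rewrite gt_eqF.
  by rewrite !big_split/= !sumrN -!mulr_sumr; field; rewrite gt_eqF.
rewrite w1 !mulr1 -[leLHS]mulr1 ler_wpM2l//.
have H : \sum_j w j * `|x j| + h <= m.
  rewrite lerD2r; have := @weighted_mean_sqr I w (fun j => `|x j|) w0 w1.
  under [X in _ <= X -> _]eq_bigr do rewrite real_normK ?num_real//.
  move=> /ler_wsqrtr; rewrite sqrtr_sqr; apply: le_trans; exact: ler_norm.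
have : (\sum_j w j * `|x j| + h) / (2 * m) <= 1 / 2.
  by rewrite ler_pdivrMr ?mulr_gt0//; lra.
by lra.
Qed.

(** If h <= sg, factor out [sg] and use the bound 5; otherwise the integrand is at most h^(-1/2).
    The larger of [sg] and [h] is at least half of their sum, which costs a factor 2 at most. *)
Lemma gaussian_scaled_sqrt (sg h : R) : 0 <= sg -> 0 < h ->
  (\int[@normal_prob R 0 1]_x (isq (`|sg * x| + h))%:E <= (10 * isq (sg + h))%:E)%E.
Proof.
move=> s0 h0.
have sh0 : 0 < sg + h by rewrite ltr_wpDl.
have key (c : R) : 0 < c -> sg + h <= 2 * c -> isq c <= 2 * isq (sg + h).
  move=> c0 hc; rewrite /isq ler_pdivlMr ?sqrtr_gt0// mulrC ler_pdivrMr ?sqrtr_gt0//.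
  apply: (@le_trans _ _ (Num.sqrt (2 ^+ 2 * c))); first by apply: ler_wsqrtr; lra.
  by rewrite sqrtrM// sqrtr_sqr ger0_norm.
have [hs|hs] := leP h sg.
  have sg0 : 0 < sg by exact: lt_le_trans hs.
  have E x : isq (`|sg * x| + h) = isq sg * isq (`|x| + h / sg).
    rewrite /isq -invfM -sqrtrM ?(ltW sg0)// normrM (gtr0_norm sg0).
    by congr (Num.sqrt _)^-1; field; rewrite gt_eqF.
  under eq_integral do rewrite E.
  have hsg : 0 < h / sg by rewrite divr_gt0.
  rewrite integral_scaler; last 3 first.
  - rewrite (_ : (fun x => _) = (fun x : R => (`|x| + h / sg) `^ (- 2^-1))); first by mfun.
    by apply/funext => x; rewrite powRN powR12_sqrt// addr_ge0// ltW.
  - by move=> x; rewrite invr_ge0 sqrtr_ge0.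
  - by rewrite invr_ge0 sqrtr_ge0.
  have is0 : 0 <= isq sg by rewrite invr_ge0 sqrtr_ge0.
  apply: (@le_trans _ _ ((isq sg)%:E * 5%:E)%E).
    by rewrite lee_wpmul2l//; exact: gaussian_integral_sqrt.
  rewrite -EFinM lee_fin; have := key _ sg0; have : sg + h <= 2 * sg by lra.
  by move=> h1 /(_ h1); lra.
apply: (@le_trans _ _ (\int[@normal_prob R 0 1]_x (2 * isq (sg + h))%:E)%E).
  apply: ge0_integral_mono => x; rewrite lee_fin ?invr_ge0 ?sqrtr_ge0//.
  apply: (@le_trans _ _ (isq h)); last by apply: key => //; lra.
  rewrite /isq lef_pV2 ?posrE ?sqrtr_gt0//; last by rewrite ltr_wpDl.
  by rewrite ler_wsqrtr// lerDr.
rewrite prob_integral_cst lee_fin ler_wpM2r ?invr_ge0 ?sqrtr_ge0//; lra.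
Qed.

End inverse_sqrt.

Section anticoncentration.
Context {R : realType} d (T : measurableType d) (Q : probability T R) (p : nat).
Variable xi : 'I_p -> T -> R.
Hypothesis hxi : iid_std_normal Q xi.
Variable a : 'I_p -> R.
Hypothesis a1 : \sum_j a j ^+ 2 = 1.
Local Notation gamma := (@normal_prob R 0 1).

Let mxi j : measurable_fun setT (xi j). Proof. by case: hxi. Qed.

Let mxi2 j : measurable_fun setT (fun z : T * T => xi j z.1) /\
  measurable_fun setT (fun z : T * T => xi j z.2).
Proof. by split; apply: measurableT_comp => //; exact: mxi. Qed.

Let polar (z : T * T) := \sum_j a j * xi j z.1 * xi j z.2.

Let mpolar : measurable_fun setT polar.
Proof.
apply: measurable_sum => j; have [h1 h2] := mxi2 j.
by apply: measurable_funM => //; exact: measurable_funM.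
Qed.

Let misq (h : R) d' (T' : measurableType d') (f : T' -> R) : 0 < h ->
  measurable_fun setT f ->
  measurable_fun setT (fun z => (Num.sqrt (`|f z| + h))^-1).
Proof.
move=> h0 mf.
rewrite (_ : (fun x => _) = (fun x => (`|f x| + h) `^ (- 2^-1))); first by mfun.
by apply/funext => x; rewrite powRN powR12_sqrt// addr_ge0// ltW.
Qed.

(** Given the first vector, the polar form is centred Gaussian with variance the sum of a_j^2
    xi_j^2. As the weights a_j^2 sum to 1, [inv_sqrt_mean] passes from this random deviation to
    single coordinates; 50 = 10 * 5. *)
Lemma gaussian_polar_sqrt (h : R) : 0 < h ->
  (\int[Q]_w \int[Q]_w1 ((Num.sqrt (`|polar (w, w1)| + h))^-1)%:E <= 50%:E)%E.
Proof.
move=> h0.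
have isq0 (x : R) : 0 <= (Num.sqrt x)^-1 by rewrite invr_ge0 sqrtr_ge0.
pose sg w := Num.sqrt (\sum_j a j ^+ 2 * xi j w ^+ 2).
apply: (@le_trans _ _ (\int[Q]_w (10 * \sum_j a j ^+ 2 * (Num.sqrt (`|xi j w| + h))^-1)%:E)%E).
  apply: ge0_integral_mono => w; first by apply: integral_ge0 => w1 _; rewrite lee_fin.
  apply: (@le_trans _ _ (10 * (Num.sqrt (sg w + h))^-1)%:E); last first.
    rewrite lee_fin ler_wpM2l//.
    by apply: inv_sqrt_mean => // j; exact: sqr_ge0.
  apply: le_trans (gaussian_scaled_sqrt (sqrtr_ge0 _) h0).
  have := @integral_linear_form _ _ _ _ _ _ hxi (fun j => a j * xi j w) (index_enum _)
    (fun x => ((Num.sqrt (`|x| + h))^-1)%:E) (index_enum_uniq _).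
  have mi : measurable_fun setT (fun x : R => ((Num.sqrt (`|x| + h))^-1)%:E).
    by apply/measurable_EFinP; apply: misq.
  move=> /(_ mi (fun x => isq0 _)).
  rewrite (_ : \sum_(j <- index_enum _) (a j * xi j w) ^+ 2 = \sum_j a j ^+ 2 * xi j w ^+ 2).
    by move=> <-.
  by apply: eq_bigr => j _; rewrite exprMn.
have mterm j : measurable_fun setT (fun w => a j ^+ 2 * (Num.sqrt (`|xi j w| + h))^-1).
  by apply: measurable_funM => //; exact: misq.
have term0 j w : 0 <= a j ^+ 2 * (Num.sqrt (`|xi j w| + h))^-1.
  by rewrite mulr_ge0 ?sqr_ge0.
rewrite integral_scaler//; last 2 first.
- exact: measurable_sum.
- by move=> w; apply: sumr_ge0.
have -> : (50 : R)%:E = (10%:E * 5%:E)%E by rewrite -EFinM -natrM.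
rewrite lee_wpmul2l//.
under eq_integral do rewrite -sumEFin.
rewrite ge0_integral_sum//; last 2 first.
- by move=> j; apply/measurable_EFinP.
- by move=> j w _; rewrite lee_fin.
apply: (@le_trans _ _ (\sum_j (5 * a j ^+ 2)%:E)%E).
  apply: lee_sum => j _.
  rewrite integral_scaler ?sqr_ge0//; last exact: misq.
  rewrite (integral_std_normal hxi j (f := fun x => ((Num.sqrt (`|x| + h))^-1)%:E)); last 2 first.
  - by apply/measurable_EFinP; apply: misq.
  - by move=> x; rewrite lee_fin.
  rewrite [5 * _]mulrC [leRHS]EFinM lee_wpmul2l ?lee_fin ?sqr_ge0//.
  exact: gaussian_integral_sqrt.
by rewrite sumEFin -mulr_sumr a1 mulr1.
Qed.

Lemma gaussian_form_anticoncentration (t h : R) : 0 < h ->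
  (Q [set w | (`|\sum_j a j * xi j w ^+ 2 - t| <= h)%R] <= (153 * Num.sqrt h)%:E)%E.
Proof.
move=> h0.
have sh0 : 0 < Num.sqrt h by rewrite sqrtr_gt0.
pose q (v : vec R p) : R := \sum_j a j * v j ^+ 2.
pose ind (x : R) : R := (near_level t h x)%:R.
have ind0 (x : R) : 0 <= ind x by exact: ler0n.
have mind : measurable_fun setT ind.
  pose S := [set x : R | `|x - t| <= h].
  rewrite (_ : ind = \1_S); last first.
    apply/funext => x; rewrite indicE; congr (nat_of_bool _)%:R.
    by apply/idP/idP; rewrite inE.
  apply: measurable_indic.
  have m1 : measurable_fun setT (fun x : R => `|x - t| <= h).
    by apply: measurable_fun_ler => //; mfun.
  by have := m1 measurableT [set true] Logic.I; rewrite setTI.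
have mq : measurable_fun setT q.
  apply: measurable_sum => j; apply: measurable_funM => //; apply: measurable_funX.
  exact: measurable_coord.
set A0 := [set w | _].
have mA0 : measurable A0.
  have m1 : measurable_fun setT (fun w => `|\sum_j a j * xi j w ^+ 2 - t| <= h).
    apply: measurable_fun_ler => //; apply: measurableT_comp => //.
    apply: measurable_funB => //; apply: measurable_sum => j.
    by apply: measurable_funM => //; apply: measurable_funX; exact: mxi.
  by have := m1 measurableT [set true] Logic.I; rewrite setTI.
have A0E : Q A0 = (\int[Q]_w (ind (q (gauss_vec xi w)))%:E)%E.
  rewrite -[in LHS](setIT A0) -integral_indic//; apply: eq_integral => w _.
  rewrite indicE; congr (_%:E); congr (nat_of_bool _)%:R.
  by apply/idP/idP; rewrite inE.
(* N is at least h^(-1/2), so that the rounding term 3 / N of [quadratic_count] is at most 3 sqrt h.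
   The main term is 2 sqrt 2 * 50 sqrt h <= 150 sqrt h, whence 153. *)
pose N := (Num.truncn (Num.sqrt h)^-1).+1.
have N0 : (0 : R) < N%:R by rewrite ltr0n.
have Nh : N%:R^-1 <= Num.sqrt h.
  rewrite -[leRHS]invrK lef_pV2 ?posrE ?invr_gt0//.
  by apply/ltW; rewrite /N; apply: truncnS_gt.
pose A (w : T) := \sum_j a j * xi j w ^+ 2.
have rot (k : 'I_N) : Q A0 = (\int[Q]_w \int[Q]_w1
    (ind (arc_quad (A w) (A w1) (polar (w, w1)) (k.+1%:R / N%:R)))%:E)%E.
  set s := k.+1%:R / N%:R.
  have s0 : 0 < s by rewrite divr_gt0.
  have s1 : s <= 1 by rewrite ler_pdivrMr// mul1r ler_nat.
  rewrite A0E -(@gauss_vec_rotation _ _ _ _ _ _ hxi (Num.sqrt (1 - s)) (Num.sqrt s) (fun v => (ind (q v))%:E)).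
  - apply: eq_integral => w _; apply: eq_integral => w1 _; congr ((ind _)%:E).
    rewrite /q /arc_quad /A /polar !mulr_sumr -!big_split/=; apply: eq_bigr => j _.
    have -> : half_circle s = Num.sqrt s * Num.sqrt (1 - s).
      by rewrite /half_circle sqrtrM// ltW.
    have e1 := sqr_sqrtr (ltW s0).
    have e2 : Num.sqrt (1 - s) ^+ 2 = 1 - s by rewrite sqr_sqrtr// subr_ge0.
    move: e1 e2; set sb := Num.sqrt s; set sa := Num.sqrt (1 - s) => e1 e2.
    by rewrite /gauss_vec -e2 -e1; ring.
  - by rewrite sqrtr_gt0.
  - by rewrite (sqr_sqrtr (ltW s0)) sqr_sqrtr ?subr_ge0// subrK.
  - by apply/measurable_EFinP; exact: measurableT_comp.
  - by move=> v; rewrite lee_fin.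
have mA i : measurable_fun setT (fun z : T * T => A (if i then z.1 else z.2)).
  case: i; apply: measurable_sum => j; have [h1 h2] := mxi2 j;
  by apply: measurable_funM => //; exact: measurable_funX.
have marc k : measurable_fun setT (fun z : T * T =>
    (ind (arc_quad (A z.1) (A z.2) (polar (z.1, z.2)) (k.+1%:R / N%:R)))%:E).
  apply/measurable_EFinP; apply: measurableT_comp => //.
  have mp : measurable_fun setT (fun z : T * T => polar (z.1, z.2)).
    by rewrite (_ : (fun _ => _) = polar)//; apply/funext => -[].
  apply: measurable_funD; last exact: measurable_funM.
  by apply: measurable_funD; apply: measurable_funM => //; [exact: (mA true)|exact: (mA false)].
have NQ : (N%:R%:E * Q A0 = \int[Q]_w \int[Q]_w1 (\sum_(k < N)
    ind (arc_quad (A w) (A w1) (polar (w, w1)) (k.+1%:R / N%:R)))%:E)%E.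
  transitivity (\sum_(k < N) Q A0)%E.
    by rewrite -[in LHS](card_ord N) -sum1_card natr_sum -sumEFin ge0_sume_distrl//; under eq_bigr do rewrite mul1e.
  rewrite (eq_bigr _ (fun k _ => rot k)) -ge0_integral_sum; [|by []| |]; last 2 first.
  - move=> k; apply: (@measurable_integral_snd _ _ _ _ _ Q _ (marc k)) => z.
    by rewrite lee_fin; exact: ind0.
  - by move=> k w _; apply: integral_ge0 => w1 _; rewrite lee_fin; exact: ind0.
  apply: eq_integral => w _; rewrite -ge0_integral_sum; [|by []| |]; last 2 first.
  - by move=> k; exact: (measurableT_comp (marc k) (measurable_pair1 w)).
  - by move=> k w1 _; rewrite lee_fin; exact: ind0.
  by apply: eq_integral => w1 _; rewrite sumEFin.
pose c := N%:R * (2 * Num.sqrt 2 * Num.sqrt h) : R.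
have c0 : 0 <= c by rewrite !mulr_ge0 ?sqrtr_ge0.
have mk : measurable_fun setT (fun z : T * T => ((Num.sqrt (`|polar z| + h))^-1)).
  exact: misq.
have bound : (N%:R%:E * Q A0 <= (c * 50 + 3)%:E)%E.
  rewrite NQ.
  apply: (@le_trans _ _ (\int[Q]_w (c%:E * \int[Q]_w1 ((Num.sqrt (`|polar (w, w1)| + h))^-1)%:E + 3%:E))%E).
    apply: ge0_integral_mono => w.
      by apply: integral_ge0 => *; rewrite lee_fin sumr_ge0.
    have mkw : measurable_fun setT (fun w1 => (Num.sqrt (`|polar (w, w1)| + h))^-1).
      exact: (measurableT_comp mk (measurable_pair1 w)).
    rewrite -integral_scaler; [|exact: mkw|by move=> w1; rewrite invr_ge0 sqrtr_ge0|by []].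
    rewrite -[(3%:E)%E](prob_integral_cst Q) -integral_addr; [|exact: measurable_funM|by mfun| |by []]; last first.
      by move=> w1; rewrite mulr_ge0// invr_ge0 sqrtr_ge0.
    apply: ge0_integral_mono => w1; rewrite lee_fin; first exact: sumr_ge0.
    apply: le_trans (quadratic_count N (A w) (A w1) (polar (w, w1)) t h0) _.
    by rewrite lerD2r /c mulrA.
  have mI : measurable_fun setT (fun w => \int[Q]_w1 ((Num.sqrt (`|polar (w, w1)| + h))^-1)%:E)%E.
    apply: (@measurable_integral_snd _ _ _ _ _ Q (fun z => ((Num.sqrt (`|polar z| + h))^-1)%:E)).
      exact/measurable_EFinP.
    by move=> z; rewrite lee_fin invr_ge0 sqrtr_ge0.
  have I0 w : (0 <= \int[Q]_w1 ((Num.sqrt (`|polar (w, w1)| + h))^-1)%:E)%E.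
    by apply: integral_ge0 => w1 _; rewrite lee_fin invr_ge0 sqrtr_ge0.
  rewrite ge0_integralD; [|by []|by move=> w _; rewrite mule_ge0| |by []|exact: measurable_cst]; last first.
    exact: emeasurable_funM.
  rewrite prob_integral_cst [leRHS]EFinD leeD2r// ge0_integralZl_EFin; [|by []|by move=> w _; exact: I0|exact: mI|by []].
  by rewrite [leRHS]EFinM lee_wpmul2l//; exact: gaussian_polar_sqrt.
have fQ : Q A0 \is a fin_num by exact: fin_num_measure.
move: bound; rewrite -(fineK fQ) -EFinM !lee_fin; set x := fine _ => H.
have : x <= (c * 50 + 3) * N%:R^-1 by rewrite ler_pdivlMr// mulrC.
move=> /le_trans; apply.
have -> : (c * 50 + 3) * N%:R^-1 = 100 * Num.sqrt 2 * Num.sqrt h + 3 * N%:R^-1.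
  by rewrite /c; field; rewrite gt_eqF.
have s2 : Num.sqrt 2 <= 3 / 2 :> R.
  rewrite -[leRHS]ger0_norm ?divr_ge0// -sqrtr_sqr ler_wsqrtr//; lra.
have : Num.sqrt 2 * Num.sqrt h <= 3 / 2 * Num.sqrt h by rewrite ler_wpM2r// ltW.
by lra.
Qed.

End anticoncentration.

(** * Spectral factorization *)

Section real_spectral.
Context {R : rcfType}.

Let sqnormE (p : nat) (u : 'rV[R]_p) : (u *m u^T) 0 0 = \sum_j u 0 j ^+ 2.
Proof. by rewrite mxE; apply: eq_bigr => j _; rewrite [u^T j 0]mxE expr2. Qed.

(** The reflection exchanging [v] and the first basis vector [e]; the factor 1 / (1 - c) equals 2 /
    |v - e|^2. When v = e the identity does. *)
Lemma householder (p : nat) (v : 'rV[R]_p.+1) : v *m v^T = 1%:M ->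
  exists H : 'M[R]_p.+1, [/\ H^T = H, H *m H = 1%:M & row 0 H = v].
Proof.
move=> v1; pose e : 'rV[R]_p.+1 := delta_mx 0 0.
have e1 : e *m e^T = 1%:M.
  by rewrite trmx_delta mul_delta_mx; apply/matrixP => i j; rewrite !mxE !ord1 !eqxx.
pose w := v - e.
have [w0|w0] := eqVneq w 0.
  exists 1%:M; rewrite trmx1 mulmx1; split => //.
  have -> : v = e by apply/eqP; rewrite -subr_eq0 -/w w0.
  by apply/rowP => j; rewrite !mxE eqxx /= eq_sym.
pose c := v 0 0.
have ve : v *m e^T = c%:M.
  apply/matrixP => i j; rewrite !ord1 !mxE eqxx mulr1n (bigD1 0)//= big1 ?addr0.
    by rewrite !mxE !eqxx mulr1.
  by move=> k k0; rewrite !mxE (negbTE k0) mulr0.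
have ev : e *m v^T = c%:M by rewrite -[e]trmxK -trmx_mul ve tr_scalar_mx.
have ww : w *m w^T = (2 * (1 - c))%:M.
  rewrite /w linearB/= mulmxBl !mulmxBr v1 e1 ve ev.
  by rewrite -!raddfB/=; congr (_%:M); ring.
have c1 : 1 - c != 0.
  apply: contra w0 => /eqP c0; have := ww; rewrite c0 mulr0 => /matrixP /(_ 0 0).
  rewrite sqnormE [X in _ = X]mxE mul0rn => /eqP.
  rewrite psumr_eq0 => [/allP h|j _]; last exact: sqr_ge0.
  apply/eqP/rowP => j; rewrite [RHS]mxE; apply/eqP; rewrite -sqrf_eq0.
  by apply: h; rewrite mem_index_enum.
pose k := (1 - c)^-1.
exists (1%:M - k *: (w^T *m w)); split.
- by rewrite linearB/= trmx1 linearZ/= trmx_mul trmxK.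
- move: (w) ww => w' ww.
  rewrite mulmxBl mul1mx mulmxBr mulmx1 -scalemxAl -scalemxAr.
  have -> : w'^T *m w' *m (w'^T *m w') = (2 * (1 - c)) *: (w'^T *m w').
    by rewrite mulmxA -(mulmxA w'^T) ww mul_mx_scalar -scalemxAl.
  rewrite !scalerA (_ : _ * (2 * (1 - c)) = k + k); last by rewrite /k; field.
  rewrite scalerDl; set X := k *: _.
  by rewrite (_ : X - (X + X) = - X) ?opprK ?subrK// opprD addrA subrr add0r.
- rewrite rowE -/e mulmxBr mulmx1 -scalemxAr mulmxA.
  have -> : e *m w^T = (c - 1)%:M.
    by rewrite /w linearB/= mulmxBr ev e1 -raddfB.
  rewrite mul_scalar_mx scalerA /k.
  have -> : (1 - c)^-1 * (c - 1) = -1 by field.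
  by rewrite scaleN1r opprK /w addrC subrK.
Qed.

Lemma char_poly_orth_conj (p : nat) (H S : 'M[R]_p) : H *m H^T = 1%:M ->
  char_poly (H *m S *m H^T) = char_poly S.
Proof.
move=> HH; rewrite /char_poly /char_poly_mx.
have HHp : map_mx polyC H *m map_mx polyC H^T = 1%:M.
  by rewrite -map_mxM HH map_mx1.
rewrite (_ : _ - _ = map_mx polyC H *m ('X%:M - map_mx polyC S) *m map_mx polyC H^T).
  rewrite !det_mulmx mulrAC -det_mulmx HHp det1 mul1r//.
by rewrite mulmxBr mulmxBl !map_mxM mul_mx_scalar -scalemxAl HHp scalemx1.
Qed.

(** Deflation: [lam 0] is a root of the characteristic polynomial, so it has a real eigenvector; a
    reflection moves this to the first axis, and symmetry clears the first column along with the
    first row. Cancelling the factor of [lam 0] identifies the characteristic polynomial of the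
    remaining block, so the eigenvalues come out in the prescribed order. *)
Lemma symmetric_diagonalization (p : nat) (S : 'M[R]_p) (lam : 'I_p -> R) :
  S^T = S -> char_poly S = \prod_(j < p) ('X - (lam j)%:P) ->
  exists U : 'M[R]_p, U *m U^T = 1%:M /\
    U *m S *m U^T = diag_mx (\row_j lam j).
Proof.
elim: p S lam => [|p IH] S lam ST cS.
  exists 1%:M; split; first by rewrite trmx1 mulmx1.
  by apply/matrixP => -[].
have : eigenvalue S (lam 0).
  rewrite eigenvalue_root_char cS /root horner_prod big_ord_recl hornerXsubC subrr mul0r//.
case/eigenvalueP => u uS u0.
pose nu := \sum_j u 0 j ^+ 2.
have nu0 : 0 < nu.
  rewrite lt_def; apply/andP; split; last by apply: sumr_ge0 => j _; exact: sqr_ge0.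
  apply: contra u0; rewrite /nu psumr_eq0 => [/allP h|j _]; last exact: sqr_ge0.
  apply/eqP/rowP => j; rewrite [RHS]mxE; apply/eqP; rewrite -sqrf_eq0.
  by apply: h; rewrite mem_index_enum.
pose v := (Num.sqrt nu)^-1 *: u.
have v1 : v *m v^T = 1%:M.
  apply/matrixP => i j; rewrite !ord1 sqnormE [RHS]mxE eqxx /=.
  rewrite -(mulVf (lt0r_neq0 nu0)) {2}/nu mulr_sumr; apply: eq_bigr => k _.
  by rewrite mxE exprMn exprVn sqr_sqrtr// ltW.
have vS : v *m S = lam 0 *: v by rewrite -scalemxAl uS !scalerA mulrC.
have [H [HT HH Hv]] := householder v1.
have [B BE] : exists B, B = H *m S *m H by eexists.
have BT : B^T = B by rewrite BE !trmx_mul HT ST mulmxA.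
have rB : row 0 B = lam 0 *: delta_mx 0 0.
  rewrite BE !row_mul Hv vS -scalemxAl; congr (_ *: _).
  by rewrite -Hv -row_mul HH row1.
pose B1 : 'M[R]_(1 + p) := B.
have B1E : B1 = block_mx (lam 0)%:M 0 0 (drsubmx B1).
  rewrite -[LHS]submxK; congr block_mx.
  - apply/matrixP => i j; rewrite !ord1 !mxE eqxx mulr1n.
    have := congr1 (fun M : 'rV_p.+1 => M 0 0) rB; rewrite !mxE !eqxx mulr1 => <-.
    by congr (B _ _); apply/val_inj.
  - apply/matrixP => i j; rewrite !mxE !ord1.
    have := congr1 (fun M : 'rV_p.+1 => M 0 (lift 0 j)) rB; rewrite !mxE eqxx /= mulr0 => <-.
    by congr (B _ _); apply/val_inj.
  - apply/matrixP => i j; rewrite !mxE !ord1.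
    have := congr1 (fun M : 'rV_p.+1 => M 0 (lift 0 i)) rB; rewrite !mxE eqxx /= mulr0 => <-.
    transitivity (B^T 0 (lift 0 i)); last by rewrite BT.
    by rewrite mxE; congr (B _ _); apply/val_inj.
pose S1 := drsubmx B1.
have S1T : S1^T = S1 by rewrite /S1 trmx_drsub; congr drsubmx; exact: BT.
have cB : char_poly B = char_poly S by rewrite BE -{2}HT char_poly_orth_conj// HT.
have cS1 : char_poly S1 = \prod_(j < p) ('X - (lam (lift 0 j))%:P).
  have : char_poly B1 = ('X - (lam 0)%:P) * char_poly S1.
    rewrite B1E /char_poly char_block_diag_mx det_ublock -/S1; congr (_ * _).
    rewrite /char_poly_mx map_scalar_mx -raddfB/= det_scalar expr1//.
  rewrite [char_poly B1]cB cS big_ord_recl => /(mulfI _) <-//.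
  by rewrite polyXsubC_eq0.
have [U [UU US]] := IH S1 _ S1T cS1.
pose W : 'M[R]_(1 + p) := block_mx 1%:M 0 0 U.
have WT : W^T = block_mx 1%:M 0 0 U^T by rewrite tr_block_mx trmx1 !trmx0.
have WW : W *m W^T = 1%:M.
  rewrite WT mulmx_block !mulmx0 !mul0mx !addr0 mul1mx UU add0r.
  by rewrite -scalar_mx_block.
exists ((W : 'M[R]_(p.+1)) *m H); split.
  by rewrite trmx_mul HT mulmxA -(mulmxA _ H H) HH mulmx1; exact: WW.
rewrite trmx_mul HT !mulmxA -(mulmxA _ H S) -(mulmxA _ (H *m S) H) -BE.
rewrite -[B]/(B1 : 'M[R]_(p.+1)) B1E.
transitivity (W *m block_mx (lam 0)%:M 0 0 S1 *m W^T) => //.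
rewrite WT !mulmx_block !(mulmx0, mul0mx, addr0, add0r, mul1mx, mulmx1) US.
suff E : block_mx (lam 0)%:M 0 0 (diag_mx (\row_j lam (lift 0 j))) =
    (diag_mx (\row_(j < 1 + p) lam j) : 'M[R]_(1 + p)) by exact: E.
apply/matrixP => i j.
case: (@split_ordP 1 p i) => i' ->; case: (@split_ordP 1 p j) => j' ->.
- rewrite block_mxEul !ord1 !mxE !eqxx !mulr1n.
  by congr lam; apply/val_inj.
- by rewrite block_mxEur !mxE !ord1.
- by rewrite block_mxEdl !mxE !ord1.
- rewrite block_mxEdr !mxE (inj_eq (@rshift_inj _ _)); congr (_ *+ _).
  by congr lam; apply/val_inj.
Qed.

(** [A] is U^T D rather than the symmetric square root U^T D U: A A^T is the covariance of A xi,
    while the diagonal A^T A turns |A xi|^2 into the sum of the lam_j xi_j^2. *)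
Lemma psd_factorization (p : nat) (S : 'M[R]_p) (lam : 'I_p -> R) :
  S^T = S -> char_poly S = \prod_(j < p) ('X - (lam j)%:P) ->
  (forall x : 'rV[R]_p, 0 <= (x *m S *m x^T) 0 0) ->
  exists A : 'M[R]_p, [/\ A *m A^T = S, A^T *m A = diag_mx (\row_j lam j) &
    forall j, 0 <= lam j].
Proof.
move=> ST cS psd; have [U [UU US]] := symmetric_diagonalization ST cS.
have lam0 j : 0 <= lam j.
  have -> : lam j = (row j U *m S *m (row j U)^T) 0 0.
    transitivity ((U *m S *m U^T) j j); first by rewrite US !mxE eqxx mulr1n.
    by rewrite -row_mul [LHS]mxE [RHS]mxE; apply: eq_bigr => k _; rewrite !mxE.
  exact: psd.
have UtU : U^T *m U = 1%:M by exact: mulmx1C.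
pose D := diag_mx (\row_j Num.sqrt (lam j)).
have DD : D *m D = diag_mx (\row_j lam j).
  rewrite /D mulmx_diag; congr diag_mx; apply/rowP => j; rewrite !mxE.
  by rewrite -expr2 sqr_sqrtr.
exists (U^T *m D); split => //.
- rewrite trmx_mul trmxK tr_diag_mx mulmxA -(mulmxA _ D D) DD -US.
  by rewrite !mulmxA UtU mul1mx -mulmxA UtU mulmx1.
- by rewrite trmx_mul trmxK tr_diag_mx mulmxA -(mulmxA D U) UU mulmx1 DD.
Qed.

End real_spectral.

(** * A smooth cutoff and its Taylor expansion *)

Section cutoff.
Context {R : realType}.
Implicit Types x D : R.

Definition trunc (x : R) : R := Num.max x 0.

Lemma trunc_pos x : 0 <= x -> trunc x = x.
Proof. by move=> x0; rewrite /trunc; apply/max_idPl. Qed.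

Lemma trunc_neg x : x <= 0 -> trunc x = 0.
Proof. by move=> x0; rewrite /trunc; apply/max_idPr. Qed.

(** The second derivative 6 x_+ of x_+^3 is Lipschitz with constant 6, so the remainder is at most 6
    |D|^3 / 3!; the cases below place [x] and [x + D] relative to the kink. *)
Lemma trunc_cube_taylor x D :
  `|trunc (x + D) ^+ 3 - trunc x ^+ 3 - 3 * trunc x ^+ 2 * D - 3 * trunc x * D ^+ 2|
    <= `|D| ^+ 3.
Proof.
rewrite -normrX; have [x0|x0] := leP 0 x.
  rewrite (trunc_pos x0); have [y0|y0] := leP 0 (x + D).
    by rewrite trunc_pos// le_eqVlt; apply/orP; left; apply/eqP; congr `|_|; ring.
  rewrite (trunc_neg (ltW y0)) expr0n.
  have -> : 0 - x ^+ 3 - 3 * x ^+ 2 * D - 3 * x * D ^+ 2 = D ^+ 3 - (x + D) ^+ 3 by ring.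
  have D0 : D <= 0 by lra.
  have P1 : 0 <= - (D ^+ 3).
    have -> : - D ^+ 3 = (- D) ^+ 3 by ring.
    by apply: exprn_ge0; lra.
  have P2 : 0 <= - ((x + D) ^+ 3).
    have -> : - ((x + D) ^+ 3) = (- (x + D)) ^+ 3 by ring.
    by apply: exprn_ge0; lra.
  have P3 : - ((x + D) ^+ 3) <= - (D ^+ 3).
    have -> : - D ^+ 3 = (- D) ^+ 3 by ring.
    have -> : - ((x + D) ^+ 3) = (- (x + D)) ^+ 3 by ring.
    by apply: lerXn2r; rewrite ?nnegrE; lra.
  by rewrite ler0_norm ?ler0_norm; lra.
rewrite (trunc_neg (ltW x0)) !expr0n/= !(mulr0, mul0r, subr0).
have [y0|y0] := leP 0 (x + D); last by rewrite (trunc_neg (ltW y0)) expr0n normr0.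
rewrite trunc_pos// !normrX; apply: lerXn2r; rewrite ?nnegrE ?normr_ge0//.
by rewrite !ger0_norm; lra.
Qed.

(* Integrated quadratic B-spline with knots 0, 1, 2, 3. *)
Definition cutoff x : R := 1 - (trunc x ^+ 3 - 3 * trunc (x - 1) ^+ 3
  + 3 * trunc (x - 2) ^+ 3 - trunc (x - 3) ^+ 3) / 6.
(** The first two derivatives of [cutoff], written out; they enter as the coefficients of
    [cutoff_taylor], so that no derivative is ever taken. *)
Definition cutoff1 x : R := - (trunc x ^+ 2 - 3 * trunc (x - 1) ^+ 2
  + 3 * trunc (x - 2) ^+ 2 - trunc (x - 3) ^+ 2) / 2.
Definition cutoff2 x : R := - (trunc x - 3 * trunc (x - 1)
  + 3 * trunc (x - 2) - trunc (x - 3)).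

Lemma cutoff_bounds x :
  [/\ 0 <= cutoff x <= 1, `|cutoff1 x| <= 1 & `|cutoff2 x| <= 1].
Proof.
rewrite /cutoff /cutoff1 /cutoff2 !ler_norml.
have [x0|x0] := leP x 0.
  by rewrite !trunc_neg; try lra; split; apply/andP; split; lra.
have [x1|x1] := leP x 1.
  rewrite (trunc_pos (ltW x0)) !trunc_neg; try lra.
  have h2 : x ^+ 2 <= 1 by rewrite expr_le1// ltW.
  have h3 : x ^+ 3 <= 1 by rewrite expr_le1// ltW.
  have g2 := exprn_ge0 2 (ltW x0); have g3 := exprn_ge0 3 (ltW x0).
  by split; apply/andP; split; lra.
have [x2|x2] := leP x 2.
  rewrite (trunc_pos (ltW x0)) (trunc_pos (x := x - 1)) ?(trunc_neg (x := x - 2)) ?(trunc_neg (x := x - 3)); try lra.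
  pose y := x - 1; have -> : x = y + 1 by rewrite /y subrK.
  rewrite addrK; have y0 : 0 <= y by rewrite /y; lra.
  have y1 : y <= 1 by rewrite /y; lra.
  have h2 : y ^+ 2 <= y by rewrite expr2; nra.
  have h3 : y ^+ 3 <= y ^+ 2 by rewrite (exprS y 2); have := sqr_ge0 y; nra.
  have g3 := exprn_ge0 3 y0; have g2 := sqr_ge0 y.
  have h4 : 0 <= (1 - y) ^+ 2 * (1 + 2 * y) by rewrite mulr_ge0 ?sqr_ge0//; lra.
  have h5 := sqr_ge0 (y - 1 / 2).
  have -> : (y + 1) ^+ 3 = y ^+ 3 + 3 * y ^+ 2 + 3 * y + 1 by ring.
  have -> : (y + 1) ^+ 2 = y ^+ 2 + 2 * y + 1 by ring.
  by split; apply/andP; split; lra.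
have [x3|x3] := leP x 3.
  rewrite (trunc_pos (ltW x0)) (trunc_pos (x := x - 1)) ?(trunc_pos (x := x - 2)) ?(trunc_neg (x := x - 3)); try lra.
  pose y := 3 - x; have -> : x = 3 - y by rewrite /y; ring.
  have y0 : 0 <= y by rewrite /y; lra.
  have y1 : y <= 1 by rewrite /y; lra.
  have h2 : y ^+ 2 <= 1 by rewrite expr_le1.
  have h3 : y ^+ 3 <= 1 by rewrite expr_le1.
  have g3 := exprn_ge0 3 y0; have g2 := sqr_ge0 y.
  have -> : 1 - ((3 - y) ^+ 3 - 3 * (3 - y - 1) ^+ 3 + 3 * (3 - y - 2) ^+ 3 - 0 ^+ 3) / 6 = y ^+ 3 / 6 by field.
  have -> : - ((3 - y) ^+ 2 - 3 * (3 - y - 1) ^+ 2 + 3 * (3 - y - 2) ^+ 2 - 0 ^+ 2) / 2 = - y ^+ 2 / 2 by field.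
  by split; apply/andP; split; lra.
rewrite !trunc_pos; try lra.
have -> : 1 - (x ^+ 3 - 3 * (x - 1) ^+ 3 + 3 * (x - 2) ^+ 3 - (x - 3) ^+ 3) / 6 = 0 by field.
have -> : - (x ^+ 2 - 3 * (x - 1) ^+ 2 + 3 * (x - 2) ^+ 2 - (x - 3) ^+ 2) / 2 = 0 by field.
by split; apply/andP; split; lra.
Qed.

Lemma cutoff_eq1 x : x <= 0 -> cutoff x = 1.
Proof. by move=> x0; rewrite /cutoff !trunc_neg; try lra; rewrite !expr0n/=; lra. Qed.

Lemma cutoff_eq0 x : 3 <= x -> cutoff x = 0.
Proof. by move=> x3; rewrite /cutoff !trunc_pos; try lra; field. Qed.

(** For |D| <= 1 the remainders of the four truncated cubes add up to (1 + 3 + 3 + 1) / 6 |D|^3; for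
    |D| > 1 the bounds on [cutoff] and its derivatives give 1 + |D| + D^2 / 2. Either is at most 3
    |D|^(2+delta). *)
Lemma cutoff_taylor (delta x D : R) : 0 < delta <= 1 ->
  `|cutoff (x + D) - cutoff x - cutoff1 x * D - cutoff2 x / 2 * D ^+ 2|
    <= 3 * `|D| `^ (2 + delta).
Proof.
move=> /andP[d0 d1].
have [D1|D1] := leP `|D| 1.
  have DD : `|D| ^+ 3 <= `|D| `^ (2 + delta).
    rewrite -powR_mulrn//; have [->|Dn] := eqVneq D 0.
      by rewrite normr0 !powR0//; lra.
    by apply: ger_powR; [rewrite normr_gt0 Dn|lra].
  have T0 := trunc_cube_taylor x D; have T1 := trunc_cube_taylor (x - 1) D.
  have T2 := trunc_cube_taylor (x - 2) D; have T3 := trunc_cube_taylor (x - 3) D.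
  have E (c : R) : x - c + D = x + D - c by ring.
  rewrite !E in T1 T2 T3.
  rewrite /cutoff /cutoff1 /cutoff2.
  move: T0 T1 T2 T3 DD; rewrite !ler_norml.
  set X := `|D| ^+ 3; set Y := `|D| `^ _.
  move=> /andP[? ?] /andP[? ?] /andP[? ?] /andP[? ?] ?.
  by apply/andP; split; lra.
have DD : `|D| ^+ 2 <= `|D| `^ (2 + delta).
  by rewrite -powR_mulrn//; apply: ler_powR; [exact: ltW|lra].
have [b1 b2 b3] := cutoff_bounds x; have [b4 _ _] := cutoff_bounds (x + D).
have N2 : `|D| <= `|D| ^+ 2 by rewrite ler_eXnr// ltW.
have H1 : `|cutoff1 x * D| <= `|D| by rewrite normrM ler_piMl.
have H2 : `|cutoff2 x / 2 * D ^+ 2| <= `|D| ^+ 2 / 2.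
  rewrite normrM normrX normrM (ger0_norm (x := 2^-1)) ?invr_ge0//.
  have Z0 : 0 <= `|D| ^+ 2 by rewrite exprn_ge0.
  by have := ler_wpM2r Z0 b3; lra.
move: b1 b4 H1 H2 => /andP[? ?] /andP[? ?].
set u := cutoff1 x * D; set v := cutoff2 x / 2 * D ^+ 2.
move=> H1 H2; have D0 : 1 < `|D| ^+ 2 by rewrite exprn_egt1.
have : `|cutoff (x + D) - cutoff x - u - v| <= 1 + `|u| + `|v|.
  apply: (le_trans (ler_normB _ _)); rewrite lerD2r.
  apply: (le_trans (ler_normB _ _)); rewrite lerD2r.
  by rewrite ler_norml; apply/andP; split; lra.
by lra.
Qed.

Lemma measurable_cutoff : measurable_fun setT cutoff.
Proof.
have mt : measurable_fun setT trunc by exact: measurable_maxr.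
have mtc c : measurable_fun setT (fun x => trunc (x - c)).
  by apply: measurableT_comp => //; mfun.
rewrite /cutoff; mfun; first [exact: mt | exact: mtc].
Qed.

End cutoff.

(** * Taylor expansion of the cutoff in expectation *)

Section taylor_step.
Context {R : realType} d (T : measurableType d) (P : probability T R).
Variables (u v : T -> R) (w2 delta psi x alpha : R).
Hypotheses (mu_ : measurable_fun setT u) (mv_ : measurable_fun setT v).
Hypotheses (iu : P.-integrable setT (EFin \o u)) (iv : P.-integrable setT (EFin \o v)).
Hypotheses (u0 : (\int[P]_w (u w)%:E = 0)%E) (v0 : (\int[P]_w (v w)%:E = 0)%E).
Hypothesis iu2 : P.-integrable setT (EFin \o (fun w => u w ^+ 2)).
Hypothesis u2 : (\int[P]_w (u w ^+ 2)%:E = w2%:E)%E.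
Hypotheses (dl : 0 < delta <= 1) (psi0 : 0 < psi) (alpha0 : 0 < alpha).

Let lin w := cutoff1 x * psi * (u w + v w) + cutoff2 x / 2 * psi ^+ 2 * (u w ^+ 2 - w2).

(** Error of an expansion that keeps [a] to second order and [b] to first: 2 a b + b^2 is counted as
    error, with [alpha] as the weight of AM-GM, and 24 = 3 * 8 combines [cutoff_taylor] with
    [powR_normD_le]. *)
Definition taylor_remainder (a b : R) :=
  psi ^+ 2 / 2 * (alpha * a ^+ 2 + (alpha^-1 + 1) * b ^+ 2) +
  24 * psi `^ (2 + delta) * (`|a| `^ (2 + delta) + `|b| `^ (2 + delta)).

Lemma taylor_remainder_ge0 a b : 0 <= taylor_remainder a b.
Proof. by rewrite /taylor_remainder; nneg. Qed.

Lemma measurable_taylor_remainder d' (T' : measurableType d') (a b : T' -> R) :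
  measurable_fun setT a -> measurable_fun setT b ->
  measurable_fun setT (fun w => taylor_remainder (a w) (b w)).
Proof. by move=> ma mb; rewrite /taylor_remainder; mfun. Qed.

Lemma powR_normD_le (a b q : R) : 0 <= q <= 3 ->
  `|a + b| `^ q <= 8 * (`|a| `^ q + `|b| `^ q).
Proof.
move=> /andP[q0 q3].
have H (m M : R) : 0 <= m -> m <= M -> (m + M) `^ q <= 8 * M `^ q.
  move=> m0 mM; apply: (@le_trans _ _ ((2 * M) `^ q)).
    by apply: ge0_ler_powR; rewrite ?nnegrE; lra.
  rewrite powRM//; last lra.
  apply: ler_wpM2r; first exact: powR_ge0.
  apply: (@le_trans _ _ (2 `^ 3%:R)); first by apply: ler_powR; lra.
  by rewrite powR_mulrn//; lra.
apply: (@le_trans _ _ ((`|a| + `|b|) `^ q)).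
  by apply: ge0_ler_powR; rewrite ?nnegrE ?addr_ge0//; exact: ler_normD.
have := powR_ge0 `|a| q; have := powR_ge0 `|b| q.
have [ab|ab] := leP `|a| `|b|; first by have := H _ _ (normr_ge0 a) ab; lra.
by have := H _ _ (normr_ge0 b) (ltW ab); rewrite addrC; lra.
Qed.

Let taylor_pointwise a b :
  `|cutoff (x + psi * (a + b)) - cutoff x
    - (cutoff1 x * psi * (a + b) + cutoff2 x / 2 * psi ^+ 2 * a ^+ 2)|
  <= taylor_remainder a b.
Proof.
have /andP[d0 d1] := dl.
have T0 := @cutoff_taylor R delta x (psi * (a + b)) dl.
rewrite normrM powRM// (gtr0_norm psi0) in T0.
have [_ _ c2] := cutoff_bounds x.
have q3 := @powR_normD_le a b (2 + delta) ltac:(apply/andP; split; lra).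
have ps := powR_ge0 psi (2 + delta).
have {}q3 := ler_wpM2l ps q3.
have AM : `|2 * a * b + b ^+ 2| <= alpha * a ^+ 2 + (alpha^-1 + 1) * b ^+ 2.
  have E1 : 0 <= alpha * (a - b / alpha) ^+ 2 by rewrite mulr_ge0 ?sqr_ge0// ltW.
  have E2 : 0 <= alpha * (a + b / alpha) ^+ 2 by rewrite mulr_ge0 ?sqr_ge0// ltW.
  have a0 : alpha != 0 by rewrite gt_eqF.
  have F1 : alpha * (a - b / alpha) ^+ 2 = alpha * a ^+ 2 - 2 * a * b + alpha^-1 * b ^+ 2 by field.
  have F2 : alpha * (a + b / alpha) ^+ 2 = alpha * a ^+ 2 + 2 * a * b + alpha^-1 * b ^+ 2 by field.
  rewrite F1 in E1; rewrite F2 in E2; have := sqr_ge0 b.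
  by rewrite ler_norml mulrDl mul1r => b2; apply/andP; split; lra.
set Y := alpha * _ + _ in AM; set Z := 2 * a * b + b ^+ 2 in AM.
have CZ : `|cutoff2 x / 2 * psi ^+ 2 * Z| <= psi ^+ 2 / 2 * Y.
  rewrite (_ : _ * Z = cutoff2 x * (psi ^+ 2 / 2 * Z)); last by ring.
  rewrite normrM; apply: (@le_trans _ _ `|psi ^+ 2 / 2 * Z|); first by rewrite ler_piMl.
  have p2 : 0 <= psi ^+ 2 / 2 by rewrite divr_ge0 ?sqr_ge0.
  by rewrite normrM ger0_norm// ler_wpM2l.
rewrite /taylor_remainder -/Y.
have E : cutoff (x + psi * (a + b)) - cutoff x
    - (cutoff1 x * psi * (a + b) + cutoff2 x / 2 * psi ^+ 2 * a ^+ 2) =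
  (cutoff (x + psi * (a + b)) - cutoff x - cutoff1 x * (psi * (a + b)) -
    cutoff2 x / 2 * (psi * (a + b)) ^+ 2) + cutoff2 x / 2 * psi ^+ 2 * Z.
  by rewrite /Z; ring.
rewrite E; apply: le_trans (ler_normD _ _) _.
by apply: (le_trans (lerD T0 CZ)); lra.
Qed.

Let ilin : P.-integrable setT (EFin \o lin).
Proof.
rewrite (_ : EFin \o lin = fun w => ((cutoff1 x * psi)%:E * ((EFin \o u) \+ (EFin \o v)) w +
    (cutoff2 x / 2 * psi ^+ 2)%:E * ((EFin \o (fun w => (u w ^+ 2)%R)) \- (EFin \o cst w2)) w)%E).
  apply: integrableD => //; apply: integrableZl => //; first exact: integrableD.
  by apply: integrableB => //; exact: finite_measure_integrable_cst.
by apply/funext => w.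
Qed.

Let lin0 : (\int[P]_w (lin w)%:E = 0)%E.
Proof.
have i1 : P.-integrable setT ((EFin \o u) \+ (EFin \o v))%E by exact: integrableD.
have ic : P.-integrable setT (EFin \o cst w2) by exact: finite_measure_integrable_cst.
have i2 : P.-integrable setT ((EFin \o (fun w => (u w ^+ 2)%R)) \- (EFin \o cst w2))%E.
  exact: integrableB.
transitivity (\int[P]_w ((cutoff1 x * psi)%:E * ((EFin \o u) \+ (EFin \o v)) w +
    (cutoff2 x / 2 * psi ^+ 2)%:E * ((EFin \o (fun w => (u w ^+ 2)%R)) \- (EFin \o cst w2)) w))%E.
  by apply: eq_integral => w _.
rewrite integralD//; [|exact: integrableZl|exact: integrableZl].
rewrite integralZl// integralZl// integralD// u0 v0 adde0 mule0 add0e.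
rewrite integralB// u2.
have -> : (\int[P]_w (EFin \o cst w2) w = w2%:E)%E by exact: (prob_integral_cst P w2%:E).
by rewrite subee ?mule0.
Qed.

Let mrem : measurable_fun setT (fun w => taylor_remainder (u w) (v w)).
Proof. exact: measurable_taylor_remainder. Qed.

Let mcut : measurable_fun setT (fun w => cutoff (x + psi * (u w + v w))).
Proof. by apply: measurableT_comp; [exact: measurable_cutoff|mfun]. Qed.

Let center := cutoff x + cutoff2 x / 2 * psi ^+ 2 * w2.

Lemma taylor_step_upper :
  (\int[P]_w (cutoff (x + psi * (u w + v w)))%:E <=
   center%:E + \int[P]_w (taylor_remainder (u w) (v w))%:E)%E.
Proof.
apply: (@ge0_integral_le_centered _ _ _ _ _ _ lin) => //.
- by move=> w; have [/andP[]] := cutoff_bounds (x + psi * (u w + v w)).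
- by move=> w; exact: taylor_remainder_ge0.
- move=> w; have := taylor_pointwise (u w) (v w); rewrite ler_norml => /andP[_].
  by rewrite /center /lin; lra.
Qed.

(** The argument of the upper bound applied to 1 - cutoff, which keeps the integrand nonnegative. *)
Lemma taylor_step_lower :
  (center%:E <= \int[P]_w (cutoff (x + psi * (u w + v w)))%:E +
    \int[P]_w (taylor_remainder (u w) (v w))%:E)%E.
Proof.
have c01 w := cutoff_bounds (x + psi * (u w + v w)).
have H : (\int[P]_w (1 - cutoff (x + psi * (u w + v w)))%:E <=
   (1 - center)%:E + \int[P]_w (taylor_remainder (u w) (v w))%:E)%E.
  apply: (@ge0_integral_le_centered _ _ _ _ _ _ (fun w => - lin w)) => //.
  - exact: measurable_funB.
  - by move=> w; have [/andP[]] := c01 w; lra.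
  - by move=> w; exact: taylor_remainder_ge0.
  - rewrite (_ : EFin \o _ = (fun w => - (EFin \o lin) w)%E); first exact: integrableN.
    by apply/funext => w /=; rewrite EFinN.
  - under eq_integral do rewrite -mulN1r EFinM.
    by rewrite integralZl// lin0 mule0.
  - move=> w; have := taylor_pointwise (u w) (v w); rewrite ler_norml => /andP[+ _].
    by rewrite /center /lin; lra.
set r := (\int[P]_w (taylor_remainder _ _)%:E)%E in H *.
have r0 : (0 <= r)%E by apply: integral_ge0 => w _; rewrite lee_fin taylor_remainder_ge0.
have E1 : (\int[P]_w (cutoff (x + psi * (u w + v w)))%:E +
    \int[P]_w (1 - cutoff (x + psi * (u w + v w)))%:E = 1)%E.
  rewrite -integral_addr//; last 3 first.
  - exact: measurable_funB.
  - by move=> w; have [/andP[]] := c01 w.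
  - by move=> w; have [/andP[]] := c01 w; lra.
  by under eq_integral do rewrite addrC subrK; rewrite prob_integral_cst.
move: E1 H; set I := (\int[P]_w (cutoff _)%:E)%E; set I' := (\int[P]_w (1 - _)%:E)%E.
have I0 : (0 <= I)%E by apply: integral_ge0 => w _; rewrite lee_fin; have [/andP[]] := c01 w.
have I'0 : (0 <= I')%E.
  by apply: integral_ge0 => w _; rewrite lee_fin; have [/andP[]] := c01 w; lra.
move: I I' r I0 I'0 r0 => [i||] [j||] [r||]//=; rewrite ?addey ?leey//.
rewrite !lee_fin => i0 j0 r0 [E1]; lra.
Qed.

End taylor_step.

(** * Exchanging one summand *)

Section vector_algebra.
Context {R : realType} (p : nat).
Implicit Types x y s : 'I_p -> R.

Definition addv x y : 'I_p -> R := fun a => x a + y a.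

Lemma sumsq_addv x y : sumsq (addv x y) = sumsq x + 2 * dotv x y + sumsq y.
Proof.
rewrite /sumsq /dotv mulr_sumr -!big_split/=.
by apply: eq_bigr => a _; rewrite /addv; ring.
Qed.

Lemma dotv_addl x y s : dotv (addv x y) s = dotv x s + dotv y s.
Proof. by rewrite /dotv -big_split/=; apply: eq_bigr => a _; rewrite mulrDl. Qed.

Lemma sqr_dotv s x : dotv s x ^+ 2 = \sum_a \sum_b s a * (x a * x b) * s b.
Proof.
rewrite expr2 /dotv mulr_suml; apply: eq_bigr => a _.
by rewrite mulr_sumr; apply: eq_bigr => b _; ring.
Qed.

End vector_algebra.

Lemma integrable_mul_sqr {R : realType} d (T : measurableType d) (P : probability T R)
    (f g : T -> R) : measurable_fun setT f -> measurable_fun setT g ->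
  P.-integrable setT (fun w => (f w ^+ 2)%:E) ->
  P.-integrable setT (fun w => (g w ^+ 2)%:E) ->
  P.-integrable setT (fun w => (f w * g w)%:E).
Proof.
move=> mf mg f2 g2; apply: (le_integrable _ _ _ (integrableD _ f2 g2)) => //.
  by apply/measurable_EFinP; exact: measurable_funM.
move=> w _; rewrite /= lee_fin [leRHS]ger0_norm ?addr_ge0 ?sqr_ge0//.
rewrite ler_norml; have := sqr_ge0 (f w + g w); have := sqr_ge0 (f w - g w).
have := sqr_ge0 (f w); have := sqr_ge0 (g w).
by move=> *; apply/andP; split; lra.
Qed.

Section matched.
Context {R : realType} d (T : measurableType d) (P : probability T R) (p : nat).

(** What a second order expansion sees of a summand; it is shared by X_1 and its Gaussian
    counterpart, which live on different probability spaces. *)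
Definition matched (Z : T -> 'I_p -> R) (S : 'M[R]_p) : Prop :=
  [/\ forall a, measurable_fun setT (fun w => Z w a),
      forall a, P.-integrable setT (fun w => (Z w a ^+ 2)%:E),
      forall a, (\int[P]_w (Z w a)%:E = 0)%E &
      forall a b, (\int[P]_w (Z w a * Z w b)%:E = (S a b)%:E)%E].

Variables (Z : T -> 'I_p -> R) (S : 'M[R]_p).
Hypothesis hZ : matched Z S.

Let mZ a : measurable_fun setT (fun w => Z w a). Proof. by case: hZ. Qed.
Let iZ2 a : P.-integrable setT (fun w => (Z w a ^+ 2)%:E). Proof. by case: hZ. Qed.

Lemma matched_integrable_mul a b : P.-integrable setT (fun w => (Z w a * Z w b)%:E).
Proof. exact: integrable_mul_sqr. Qed.

Lemma matched_integrable a : P.-integrable setT (fun w => (Z w a)%:E).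
Proof.
have i1 : P.-integrable setT (EFin \o cst (1 : R)) by exact: finite_measure_integrable_cst.
apply: (le_integrable _ _ _ (integrableD _ i1 (iZ2 a))) => //.
  exact/measurable_EFinP.
move=> w _; rewrite /= lee_fin [leRHS]ger0_norm ?addr_ge0 ?sqr_ge0//.
rewrite ler_norml; have := sqr_ge0 (Z w a + 1); have := sqr_ge0 (Z w a - 1).
have := sqr_ge0 (Z w a).
by move=> *; apply/andP; split; lra.
Qed.

Let integrable_sumR (I : Type) (r : seq I) (F : I -> T -> R) :
  (forall i, P.-integrable setT (EFin \o F i)) ->
  P.-integrable setT (EFin \o (fun w => \sum_(i <- r) F i w)).
Proof.
move=> iF; rewrite (_ : EFin \o _ = fun w => (\sum_(i <- r) (EFin \o F i) w)%E).
  exact: integrable_sum.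
by apply/funext => w /=; rewrite sumEFin.
Qed.

Let integral_sumR (I : Type) (r : seq I) (F : I -> T -> R) :
  (forall i, P.-integrable setT (EFin \o F i)) ->
  (\int[P]_w (\sum_(i <- r) F i w)%:E = \sum_(i <- r) \int[P]_w (F i w)%:E)%E.
Proof.
move=> iF; under eq_integral do rewrite -sumEFin.
by rewrite (integral_sum measurableT (fun i => iF i)).
Qed.

Let integrable_scale (c : R) (F : T -> R) : P.-integrable setT (EFin \o F) ->
  P.-integrable setT (EFin \o (fun w => c * F w)).
Proof.
by move=> iF; have := integrableZl measurableT c iF.
Qed.

Let integral_scale (c : R) (F : T -> R) : P.-integrable setT (EFin \o F) ->
  (\int[P]_w (c * F w)%:E = c%:E * \int[P]_w (F w)%:E)%E.
Proof.
by move=> iF; under eq_integral do rewrite EFinM; rewrite integralZl.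
Qed.

Lemma measurable_dotv s : measurable_fun setT (fun w => dotv s (Z w)).
Proof. by apply: measurable_sum => a; exact: measurable_funM. Qed.

Lemma measurable_sumsq : measurable_fun setT (fun w => sumsq (Z w)).
Proof. by apply: measurable_sum => a; exact: measurable_funX. Qed.

Lemma matched_dotv_integrable s : P.-integrable setT (EFin \o (fun w => dotv s (Z w))).
Proof. by apply: integrable_sumR => a; apply: integrable_scale; exact: matched_integrable. Qed.

Lemma matched_dotv_mean s : (\int[P]_w (dotv s (Z w))%:E = 0)%E.
Proof.
rewrite /dotv integral_sumR; last first.
  by move=> a; apply: integrable_scale; exact: matched_integrable.
rewrite big1// => a _; rewrite integral_scale; last exact: matched_integrable.
by case: hZ => _ _ -> _; rewrite mule0.
Qed.

Let sqr_dotvE s w : dotv s (Z w) ^+ 2 = \sum_a \sum_b (s a * s b) * (Z w a * Z w b).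
Proof.
by rewrite sqr_dotv; apply: eq_bigr => a _; apply: eq_bigr => b _; ring.
Qed.

Lemma matched_dotv2_integrable s :
  P.-integrable setT (EFin \o (fun w => dotv s (Z w) ^+ 2)).
Proof.
under [X in EFin \o X]eq_fun do rewrite sqr_dotvE.
apply: integrable_sumR => a; apply: integrable_sumR => b.
by apply: integrable_scale; exact: matched_integrable_mul.
Qed.

Lemma matched_dotv2 s : (\int[P]_w (dotv s (Z w) ^+ 2)%:E = (quadf S s)%:E)%E.
Proof.
under eq_integral do rewrite sqr_dotvE.
have i2 a b : P.-integrable setT (EFin \o (fun w => s a * s b * (Z w a * Z w b))).
  by apply: integrable_scale; exact: matched_integrable_mul.
rewrite integral_sumR; last by move=> a; exact: integrable_sumR.
rewrite /quadf -sumEFin; apply: eq_bigr => a _.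
rewrite integral_sumR// -sumEFin; apply: eq_bigr => b _.
rewrite integral_scale; last exact: matched_integrable_mul.
by case: hZ => _ _ _ ->; rewrite -EFinM; congr (_%:E); ring.
Qed.

Lemma matched_quadf_mean :
  (\int[P]_w (quadf S (Z w))%:E = (\tr (S *m S^T))%:E)%E.
Proof.
have E w : quadf S (Z w) = \sum_a \sum_b S a b * (Z w a * Z w b).
  by apply: eq_bigr => a _; apply: eq_bigr => b _; ring.
under eq_integral do rewrite E.
have i2 a b : P.-integrable setT (EFin \o (fun w => S a b * (Z w a * Z w b))).
  by apply: integrable_scale; exact: matched_integrable_mul.
rewrite integral_sumR; last by move=> a; exact: integrable_sumR.
rewrite /mxtrace -sumEFin; apply: eq_bigr => a _.
rewrite mxE integral_sumR// -sumEFin; apply: eq_bigr => b _.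
rewrite integral_scale; last exact: matched_integrable_mul.
by case: hZ => _ _ _ ->; rewrite mxE -EFinM.
Qed.

Lemma matched_quadf_ge0 s : 0 <= quadf S s.
Proof.
rewrite -lee_fin -matched_dotv2; apply: integral_ge0 => w _.
by rewrite lee_fin sqr_ge0.
Qed.

Let sumsqE w : sumsq (Z w) - \tr S = \sum_a (Z w a ^+ 2 - S a a).
Proof. by rewrite sumrB. Qed.

Let isq1 a : P.-integrable setT (EFin \o (fun w => Z w a ^+ 2 - S a a)).
Proof.
have := integrableB measurableT (iZ2 a) (finite_measure_integrable_cst P (S a a) measurableT).
by [].
Qed.

Lemma matched_sumsq_integrable : P.-integrable setT (EFin \o (fun w => sumsq (Z w) - \tr S)).
Proof.
under [X in EFin \o X]eq_fun do rewrite sumsqE.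
exact: integrable_sumR.
Qed.

Lemma matched_sumsq_mean : (\int[P]_w (sumsq (Z w) - \tr S)%:E = 0)%E.
Proof.
under eq_integral do rewrite sumsqE.
rewrite integral_sumR// big1// => a _.
under eq_integral do rewrite EFinB.
rewrite integralB//; last exact: finite_measure_integrable_cst.
under eq_integral do rewrite expr2.
by case: hZ => _ _ _ ->; rewrite (prob_integral_cst P) subee.
Qed.

End matched.

Section exchange.
Context {R : realType} (p : nat) (S : 'M[R]_p).
Variables (nn f psi t delta alpha : R).
Hypotheses (nn0 : 0 < nn) (f0 : 0 < f) (psi0 : 0 < psi) (alpha0 : 0 < alpha).
Hypothesis dl : 0 < delta <= 1.

Definition smooth_ind (v : 'I_p -> R) : R :=
  cutoff (psi * ((sumsq v / nn - \tr S) / f - t)).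

Definition exchange_error (s z : 'I_p -> R) : R :=
  taylor_remainder delta psi alpha (2 / (nn * f) * dotv s z)
    ((nn * f)^-1 * (sumsq z - \tr S)).

(** The base point includes the mean tr S of |Z|^2, so that the remaining quadratic part |Z|^2 - tr
    S is centred. *)
Let x0 (s : 'I_p -> R) := psi * (((sumsq s + \tr S) / nn - \tr S) / f - t).

Let smooth_indE s z : smooth_ind (addv s z) =
  cutoff (x0 s + psi * (2 / (nn * f) * dotv s z + (nn * f)^-1 * (sumsq z - \tr S))).
Proof.
rewrite /smooth_ind sumsq_addv; congr cutoff.
by rewrite /x0; field; rewrite !gt_eqF.
Qed.

Let w2 s := (2 / (nn * f)) ^+ 2 * quadf S s.

Section one.
Context d (T : measurableType d) (P : probability T R) (Z : T -> 'I_p -> R).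
Hypothesis hZ : matched P Z S.

Let center s := cutoff (x0 s) + cutoff2 (x0 s) / 2 * psi ^+ 2 * w2 s.

Let facts s : let u := fun w => 2 / (nn * f) * dotv s (Z w) in
  let v := fun w => (nn * f)^-1 * (sumsq (Z w) - \tr S) in
  [/\ measurable_fun setT u, measurable_fun setT v,
     P.-integrable setT (EFin \o u) & P.-integrable setT (EFin \o v)] /\
  [/\ (\int[P]_w (u w)%:E = 0)%E, (\int[P]_w (v w)%:E = 0)%E,
     P.-integrable setT (EFin \o (fun w => u w ^+ 2)) &
     (\int[P]_w (u w ^+ 2)%:E = (w2 s)%:E)%E].
Proof.
have md := measurable_dotv hZ s; have ms := measurable_sumsq hZ.
have id_ := matched_dotv_integrable hZ s; have is_ := matched_sumsq_integrable hZ.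
have i2 := matched_dotv2_integrable hZ s.
move=> u v; split; split.
- exact: measurable_funM.
- by apply: measurable_funM => //; exact: measurable_funB.
- exact: (integrableZl measurableT (2 / (nn * f)) id_).
- exact: (integrableZl measurableT (nn * f)^-1 is_).
- under eq_integral do rewrite EFinM.
  by rewrite integralZl// (matched_dotv_mean hZ) mule0.
- under eq_integral do rewrite EFinM.
  by rewrite integralZl// (matched_sumsq_mean hZ) mule0.
- rewrite (_ : EFin \o _ = EFin \o (fun w => (2 / (nn * f)) ^+ 2 * dotv s (Z w) ^+ 2)).
    exact: (integrableZl measurableT ((2 / (nn * f)) ^+ 2) i2).
  by apply/funext => w /=; rewrite exprMn.
- under eq_integral do rewrite exprMn EFinM.
  by rewrite integralZl// (matched_dotv2 hZ).
Qed.

Lemma smooth_ind_upper s : (\int[P]_w (smooth_ind (addv s (Z w)))%:E <=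
  (center s)%:E + \int[P]_w (exchange_error s (Z w))%:E)%E.
Proof.
have [[mu_ mv_ iu iv] [u0 v0 iu2 u2]] := facts s.
under eq_integral do rewrite smooth_indE.
exact: (taylor_step_upper (x0 s) mu_ mv_ iu iv u0 v0 iu2 u2 dl psi0 alpha0).
Qed.

Lemma smooth_ind_lower s : ((center s)%:E <=
  \int[P]_w (smooth_ind (addv s (Z w)))%:E + \int[P]_w (exchange_error s (Z w))%:E)%E.
Proof.
have [[mu_ mv_ iu iv] [u0 v0 iu2 u2]] := facts s.
under eq_integral do rewrite smooth_indE.
exact: (taylor_step_lower (x0 s) mu_ mv_ iu iv u0 v0 iu2 u2 dl psi0 alpha0).
Qed.

End one.

Lemma exchange_step d (T : measurableType d) (P : probability T R) (X : T -> 'I_p -> R)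
    d' (T' : measurableType d') (Q : probability T' R) (Y : T' -> 'I_p -> R) s :
  matched P X S -> matched Q Y S ->
  (\int[P]_w (smooth_ind (addv s (X w)))%:E <=
   \int[Q]_w (smooth_ind (addv s (Y w)))%:E +
   (\int[P]_w (exchange_error s (X w))%:E + \int[Q]_w (exchange_error s (Y w))%:E))%E.
Proof.
move=> hX hY; apply: le_trans (smooth_ind_upper hX s) _.
apply: le_trans (leeD2r _ (smooth_ind_lower hY s)) _.
rewrite -addeA (addeC (\int[Q]_w (exchange_error _ _)%:E)%E).
exact: lexx.
Qed.

End exchange.

(** * Gaussian vectors with a prescribed covariance *)

Section gaussian_image.
Context {R : realType} d (T : measurableType d) (Q : probability T R) (p : nat).
Variable xi : 'I_p -> T -> R.
Hypothesis hxi : iid_std_normal Q xi.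
Variables (A S : 'M[R]_p).
Hypothesis AA : A *m A^T = S.
Local Notation gamma := (@normal_prob R 0 1).

Definition linear_image (v : vec R p) : vec R p := fun a => \sum_j A a j * v j.

Definition gauss_image (w : T) : vec R p := linear_image (gauss_vec xi w).

Lemma measurable_linear_image : measurable_fun setT linear_image.
Proof.
apply: measurable_vec => a; apply: measurable_sum => j.
by apply: measurable_funM => //; exact: measurable_coord.
Qed.

Lemma measurable_gauss_image a : measurable_fun setT (fun w => gauss_image w a).
Proof.
apply: measurable_sum => j; apply: measurable_funM => //.
by case: hxi => mx _ _; exact: mx.
Qed.

Lemma dotv_gauss_image s w : dotv (gauss_image w) s =
  \sum_j (\sum_a A a j * s a) * xi j w.
Proof.
rewrite /dotv; under eq_bigr do rewrite mulr_suml.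
rewrite exchange_big/=; apply: eq_bigr => j _; rewrite mulr_suml.
by apply: eq_bigr => a _; rewrite /gauss_vec; ring.
Qed.

Lemma quadf_factor s : quadf S s = \sum_j (\sum_a A a j * s a) ^+ 2.
Proof.
rewrite /quadf -AA.
transitivity (\sum_a \sum_b \sum_j (A a j * s a) * (A b j * s b)).
  apply: eq_bigr => a _; apply: eq_bigr => b _.
  rewrite mxE mulr_sumr mulr_suml; apply: eq_bigr => j _.
  by rewrite mxE; ring.
under eq_bigr do rewrite exchange_big/=.
rewrite exchange_big/=; apply: eq_bigr => j _.
rewrite expr2 mulr_suml; apply: eq_bigr => a _.
by rewrite mulr_sumr.
Qed.

Lemma integral_gauss_image s (f : R -> \bar R) :
  measurable_fun setT f -> (forall x, 0 <= f x)%E ->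
  (\int[Q]_w f (dotv (gauss_image w) s) =
   \int[gamma]_x f (Num.sqrt (quadf S s) * x)%R)%E.
Proof.
move=> mf f0; under eq_integral do rewrite dotv_gauss_image.
by rewrite (integral_linear_form hxi (fun j => \sum_a A a j * s a) (index_enum_uniq _))// quadf_factor.
Qed.

Lemma quadf_factor_ge0 s : 0 <= quadf S s.
Proof. by rewrite quadf_factor sumr_ge0// => j _; rewrite sqr_ge0. Qed.

Lemma gauss_image_dotv2 s : (\int[Q]_w (dotv (gauss_image w) s ^+ 2)%:E = (quadf S s)%:E)%E.
Proof.
rewrite (integral_gauss_image s (f := fun x => (x ^+ 2)%:E)); [|by mfun|by move=> x; rewrite lee_fin sqr_ge0].
under eq_integral do rewrite exprMn sqr_sqrtr ?quadf_factor_ge0//.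
rewrite integral_scaler; [|by mfun|by move=> x; rewrite sqr_ge0|exact: quadf_factor_ge0].
by rewrite gaussian_moment2 mule1.
Qed.

Lemma gauss_image_powR s (q mq : R) : 0 <= q ->
  (\int[gamma]_x (`|x| `^ q)%:E <= mq%:E)%E ->
  (\int[Q]_w (`|dotv (gauss_image w) s| `^ q)%:E <= ((quadf S s) `^ (q / 2) * mq)%:E)%E.
Proof.
move=> q0 hq.
rewrite (integral_gauss_image s (f := fun x => (`|x| `^ q)%:E)); [|by mfun|by []].
have E x : `|Num.sqrt (quadf S s) * x| `^ q = (quadf S s) `^ (q / 2) * `|x| `^ q.
  rewrite normrM powRM// ger0_norm ?sqrtr_ge0//; congr (_ * _).
  by rewrite -[in RHS](sqr_sqrtr (quadf_factor_ge0 s)) powR_sqr_half ?sqrtr_ge0.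
under eq_integral do rewrite E.
rewrite integral_scaler; [|by mfun|by []|exact: powR_ge0].
by rewrite EFinM lee_wpmul2l ?lee_fin ?powR_ge0.
Qed.

Let e_ (a : 'I_p) : 'I_p -> R := fun b => (a == b)%:R.

Let dotv_e v a : dotv v (e_ a) = v a.
Proof.
rewrite /dotv (bigD1 a)//= big1 => [|b /negbTE ba]; first by rewrite /e_ eqxx mulr1 addr0.
by rewrite /e_ eq_sym ba mulr0.
Qed.

Let quadf_e a b : quadf S (fun c => e_ a c + e_ b c) = S a a + S a b + S b a + S b b.
Proof.
have D (F : 'I_p -> R) c : \sum_k e_ c k * F k = F c.
  have := dotv_e F c; rewrite /dotv; under eq_bigr do rewrite mulrC; by [].
rewrite /quadf.
transitivity (\sum_k (e_ a k * (S k a + S k b) + e_ b k * (S k a + S k b))).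
  apply: eq_bigr => k _; rewrite -mulrDl.
  transitivity (\sum_l (e_ a l * ((e_ a k + e_ b k) * S k l) + e_ b l * ((e_ a k + e_ b k) * S k l))).
    by apply: eq_bigr => l _; ring.
  by rewrite big_split/= !D; ring.
by rewrite big_split/= !D; ring.
Qed.

Let quadf_e1 a : quadf S (e_ a) = S a a.
Proof.
have D (F : 'I_p -> R) c : \sum_k e_ c k * F k = F c.
  have := dotv_e F c; rewrite /dotv; under eq_bigr do rewrite mulrC; by [].
rewrite /quadf; transitivity (\sum_k e_ a k * (\sum_l e_ a l * S k l)).
  by apply: eq_bigr => k _; rewrite mulr_sumr; apply: eq_bigr => l _; ring.
by rewrite !D.
Qed.

Let sqr_int a : (\int[Q]_w (gauss_image w a ^+ 2)%:E = (S a a)%:E)%E.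
Proof.
by have := gauss_image_dotv2 (e_ a); under eq_integral do rewrite dotv_e; rewrite quadf_e1.
Qed.

(** Covariances come by polarisation: the second moment of the linear form at [e_ a] plus [e_ b] is
    known from [gauss_image_dotv2], and the two squares are subtracted. *)
Lemma matched_gauss_image : matched Q gauss_image S.
Proof.
have mY := measurable_gauss_image.
have iY2 a : Q.-integrable setT (EFin \o (fun w => gauss_image w a ^+ 2)).
  apply/integrableP; split; first by apply/measurable_EFinP; exact: measurable_funX.
  under eq_integral do rewrite /= ger0_norm ?sqr_ge0//.
  by rewrite sqr_int ltry.
have ixi j : Q.-integrable setT (EFin \o xi j).
  have mj : measurable_fun setT (xi j) by case: hxi.
  apply/integrableP; split; first exact/measurable_EFinP.
  under eq_integral do rewrite /=.
  rewrite (integral_std_normal hxi j (f := fun x => (`|x|)%:E)); [|by mfun|by []].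
  by have /integrableP[_] := @gaussian_integrable_id R.
have xi0 j : (\int[Q]_w (xi j w)%:E = 0)%E.
  have mj : measurable_fun setT (xi j) by case: hxi.
  rewrite integralE.
  have P1 : (\int[Q]_w (fun w => (xi j w)%:E)^\+ w = \int[gamma]_x (EFin \o (id : R -> R))^\+ x)%E.
    rewrite -(integral_std_normal hxi j).
    - by apply: eq_integral => w _; rewrite !funeposE.
    - by apply: measurable_funepos; apply/measurable_EFinP; exact: measurable_id.
    - by move=> x; exact: funepos_ge0.
  have P2 : (\int[Q]_w (fun w => (xi j w)%:E)^\- w = \int[gamma]_x (EFin \o (id : R -> R))^\- x)%E.
    rewrite -(integral_std_normal hxi j).
    - by apply: eq_integral => w _; rewrite !funenegE.
    - by apply: measurable_funeneg; apply/measurable_EFinP; exact: measurable_id.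
    - by move=> x; exact: funeneg_ge0.
  by rewrite P1 P2 -integralE; exact: gaussian_mean.
split => //.
- move=> a; rewrite /gauss_image /linear_image.
  under eq_integral do rewrite -sumEFin.
  rewrite (integral_sum measurableT (f := fun j w => (A a j * xi j w)%:E)); last first.
    by move=> j; exact: (integrableZl measurableT (A a j) (ixi j)).
  rewrite big1// => j _; under eq_integral do rewrite EFinM.
  by rewrite integralZl ?xi0 ?mule0//; exact: ixi.
- move=> a b.
  have sy : S b a = S a b by rewrite -AA -[in LHS](trmxK A) -trmx_mul mxE trmxK.
  have iab : Q.-integrable setT (EFin \o (fun w => gauss_image w a * gauss_image w b)).
    by apply: integrable_mul_sqr => //; exact: iY2.
  have := gauss_image_dotv2 (fun c => e_ a c + e_ b c).
  have E w : dotv (gauss_image w) (fun c => e_ a c + e_ b c) ^+ 2 =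
     gauss_image w a ^+ 2 + gauss_image w b ^+ 2 + 2 * (gauss_image w a * gauss_image w b).
    rewrite (_ : dotv _ _ = gauss_image w a + gauss_image w b); first by ring.
    rewrite -[X in _ = X + _]dotv_e -[X in _ = _ + X]dotv_e /dotv -big_split/=.
    by apply: eq_bigr => c _; ring.
  have EE w : ((dotv (gauss_image w) (fun c => (e_ a c + e_ b c)%R) ^+ 2)%:E =
     (gauss_image w a ^+ 2)%:E + (gauss_image w b ^+ 2)%:E +
     2%:E * (gauss_image w a * gauss_image w b)%:E)%E by rewrite E.
  under eq_integral do rewrite EE.
  have i12 := integrableD measurableT (iY2 a) (iY2 b).
  rewrite integralD; [|by []|exact: i12|exact: (integrableZl measurableT 2 iab)].
  rewrite integralD; [|by []|exact: iY2|exact: iY2].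
  rewrite !sqr_int integralZl; [|by []|exact: iab].
  rewrite quadf_e sy.
  have fI : (\int[Q]_w (gauss_image w a * gauss_image w b)%:E)%E \is a fin_num.
    exact: integrable_fin_num.
  rewrite -(fineK fI); set I := fine _ => -[H]; congr (_%:E); lra.
Qed.

End gaussian_image.

(** * Hybrid sums *)

Section lindeberg.
Context {R : realType} d (T : measurableType d) (P : probability T R) (p : nat).
Variable X : nat -> T -> 'I_p -> R.
Hypothesis hX : iid_vec P X.
Context d' (T' : measurableType d') (Q : probability T' R) (xi : 'I_p -> T' -> R).
Hypothesis hxi : iid_std_normal Q xi.
Variables (A : 'M[R]_p) (h : vec R p -> R).
Hypotheses (mh : measurable_fun setT h) (h0 : forall v, 0 <= h v).
Local Open Scope ereal_scope.

Let Y := gauss_image xi A.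

Let mX i a : measurable_fun setT (fun w => X i w a). Proof. by case: hX. Qed.

Let mXv i : measurable_fun setT (X i : T -> vec R p).
Proof. by apply: measurable_vec => a; exact: mX. Qed.

Let mY a : measurable_fun setT (fun w => Y w a).
Proof. exact: (measurable_gauss_image hxi A a). Qed.

Definition partial_sum (k : nat) (w : T) : vec R p :=
  fun a => (\sum_(i <- iota 0 k) X i w a)%R.

Definition hybrid (c : R) (k : nat) (z : T * T') : vec R p :=
  addv (partial_sum k z.1) (fun a => (c * Y z.2 a)%R).

Lemma measurable_partial_sum k a : measurable_fun setT (fun w => partial_sum k w a).
Proof. exact: measurable_sum. Qed.

Lemma measurable_hybrid c k a : measurable_fun setT (fun z => hybrid c k z a).
Proof.
apply: measurable_funD.
  exact: (measurableT_comp (measurable_partial_sum k a) measurable_fst).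
by apply: measurable_funM => //; exact: (measurableT_comp (mY a) measurable_snd).
Qed.

Let uniqk k : uniq (k :: iota 0 k).
Proof. by rewrite /= iota_uniq mem_iota /= add0n ltnn. Qed.

Lemma partial_sum_split k :
  joint_split P (partial_sum k) (X k : T -> vec R p) (X 0%N : T -> vec R p).
Proof.
apply: (past_split mXv _ (uniqk k)).
- by move=> s B us mB; case: hX => _ _; apply.
- apply: measurable_vec => a; apply: measurable_sum_in => i ik.
  have mi : measurable_fun setT (X i : past (X : nat -> T -> vec R p) (iota 0 k) -> vec R p).
    exact: (measurable_past ik).
  exact: (measurableT_comp (measurable_coord a) mi).
- exact: mXv.
- by move=> B mB; case: hX => _ H _; exact: H.
Qed.

Let mh2 d1 (T1 : measurableType d1) (g : T1 -> 'I_p -> R) :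
  (forall a, measurable_fun setT (fun z => g z a)) ->
  measurable_fun setT (fun z => (h (g z))%:E).
Proof.
move=> mg; apply/measurable_EFinP; apply: (measurableT_comp mh).
exact: (@measurable_vec _ _ _ _ g).
Qed.

Definition mixed c k := \int[P]_w \int[Q]_w' (h (hybrid c k (w, w')))%:E.

(** [X k] is independent of the partial sum and distributed as [X 0], so it can be integrated
    separately; Tonelli then moves it innermost, where [exchange_step] compares it with a Gaussian
    vector. *)
Lemma mixed_next c k : mixed c k.+1 =
  \int[P]_w \int[Q]_w' \int[P]_w1 (h (addv (hybrid c k (w, w')) (X 0%N w1)))%:E.
Proof.
pose g (z : vec R p * vec R p) := \int[Q]_w' (h (fun a => (z.1 a + z.2 a + c * Y w' a)%R))%:E.
have mg0 : measurable_fun setT (fun z : (vec R p * vec R p) * T' =>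
    (h (fun a => (z.1.1 a + z.1.2 a + c * Y z.2 a)%R))%:E).
  apply: mh2 => a; apply: measurable_funD; last first.
    by apply: measurable_funM => //; exact: (measurableT_comp (mY a) measurable_snd).
  apply: measurable_funD.
    exact: (measurableT_comp (measurable_coord a) (measurableT_comp measurable_fst measurable_fst)).
  exact: (measurableT_comp (measurable_coord a) (measurableT_comp measurable_snd measurable_fst)).
have mg : measurable_fun setT g.
  apply: (@measurable_integral_snd _ _ _ _ _ Q _ mg0).
  by move=> z; rewrite lee_fin.
transitivity (\int[P]_w g (partial_sum k w, X k w)).
  apply: eq_integral => w _; apply: eq_integral => w' _; congr ((h _)%:E).
  apply/funext => a; rewrite /hybrid /addv; congr (_ + _)%R.
  by rewrite /partial_sum -addn1 iotaD big_cat/= big_seq1 add0n.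
rewrite (joint_split_integral (phi := g) (partial_sum_split k) mg); last first.
  by move=> z; apply: integral_ge0 => *; rewrite lee_fin.
apply: eq_integral => w _; rewrite /g.
rewrite (@fubini_tonelli _ _ _ _ _ P Q
  (fun z : T * T' => (h (fun a => (partial_sum k w a + X 0%N z.1 a + c * Y z.2 a)%R))%:E)).
- apply: eq_integral => w' _; apply: eq_integral => w1 _; congr ((h _)%:E).
  by apply/funext => a; rewrite /hybrid /addv /=; ring.
- apply: mh2 => a; apply: measurable_funD; last first.
    by apply: measurable_funM => //; exact: (measurableT_comp (mY a) measurable_snd).
  apply: measurable_funD => //.
  exact: (measurableT_comp (mX 0%N a) measurable_fst).
- by move=> z; rewrite lee_fin.
Qed.

(* The Gaussian component is split off by rotation invariance. *)
Lemma mixed_split (m : R) k : (0 <= m)%R -> mixed (Num.sqrt (m + 1)) k =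
  \int[P]_w \int[Q]_w' \int[Q]_w1 (h (addv (hybrid (Num.sqrt m) k (w, w')) (Y w1)))%:E.
Proof.
move=> m0; have m1 : (0 < m + 1)%R by rewrite ltr_wpDl.
have s1 : (0 < Num.sqrt (m + 1))%R by rewrite sqrtr_gt0.
apply: eq_integral => w _.
pose f (v : vec R p) := (h (addv (partial_sum k w)
  (fun a => (Num.sqrt (m + 1) * linear_image A v a)%R)))%:E.
have mf : measurable_fun setT f.
  apply: mh2 => a; apply: measurable_funD => //; apply: measurable_funM => //.
  exact: (measurableT_comp (measurable_coord a) (measurable_linear_image A)).
transitivity (\int[Q]_w' f (gauss_vec xi w')) => //.
rewrite -(@gauss_vec_rotation _ _ _ _ _ _ hxi (Num.sqrt m / Num.sqrt (m + 1)) (Num.sqrt (m + 1))^-1 f).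
- apply: eq_integral => w' _; apply: eq_integral => w1 _; congr ((h _)%:E).
  apply/funext => a; rewrite /hybrid /addv /= -addrA; congr (_ + _)%R.
  rewrite /Y /gauss_image /linear_image !mulr_sumr -big_split/=.
  apply: eq_bigr => j _; rewrite /gauss_vec; field.
  by rewrite gt_eqF.
- by rewrite invr_gt0.
- rewrite exprMn exprVn !sqr_sqrtr// ?ltW//.
  by field; rewrite gt_eqF.
- exact: mf.
- by move=> v; rewrite lee_fin.
Qed.

End lindeberg.

(** * Error bounds and telescoping *)

Section same_law.
Context {R : realType} d (T : measurableType d) (P : probability T R) (p : nat).
Variable X : nat -> T -> 'I_p -> R.
Hypothesis hX : iid_vec P X.
Local Open Scope ereal_scope.

Let mXv i : measurable_fun setT (X i : T -> vec R p).
Proof. by apply: measurable_vec => a; case: hX. Qed.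

Lemma iid_integral i (f : vec R p -> \bar R) :
  measurable_fun setT f -> (forall v, 0 <= f v) ->
  \int[P]_w f (X i w) = \int[P]_w f (X 0%N w).
Proof.
move=> mf f0.
pose X_ j : {mfun T >-> vec R p} :=
  HB.pack (X j : T -> vec R p) (isMeasurableFun.Build _ _ _ _ _ (mXv j)).
rewrite -(@ge0_integral_distribution _ _ _ _ _ P (X_ i) f)//.
rewrite -(@ge0_integral_distribution _ _ _ _ _ P (X_ 0%N) f)//.
apply: eq_measure_integral => B mB _.
by case: hX => _ H _; exact: H.
Qed.

Lemma iid_integrable i (f : vec R p -> R) : measurable_fun setT f ->
  P.-integrable setT (fun w => (f (X 0%N w))%:E) ->
  P.-integrable setT (fun w => (f (X i w))%:E) /\
  \int[P]_w (f (X i w))%:E = \int[P]_w (f (X 0%N w))%:E.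
Proof.
move=> mf /integrableP[m0 H]; split.
  apply/integrableP; split.
    by apply/measurable_EFinP; exact: (measurableT_comp mf (mXv i)).
  by rewrite (iid_integral i (f := fun v => (`|f v|%R)%:E))//; mfun.
rewrite [LHS]integralE [RHS]integralE; congr (_ - _).
- under eq_integral do rewrite funeposE.
  under [RHS]eq_integral do rewrite funeposE.
  rewrite (iid_integral i (f := fun v => maxe (f v)%:E 0))//.
  + by apply: measurable_maxe => //; apply/measurable_EFinP; exact: mf.
  + by move=> v; rewrite le_max lexx orbT.
- under eq_integral do rewrite funenegE.
  under [RHS]eq_integral do rewrite funenegE.
  rewrite (iid_integral i (f := fun v => maxe (- (f v)%:E) 0))//.
  + apply: measurable_maxe => //; apply: measurableT_comp => //; apply/measurable_EFinP; exact: mf.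
  + by move=> v; rewrite le_max lexx orbT.
Qed.

Variable S : 'M[R]_p.
Hypothesis hX0 : matched P (X 0%N) S.

Let phi (z : 'I_p -> R) (i : nat) (x : vec R p) : R := dotv x z.

Let mphi z i : measurable_fun setT (phi z i).
Proof.
apply: measurable_sum => a; apply: measurable_funM => //; exact: measurable_coord.
Qed.

Let dotvC (x y : 'I_p -> R) : dotv x y = dotv y x.
Proof. by apply: eq_bigr => a _; rewrite mulrC. Qed.

Let phi_int z i : P.-integrable setT (fun w => (phi z i (X i w))%:E) /\
  \int[P]_w (phi z i (X i w))%:E = 0.
Proof.
have E : (fun w => (phi z i (X 0%N w))%:E) = EFin \o (fun w => dotv z (X 0%N w)).
  by apply/funext => w; rewrite /phi /= dotvC.
have H : P.-integrable setT (fun w => (phi z i (X 0%N w))%:E).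
  by rewrite E; exact: matched_dotv_integrable hX0 z.
have [h1 h2] := iid_integrable i (mphi z i) H.
split => //; rewrite h2; under eq_integral do rewrite /phi dotvC.
exact: matched_dotv_mean hX0 z.
Qed.

Let phi_sqr z i : \int[P]_w (phi z i (X i w) ^+ 2)%:E <= (quadf S z)%:E.
Proof.
rewrite (iid_integral i (f := fun v => (phi z i v ^+ 2)%:E)).
- under eq_integral do rewrite /phi dotvC.
  by rewrite (matched_dotv2 hX0 z).
- by apply/measurable_EFinP; exact: measurable_funX.
- by move=> v; rewrite lee_fin sqr_ge0.
Qed.

Let partial_dot k z w : dotv (partial_sum X k w) z = (\sum_(i <- iota 0 k) phi z i (X i w))%R.
Proof.
rewrite /dotv /partial_sum; under eq_bigr do rewrite mulr_suml.
by rewrite exchange_big.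
Qed.

Let indepX (s : seq nat) (B : nat -> set (vec R p)) : uniq s ->
  (forall i, measurable (B i)) ->
  P (\big[setI/setT]_(i <- s) ((X i : T -> vec R p) @^-1` B i)) =
  \prod_(i <- s) P ((X i : T -> vec R p) @^-1` B i).
Proof. by move=> us mB; case: hX => _ _; apply. Qed.

Lemma partial_sum_dotv2 k z :
  \int[P]_w (dotv (partial_sum X k w) z ^+ 2)%:E <= (k%:R * quadf S z)%:E.
Proof.
under eq_integral do rewrite partial_dot.
have := @indep_sum_sqr _ _ _ _ _ _ _ _ mXv indepX (phi z) (mphi z)
  (fun i => (phi_int z i).1) (fun i => (phi_int z i).2) _ (phi_sqr z) (iota 0 k) (iota_uniq _ _).
by rewrite big_const_seq count_predT size_iota iter_addr_0 mulr_natl.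
Qed.

(** Projection on a fixed [z] reduces to scalar summands. The parameter [v] is any positive bound on
    the variance of the projection, which may itself vanish. *)
Lemma partial_sum_powR (delta v : R) k z : (0 < delta <= 1)%R -> (0 < v)%R ->
  (k%:R * quadf S z <= v)%R ->
  \int[P]_w (`|dotv (partial_sum X k w) z| `^ (2 + delta))%:E <=
  (8 * v `^ (1 + delta / 2))%:E +
  (8 * k%:R)%:E * \int[P]_w (`|dotv (X 0%N w) z| `^ (2 + delta))%:E.
Proof.
move=> dl v0 kv; have /andP[d0 d1] := dl.
under eq_integral do rewrite partial_dot.
have SS : (\sum_(i <- iota 0 k) quadf S z = k%:R * quadf S z)%R.
  by rewrite big_const_seq count_predT size_iota iter_addr_0 mulr_natl.
have := @indep_sum_powR _ _ _ _ _ _ _ _ mXv indepX (phi z) (mphi z)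
  (fun i => (phi_int z i).1) (fun i => (phi_int z i).2) _ (phi_sqr z) delta v (iota 0 k) dl v0 (iota_uniq _ _).
rewrite SS => /(_ kv) /le_trans; apply.
set G := \int[P]_w (`|dotv (X 0%N w) z| `^ (2 + delta))%:E.
have EG i : \int[P]_w (`|phi z i (X i w)| `^ (2 + delta))%:E = G.
  rewrite (iid_integral i (f := fun v => (`|phi z i v| `^ (2 + delta))%:E))//.
  by mfun; exact: mphi.
rewrite (eq_bigr _ (fun i _ => EG i)) big_const_seq count_predT size_iota.
have -> : iter k (adde G) 0 = k%:R%:E * G.
  elim: k {SS kv} => [|k IH]; first by rewrite mul0e.
  by rewrite iterS IH -natr1 EFinD addrC ge0_muleDl// mul1e.
rewrite muleA -EFinM leeD2r// lee_fin -mulrA ler_wpM2l//.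
rewrite powRD; last by apply/implyP => _; rewrite gt_eqF.
rewrite powRr1; last exact: ltW.
by rewrite [leRHS]mulrC; apply: ler_wpM2l => //; exact: powR_ge0.
Qed.

End same_law.

Section tonelli.
Context {R : realType} d1 d2 d3 (T1 : measurableType d1) (T2 : measurableType d2)
  (T3 : measurableType d3).
Variables (P1 : probability T1 R) (P2 : probability T2 R) (P3 : probability T3 R).
Local Open Scope ereal_scope.

(** Puts the newest vector outermost: errors are estimated for a fixed value of it and integrated
    over that value last. *)
Lemma tonelli3 (F : T1 -> T2 -> T3 -> \bar R) :
  measurable_fun setT (fun z : T1 * T2 * T3 => F z.1.1 z.1.2 z.2) ->
  (forall x y z, 0 <= F x y z) ->
  \int[P1]_x \int[P2]_y \int[P3]_z F x y z = \int[P3]_z \int[P1]_x \int[P2]_y F x y z.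
Proof.
move=> mF F0.
have mF' : measurable_fun setT (fun z : T1 * T3 * T2 => F z.1.1 z.2 z.1.2).
  apply: (measurableT_comp mF (g := fun z : T1 * T3 * T2 => (z.1.1, z.2, z.1.2))).
  apply: measurable_fun_pair; last first.
    exact: (measurableT_comp measurable_snd measurable_fst).
  apply: measurable_fun_pair; last exact: measurable_snd.
  exact: (measurableT_comp measurable_fst measurable_fst).
transitivity (\int[P1]_x \int[P3]_z \int[P2]_y F x y z).
  apply: eq_integral => x _.
  apply: (@fubini_tonelli _ _ _ _ _ P2 P3 (fun u : T2 * T3 => F x u.1 u.2)) => //.
  apply: (measurableT_comp mF (g := fun u : T2 * T3 => (x, u.1, u.2))).
  apply: measurable_fun_pair; last exact: measurable_snd.
  by apply: measurable_fun_pair => //; exact: measurable_fst.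
apply: (@fubini_tonelli _ _ _ _ _ P1 P3 (fun u : T1 * T3 => \int[P2]_y F u.1 y u.2)).
  exact: (@measurable_integral_snd _ _ _ _ _ P2 _ mF').
by move=> u; apply: integral_ge0.
Qed.

End tonelli.

(** [a] and [b] stand for the projections of the X part and of the Gaussian part of a hybrid sum.
    The factor 1/2 in [taylor_remainder] absorbs (a + b)^2 <= 2 (a^2 + b^2), and 192 = 24 * 8. *)
Lemma taylor_remainder_le {R : realType} (delta psi alpha c a b v : R) :
  0 < delta <= 1 -> 0 < psi -> 0 < alpha -> 0 < c ->
  taylor_remainder delta psi alpha (c * (a + b)) v <=
  psi ^+ 2 * alpha * c ^+ 2 * (a ^+ 2 + b ^+ 2) +
  192 * psi `^ (2 + delta) * c `^ (2 + delta) *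
    (`|a| `^ (2 + delta) + `|b| `^ (2 + delta)) +
  taylor_remainder delta psi alpha 0 v.
Proof.
move=> /andP[d0 d1] p0 a0 c0; rewrite /taylor_remainder.
have H := @powR_normD_le R a b (2 + delta) ltac:(apply/andP; split; lra).
rewrite normrM gtr0_norm// powRM//; last exact: ltW.
rewrite normr0 powR0; last by rewrite gt_eqF//; lra.
have pq := powR_ge0 psi (2 + delta); have cq := powR_ge0 c (2 + delta).
have {}H := ler_wpM2l (mulr_ge0 pq cq) H.
have ab : 0 <= psi ^+ 2 / 2 * alpha * c ^+ 2 * (a - b) ^+ 2.
  by nneg.
have -> : psi ^+ 2 / 2 * (alpha * (c * (a + b)) ^+ 2 + (alpha^-1 + 1) * v ^+ 2) =
   psi ^+ 2 * alpha * c ^+ 2 * (a ^+ 2 + b ^+ 2) - psi ^+ 2 / 2 * alpha * c ^+ 2 * (a - b) ^+ 2 +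
   psi ^+ 2 / 2 * (alpha * 0 ^+ 2 + (alpha^-1 + 1) * v ^+ 2).
  by field; rewrite gt_eqF.
lra.
Qed.

Section exchange_error_bound.
Context {R : realType} d (T : measurableType d) (P : probability T R) (p : nat).
Variable X : nat -> T -> 'I_p -> R.
Hypothesis hX : iid_vec P X.
Context d' (T' : measurableType d') (Q : probability T' R) (xi : 'I_p -> T' -> R).
Hypothesis hxi : iid_std_normal Q xi.
Variables (A S : 'M[R]_p).
Hypothesis AA : A *m A^T = S.
Hypothesis hX0 : matched P (X 0%N) S.
Variables (nn f psi delta alpha mq : R).
Hypotheses (nn0 : 0 < nn) (f0 : 0 < f) (psi0 : 0 < psi) (alpha0 : 0 < alpha).
Hypothesis dl : 0 < delta <= 1.
Hypothesis mqE : (\int[@normal_prob R 0 1]_x (`|x| `^ (2 + delta))%:E <= mq%:E)%E.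

Let Y := gauss_image xi A.
Let c := 2 / (nn * f).
Let K1 := psi ^+ 2 * alpha * c ^+ 2.
Let K3 := 192 * psi `^ (2 + delta) * c `^ (2 + delta).
Let v (z : 'I_p -> R) := (nn * f)^-1 * (sumsq z - \tr S).
Let rest z := taylor_remainder delta psi alpha 0 (v z).
Let G (z : 'I_p -> R) := (\int[P]_w (`|dotv (X 0%N w) z| `^ (2 + delta))%:E)%E.

Let c0 : 0 < c. Proof. by rewrite divr_gt0 ?mulr_gt0. Qed.
Let K10 : 0 <= K1. Proof. by rewrite /K1; have := c0; move=> *; nneg. Qed.
Let K30 : 0 <= K3. Proof. by rewrite /K3 !mulr_ge0// powR_ge0. Qed.
Let mq0 : 0 <= mq.
Proof. by rewrite -lee_fin; apply: le_trans mqE; apply: integral_ge0 => *; rewrite lee_fin powR_ge0. Qed.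
Let rest0 z : 0 <= rest z. Proof. exact: taylor_remainder_ge0. Qed.
Let quadf0 z : 0 <= quadf S z. Proof. exact: (quadf_factor_ge0 AA). Qed.

Let mX i a : measurable_fun setT (fun w => X i w a). Proof. by case: hX. Qed.
Let mS k z : measurable_fun setT (fun w => dotv (partial_sum X k w) z).
Proof.
apply: measurable_sum => a; apply: measurable_funM => //.
exact: (measurable_partial_sum hX).
Qed.
Let mYz z : measurable_fun setT (fun w => dotv (Y w) z).
Proof.
apply: measurable_sum => a; apply: measurable_funM => //.
exact: (measurable_gauss_image hxi A a).
Qed.

Let dotv_hybrid m k w w' z : dotv (hybrid X xi A m k (w, w')) z =
  dotv (partial_sum X k w) z + m * dotv (Y w') z.
Proof.
rewrite /hybrid dotv_addl /= /Y; congr (_ + _); rewrite /dotv mulr_sumr.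
by apply: eq_bigr => a _; rewrite mulrA.
Qed.

(** The added f^2 keeps the variance bound in the Rosenthal inequality positive when the quadratic
    form vanishes at [z]; after integration over [z] it is of the same order as the form itself,
    whose mean is f^2. *)
Definition exchange_bound z : R :=
  K1 * (nn * quadf S z) + K3 * (8 + mq) * (nn * (quadf S z + f ^+ 2)) `^ (1 + delta / 2) + rest z.

Let inner m k w z : 0 <= m ->
  (\int[Q]_w' (exchange_error S nn f psi delta alpha (hybrid X xi A (Num.sqrt m) k (w, w')) z)%:E
   <= (K1 * dotv (partial_sum X k w) z ^+ 2 + K3 * `|dotv (partial_sum X k w) z| `^ (2 + delta) +
       (K1 * m * quadf S z + K3 * mq * (m * quadf S z) `^ (1 + delta / 2) + rest z))%:E)%E.
Proof.
move=> m0; have /andP[d0 d1] := dl.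
set a := dotv (partial_sum X k w) z.
pose C0 := K1 * a ^+ 2 + K3 * `|a| `^ (2 + delta) + rest z.
have mB := mYz z.
apply: (@le_trans _ _ (\int[Q]_w' (C0 + (K1 * m * dotv (Y w') z ^+ 2 +
    K3 * m `^ (1 + delta / 2) * `|dotv (Y w') z| `^ (2 + delta)))%:E)%E).
  apply: ge0_integral_mono => w'; rewrite lee_fin; first exact: taylor_remainder_ge0.
  rewrite /exchange_error dotv_hybrid -/a.
  have /le_trans := @taylor_remainder_le R delta psi alpha c a (Num.sqrt m * dotv (Y w') z) (v z) dl psi0 alpha0 c0.
  apply.
  rewrite -/K1 -/K3 exprMn sqr_sqrtr// normrM ger0_norm ?sqrtr_ge0// powRM ?sqrtr_ge0//.
  have -> : Num.sqrt m `^ (2 + delta) = m `^ (1 + delta / 2).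
    rewrite -[in RHS](sqr_sqrtr m0) (_ : 1 + delta / 2 = (2 + delta) / 2); last by field.
    by rewrite powR_sqr_half ?sqrtr_ge0.
  rewrite /C0 /rest /v; lra.
have C00 : 0 <= C0 by rewrite /C0; nneg.
have t1 w' : 0 <= K1 * m * dotv (Y w') z ^+ 2 by nneg.
have t2 w' : 0 <= K3 * m `^ (1 + delta / 2) * `|dotv (Y w') z| `^ (2 + delta).
  by nneg.
rewrite integral_addr; [|by mfun|by mfun|by []|by move=> w'; rewrite addr_ge0].
rewrite (prob_integral_cst Q).
rewrite integral_addr; [|by mfun|by mfun|exact: t1|exact: t2].
rewrite integral_scaler; [|by mfun|by move=> *; rewrite sqr_ge0|by nneg].
rewrite integral_scaler; [|by mfun|by move=> *; rewrite powR_ge0|by nneg].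
rewrite (gauss_image_dotv2 hxi AA).
have H := gauss_image_powR hxi AA z (ltac:(lra) : 0 <= 2 + delta) mqE.
have K30' : 0 <= K3 * m `^ (1 + delta / 2) by nneg.
apply: (@le_trans _ _ (C0%:E + ((K1 * m)%:E * (quadf S z)%:E +
   (K3 * m `^ (1 + delta / 2))%:E * (quadf S z `^ ((2 + delta) / 2) * mq)%:E))%E).
  by rewrite leeD2l// leeD2l// lee_wpmul2l.
rewrite -!EFinM -!EFinD lee_fin /C0 powRM//.
rewrite (_ : (2 + delta) / 2 = 1 + delta / 2); last by field.
by rewrite le_eqVlt; apply/orP; left; apply/eqP; ring.
Qed.

(** In the direction [z] the hybrid sum has variance (k + m) z^T S z <= nn z^T S z, so the bound
    does not depend on how the sum is shared between the two kinds of summands. *)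
Lemma exchange_error_le m k z : 0 <= m -> k%:R + m <= nn ->
  (\int[P]_w \int[Q]_w' (exchange_error S nn f psi delta alpha
      (hybrid X xi A (Num.sqrt m) k (w, w')) z)%:E
   <= (exchange_bound z)%:E + (8 * nn * K3)%:E * G z)%E.
Proof.
move=> m0 km; have /andP[d0 d1] := dl.
have k0 : 0 <= k%:R :> R by [].
pose D0 := K1 * m * quadf S z + K3 * mq * (m * quadf S z) `^ (1 + delta / 2) + rest z.
have D00 : 0 <= D0 by rewrite /D0; nneg.
have mSk := mS k z.
apply: (@le_trans _ _ (\int[P]_w (K1 * dotv (partial_sum X k w) z ^+ 2 +
    K3 * `|dotv (partial_sum X k w) z| `^ (2 + delta) + D0)%:E)%E).
  apply: ge0_integral_mono => w; last exact: inner.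
  by apply: integral_ge0 => *; rewrite lee_fin taylor_remainder_ge0.
have t1 w : 0 <= K1 * dotv (partial_sum X k w) z ^+ 2 by nneg.
have t2 w : 0 <= K3 * `|dotv (partial_sum X k w) z| `^ (2 + delta) by nneg.
rewrite integral_addr; [|by mfun|by mfun|by move=> w; rewrite addr_ge0|by []].
rewrite (prob_integral_cst P).
rewrite integral_addr; [|by mfun|by mfun|exact: t1|exact: t2].
rewrite integral_scaler; [|by mfun|by move=> *; rewrite sqr_ge0|by []].
rewrite integral_scaler; [|by mfun|by move=> *; rewrite powR_ge0|by []].
pose vv := nn * (quadf S z + f ^+ 2).
have f20 : 0 < f ^+ 2 by rewrite exprn_gt0.
have vv0 : 0 < vv by rewrite mulr_gt0// ltr_wpDl.
have kv : k%:R * quadf S z <= vv.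
  by rewrite /vv; apply: ler_pM => //; [lra|rewrite lerDl ltW].
have mv : m * quadf S z <= vv.
  by rewrite /vv; apply: ler_pM => //; [lra|rewrite lerDl ltW].
have H2 := partial_sum_dotv2 hX hX0 k z.
have Hq := partial_sum_powR hX hX0 dl vv0 kv.
rewrite -/(G z) in Hq.
have G0 : (0 <= G z)%E by apply: integral_ge0 => *; rewrite lee_fin powR_ge0.
apply: (@le_trans _ _ (K1%:E * (k%:R * quadf S z)%:E + K3%:E * ((8 * vv `^ (1 + delta / 2))%:E +
    (8 * k%:R)%:E * G z) + D0%:E)%E).
  by rewrite leeD2r// leeD// lee_wpmul2l.
rewrite ge0_muleDr; [|by rewrite lee_fin mulr_ge0 ?powR_ge0|by rewrite mule_ge0// lee_fin mulr_ge0].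
rewrite muleA -!EFinM addeA (addeAC _ (_ * G z)%E) -!EFinD.
apply: leeD; last first.
  apply: lee_wpmul2r => //; rewrite lee_fin.
  by have := ler_wpM2l K30 (ltac:(lra) : k%:R <= nn); lra.
rewrite lee_fin /exchange_bound -/vv /D0.
have mvp : (m * quadf S z) `^ (1 + delta / 2) <= vv `^ (1 + delta / 2).
  by apply: ge0_ler_powR; rewrite ?nnegrE//; [lra|nneg|exact: ltW].
have h1 := ler_wpM2l (mulr_ge0 K30 mq0) mvp.
have h2 : K1 * (k%:R * quadf S z + m * quadf S z) <= K1 * (nn * quadf S z).
  by rewrite ler_wpM2l// -mulrDl ler_wpM2r.
lra.
Qed.

End exchange_error_bound.

Section iterated_sum.
Context {R : realType} d1 d2 (T1 : measurableType d1) (T2 : measurableType d2).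
Variables (P1 : probability T1 R) (P2 : probability T2 R).
Local Open Scope ereal_scope.

Lemma iterated_integralD (F G : T1 * T2 -> \bar R) :
  measurable_fun setT F -> measurable_fun setT G ->
  (forall z, 0 <= F z) -> (forall z, 0 <= G z) ->
  \int[P1]_x \int[P2]_y (F (x, y) + G (x, y)) =
  \int[P1]_x \int[P2]_y F (x, y) + \int[P1]_x \int[P2]_y G (x, y).
Proof.
move=> mF mG F0 G0.
rewrite -ge0_integralD//.
- apply: eq_integral => x _; rewrite ge0_integralD//.
  + exact: (measurableT_comp mF (pair1_measurable x)).
  + exact: (measurableT_comp mG (pair1_measurable x)).
- by move=> x _; apply: integral_ge0.
- exact: measurable_integral_snd.
- by move=> x _; apply: integral_ge0.
- exact: measurable_integral_snd.
Qed.

Lemma iterated_integral_mono (F G : T1 * T2 -> \bar R) :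
  (forall z, 0 <= F z) -> (forall z, F z <= G z) ->
  \int[P1]_x \int[P2]_y F (x, y) <= \int[P1]_x \int[P2]_y G (x, y).
Proof.
move=> F0 FG; apply: ge0_integral_mono => x; first exact: integral_ge0.
exact: ge0_integral_mono.
Qed.

Lemma iterated_integral_le_add (F G H1 H2 : T1 * T2 -> \bar R) (E : R) :
  measurable_fun setT G -> measurable_fun setT H1 -> measurable_fun setT H2 ->
  (forall z, 0 <= F z) -> (forall z, 0 <= G z) -> (forall z, 0 <= H1 z) -> (forall z, 0 <= H2 z) ->
  (forall z, F z <= G z + (H1 z + H2 z)) ->
  \int[P1]_x \int[P2]_y H1 (x, y) <= E%:E -> \int[P1]_x \int[P2]_y H2 (x, y) <= E%:E ->
  \int[P1]_x \int[P2]_y F (x, y) <= \int[P1]_x \int[P2]_y G (x, y) + (2 * E)%:E.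
Proof.
move=> mG m1 m2 F0 G0 H10 H20 le e1 e2.
apply: le_trans (iterated_integral_mono F0 le) _.
have E1 := iterated_integralD mG (emeasurable_funD m1 m2) G0 (fun z => adde_ge0 (H10 z) (H20 z)).
have E2 := iterated_integralD m1 m2 H10 H20.
apply: (@le_trans _ _ (\int[P1]_x \int[P2]_y G (x, y) +
  (\int[P1]_x \int[P2]_y H1 (x, y) + \int[P1]_x \int[P2]_y H2 (x, y)))).
  by rewrite -E2 -E1.
rewrite leeD2l//.
rewrite (_ : (2 * E)%:E = E%:E + E%:E); last by rewrite -EFinD; congr (_%:E); ring.
exact: leeD.
Qed.

End iterated_sum.

(** * Telescoping over the exchanges *)

Section telescoping.
Context {R : realType} d (T : measurableType d) (P : probability T R) (p : nat).
Variable X : nat -> T -> 'I_p -> R.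
Hypothesis hX : iid_vec P X.
Context d' (T' : measurableType d') (Q : probability T' R) (xi : 'I_p -> T' -> R).
Hypothesis hxi : iid_std_normal Q xi.
Variables (A S : 'M[R]_p).
Hypothesis AA : A *m A^T = S.
Hypothesis hX0 : matched P (X 0%N) S.
Variables (n : nat) (f psi t delta alpha mq : R).
Hypotheses (n0 : (0 < n)%N) (f0 : 0 < f) (psi0 : 0 < psi) (alpha0 : 0 < alpha).
Hypothesis dl : 0 < delta <= 1.

Let Y := gauss_image xi A.
Let hY : matched Q Y S. Proof. exact: matched_gauss_image. Qed.
Let nn0 : 0 < n%:R :> R. Proof. by rewrite ltr0n. Qed.
Let h : vec R p -> R := smooth_ind S n%:R f psi t.

Lemma measurable_smooth_ind : measurable_fun setT h.
Proof.
have ms : measurable_fun setT (fun v : vec R p => sumsq v).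
  by apply: measurable_sum => a; apply: measurable_funX; exact: measurable_coord.
have mu : measurable_fun setT
    (fun v : vec R p => psi * ((sumsq v / n%:R - \tr S) / f - t)) by mfun.
exact: (measurableT_comp measurable_cutoff mu).
Qed.

Lemma smooth_ind_ge0 v : 0 <= h v.
Proof. by have [/andP[]] := cutoff_bounds (psi * ((sumsq v / n%:R - \tr S) / f - t)). Qed.

Section one_vector.
Context d1 (T1 : measurableType d1) (W : probability T1 R) (Z : T1 -> 'I_p -> R).
Hypothesis hZ : matched W Z S.

Let mZ a : measurable_fun setT (fun w => Z w a). Proof. by case: hZ. Qed.

Lemma measurable_smooth_hybrid m k :
  measurable_fun setT (fun z : T * T' * T1 => (h (addv (hybrid X xi A m k z.1) (Z z.2)))%:E).
Proof.
apply/measurable_EFinP; apply: (measurableT_comp measurable_smooth_ind).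
apply: (@measurable_vec _ _ _ _ (fun z : T * T' * T1 => addv (hybrid X xi A m k z.1) (Z z.2))) => a.
apply: measurable_funD.
  exact: (measurableT_comp (measurable_hybrid hX hxi A m k a) measurable_fst).
exact: (measurableT_comp (mZ a) measurable_snd).
Qed.

Lemma measurable_error_hybrid m k :
  measurable_fun setT (fun z : T * T' * T1 =>
    (exchange_error S n%:R f psi delta alpha (hybrid X xi A m k z.1) (Z z.2))%:E).
Proof.
have m1 a : measurable_fun setT (fun z : T * T' * T1 => hybrid X xi A m k z.1 a).
  exact: (measurableT_comp (measurable_hybrid hX hxi A m k a) measurable_fst).
have m2 a : measurable_fun setT (fun z : T * T' * T1 => Z z.2 a).
  exact: (measurableT_comp (mZ a) measurable_snd).
apply/measurable_EFinP; apply: measurable_taylor_remainder.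
  apply: measurable_funM => //; apply: measurable_sum => a; exact: measurable_funM.
apply: measurable_funM => //; apply: measurable_funB => //.
by apply: measurable_sum => a; exact: measurable_funX.
Qed.

End one_vector.

Variable E : R.
Hypothesis EX : forall k m, 0 <= m -> k%:R + m <= n%:R ->
  (\int[P]_w \int[Q]_w' \int[P]_w1 (exchange_error S n%:R f psi delta alpha
      (hybrid X xi A (Num.sqrt m) k (w, w')) (X 0%N w1))%:E <= E%:E)%E.
Hypothesis EY : forall k m, 0 <= m -> k%:R + m <= n%:R ->
  (\int[P]_w \int[Q]_w' \int[Q]_w1 (exchange_error S n%:R f psi delta alpha
      (hybrid X xi A (Num.sqrt m) k (w, w')) (Y w1))%:E <= E%:E)%E.

Let J k := mixed P X Q xi A h (Num.sqrt (n - k)%:R) k.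

Let err0 s z : (0 <= (exchange_error S n%:R f psi delta alpha s z)%:E)%E.
Proof. by rewrite lee_fin taylor_remainder_ge0. Qed.

Let step d1 (T1 : measurableType d1) (W : probability T1 R) (Z : T1 -> 'I_p -> R)
    d2 (T2 : measurableType d2) (W' : probability T2 R) (Z' : T2 -> 'I_p -> R) m k :
  matched W Z S -> matched W' Z' S ->
  (\int[P]_w \int[Q]_w' \int[W]_w1 (exchange_error S n%:R f psi delta alpha
      (hybrid X xi A (Num.sqrt m) k (w, w')) (Z w1))%:E <= E%:E ->
   \int[P]_w \int[Q]_w' \int[W']_w1 (exchange_error S n%:R f psi delta alpha
      (hybrid X xi A (Num.sqrt m) k (w, w')) (Z' w1))%:E <= E%:E ->
   \int[P]_w \int[Q]_w' \int[W]_w1 (h (addv (hybrid X xi A (Num.sqrt m) k (w, w')) (Z w1)))%:E <=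
   \int[P]_w \int[Q]_w' \int[W']_w1 (h (addv (hybrid X xi A (Num.sqrt m) k (w, w')) (Z' w1)))%:E
   + (2 * E)%:E)%E.
Proof.
move=> hZ hZ' e1 e2.
pose I1 z := (\int[W]_w1 (h (addv (hybrid X xi A (Num.sqrt m) k z) (Z w1)))%:E)%E.
pose I2 z := (\int[W']_w1 (h (addv (hybrid X xi A (Num.sqrt m) k z) (Z' w1)))%:E)%E.
pose R1 z := (\int[W]_w1 (exchange_error S n%:R f psi delta alpha
      (hybrid X xi A (Num.sqrt m) k z) (Z w1))%:E)%E.
pose R2 z := (\int[W']_w1 (exchange_error S n%:R f psi delta alpha
      (hybrid X xi A (Num.sqrt m) k z) (Z' w1))%:E)%E.
have I20 z : (0 <= I2 z)%E by apply: integral_ge0 => *; rewrite lee_fin smooth_ind_ge0.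
have I10 z : (0 <= I1 z)%E by apply: integral_ge0 => *; rewrite lee_fin smooth_ind_ge0.
have R10 z : (0 <= R1 z)%E by apply: integral_ge0 => *; exact: err0.
have R20 z : (0 <= R2 z)%E by apply: integral_ge0 => *; exact: err0.
have mI2 : measurable_fun setT I2.
  apply: (measurable_integral_snd _ (measurable_smooth_hybrid hZ' (Num.sqrt m) k)).
  by move=> z; rewrite lee_fin smooth_ind_ge0.
have mR1 : measurable_fun setT R1.
  by apply: (measurable_integral_snd _ (measurable_error_hybrid hZ (Num.sqrt m) k)) => z; exact: err0.
have mR2 : measurable_fun setT R2.
  by apply: (measurable_integral_snd _ (measurable_error_hybrid hZ' (Num.sqrt m) k)) => z; exact: err0.
exact: (@iterated_integral_le_add _ _ _ _ _ P Q I1 I2 R1 R2 E mI2 mR1 mR2 I10 I20 R10 R20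
  (fun z => exchange_step t nn0 f0 psi0 alpha0 dl (hybrid X xi A (Num.sqrt m) k z) hZ hZ') e1 e2).
Qed.

(** After [mixed_next] and [mixed_split] both values come from the same hybrid, with [k] vectors of
    X and Gaussian variance factor n - k - 1, to which one vector is added; only that vector
    differs. *)
Let J_step k : (k < n)%N -> (J k.+1 <= J k + (2 * E)%:E /\ J k <= J k.+1 + (2 * E)%:E)%E.
Proof.
move=> kn; rewrite /J.
have nkE : (n - k)%:R = (n - k.+1)%:R + 1 :> R by rewrite natr1 -subSn// subSS.
rewrite nkE (mixed_next hX hxi A measurable_smooth_ind smooth_ind_ge0).
rewrite (mixed_split P X hxi A measurable_smooth_ind smooth_ind_ge0)//.
have km : k%:R + (n - k.+1)%:R <= n%:R :> R.
  by rewrite -natrD ler_nat -[leqRHS](subnKC (ltnW kn)) leq_add2l leq_sub2l.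
by split; apply: step => //; [exact: EX|exact: EY|exact: EY|exact: EX].
Qed.

Let J_tele k : (k <= n)%N ->
  (J k <= J 0%N + (k%:R * (2 * E))%:E /\ J 0%N <= J k + (k%:R * (2 * E))%:E)%E.
Proof.
elim: k => [_|k IH kn]; first by rewrite mul0r adde0.
have [h1 h2] := IH (ltnW kn); have [s1 s2] := J_step kn.
have aux (x y z : \bar R) (a b : R) : (x <= y + b%:E -> y <= z + a%:E -> x <= z + (a + b)%:E)%E.
  by move=> xy yz; apply: (le_trans xy); rewrite EFinD addeA leeD2r.
have -> : k.+1%:R * (2 * E) = k%:R * (2 * E) + 2 * E by rewrite -natr1; ring.
split; first exact: aux s1 h1.
by rewrite [_ + 2 * E]addrC; exact: aux h2 s2.
Qed.

Lemma lindeberg_exchange :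
  (\int[P]_w (h (partial_sum X n w))%:E <=
    \int[Q]_w' (h (fun a => Num.sqrt n%:R * Y w' a)%R)%:E + (n%:R * (2 * E))%:E /\
   \int[Q]_w' (h (fun a => Num.sqrt n%:R * Y w' a)%R)%:E <=
    \int[P]_w (h (partial_sum X n w))%:E + (n%:R * (2 * E))%:E)%E.
Proof.
have := J_tele (leqnn n).
have -> : J n = (\int[P]_w (h (partial_sum X n w))%:E)%E.
  rewrite /J subnn sqrtr0; apply: eq_integral => w _.
  rewrite -[RHS](prob_integral_cst Q); apply: eq_integral => w' _; congr ((h _)%:E).
  by apply/funext => a; rewrite /hybrid /addv/= mul0r addr0.
have -> // : J 0%N = (\int[Q]_w' (h (fun a => Num.sqrt n%:R * Y w' a)%R)%:E)%E.
rewrite /J subn0 -[RHS](prob_integral_cst P); apply: eq_integral => w _.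
apply: eq_integral => w' _; congr ((h _)%:E).
by apply/funext => a; rewrite /hybrid /addv/= /partial_sum/= big_nil add0r.
Qed.

End telescoping.

Section bounded_combination.
Context {R : realType} d (T : measurableType d) (P : probability T R).

Lemma integral_comb_le (F1 F2 F3 F4 : T -> R) (c1 c2 c3 c4 c5 r1 r2 r3 r4 : R) :
  measurable_fun setT F1 -> measurable_fun setT F2 -> measurable_fun setT F3 ->
  measurable_fun setT F4 ->
  (forall w, 0 <= F1 w) -> (forall w, 0 <= F2 w) -> (forall w, 0 <= F3 w) ->
  (forall w, 0 <= F4 w) -> 0 <= c1 -> 0 <= c2 -> 0 <= c3 -> 0 <= c4 -> 0 <= c5 ->
  (\int[P]_w (F1 w)%:E <= r1%:E)%E -> (\int[P]_w (F2 w)%:E <= r2%:E)%E ->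
  (\int[P]_w (F3 w)%:E <= r3%:E)%E -> (\int[P]_w (F4 w)%:E <= r4%:E)%E ->
  (\int[P]_w (c1 * F1 w + (c2 * F2 w + (c3 * F3 w + (c4 * F4 w + c5))))%:E <=
   (c1 * r1 + (c2 * r2 + (c3 * r3 + (c4 * r4 + c5))))%:E)%E.
Proof.
move=> m1 m2 m3 m4 p1 p2 p3 p4 q1 q2 q3 q4 q5 h1 h2 h3 h4.
have H (F : T -> R) c r (F' : T -> R) r' : measurable_fun setT F -> measurable_fun setT F' ->
    (forall w, 0 <= F w) -> (forall w, 0 <= F' w) -> 0 <= c ->
    (\int[P]_w (F w)%:E <= r%:E -> \int[P]_w (F' w)%:E <= r'%:E ->
     \int[P]_w (c * F w + F' w)%:E <= (c * r + r')%:E)%E.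
  move=> mF mF' F0 F'0 c0 e e'.
  rewrite integral_addr; [|by mfun|by []|by move=> w; rewrite mulr_ge0|by []].
  by rewrite integral_scaler// EFinD EFinM leeD// lee_wpmul2l.
have z4 w : 0 <= c4 * F4 w + c5 by rewrite addr_ge0 ?mulr_ge0.
have z3 w : 0 <= c3 * F3 w + (c4 * F4 w + c5) by rewrite addr_ge0 ?mulr_ge0.
have z2 w : 0 <= c2 * F2 w + (c3 * F3 w + (c4 * F4 w + c5)) by rewrite addr_ge0 ?mulr_ge0.
have i5 : (\int[P]_w (cst c5 w)%:E <= c5%:E)%E by rewrite (prob_integral_cst P c5%:E).
have i4 := H F4 c4 r4 (cst c5) c5 m4 (measurable_cst _) p4 (fun=> q5) q4 h4 i5.
have n4 : measurable_fun setT (fun w => c4 * F4 w + c5) by mfun.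
have i3 := H F3 c3 r3 _ _ m3 n4 p3 z4 q3 h3 i4.
have n3 : measurable_fun setT (fun w => c3 * F3 w + (c4 * F4 w + c5)) by mfun.
have i2 := H F2 c2 r2 _ _ m2 n3 p2 z3 q2 h2 i3.
have n2 : measurable_fun setT (fun w => c2 * F2 w + (c3 * F3 w + (c4 * F4 w + c5))) by mfun.
exact: H F1 c1 r1 _ _ m1 n2 p1 z2 q1 h1 i2.
Qed.

End bounded_combination.

Lemma powR_invr {R : realType} (x r : R) : 0 < x -> x^-1 `^ r = (x `^ r)^-1.
Proof. by move=> x0; rewrite -(powR_inv1 (ltW x0)) -powRrM mulN1r powRN. Qed.

Section total_error.
Context {R : realType} d (T : measurableType d) (P : probability T R) (p : nat).
Variable X : nat -> T -> 'I_p -> R.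
Hypothesis hX : iid_vec P X.
Context d' (T' : measurableType d') (Q : probability T' R) (xi : 'I_p -> T' -> R).
Hypothesis hxi : iid_std_normal Q xi.
Variables (A S : 'M[R]_p).
Hypothesis AA : A *m A^T = S.
Hypothesis hX0 : matched P (X 0%N) S.
Variables (n : nat) (f psi delta alpha mq : R).
Hypotheses (n0 : (0 < n)%N) (f0 : 0 < f) (psi0 : 0 < psi) (alpha0 : 0 < alpha).
Hypothesis dl : 0 < delta <= 1.
Hypothesis mqE : (\int[@normal_prob R 0 1]_x (`|x| `^ (2 + delta))%:E <= mq%:E)%E.
Hypothesis trS2 : \tr (S *m S^T) = f ^+ 2.

Let N : R := n%:R.
Let e := N `^ (delta / 2).
Let pq := psi `^ (2 + delta).
Let phi := f `^ (2 + delta).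
Let N0 : 0 < N. Proof. by rewrite ltr0n. Qed.
Let e0 : 0 < e. Proof. exact: powR_gt0. Qed.
Let pq0 : 0 < pq. Proof. exact: powR_gt0. Qed.
Let phi0 : 0 < phi. Proof. exact: powR_gt0. Qed.
Let mq0 : 0 <= mq.
Proof. by rewrite -lee_fin; apply: le_trans mqE; apply: integral_ge0 => *; rewrite lee_fin powR_ge0. Qed.

(** [n] times the error attached to one exchanged vector, in terms of its normalised moments: [mu]
    for the quadratic form, [nu2] and [nuq] for the centred squared norm, [gam] for the inner
    product with an independent X. The constant 12288 is 192 * 8 * 8. *)
Definition total_error (mu nu2 nuq gam : R) : R :=
  4 * psi ^+ 2 * alpha + 12288 * (8 + mq) * pq * (mu + 1) / e +
  psi ^+ 2 / 2 * (alpha^-1 + 1) * nu2 / N + 24 * pq * nuq / (N * e ^+ 2) +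
  12288 * pq * gam / e ^+ 2.

Let Nr : N `^ (1 + delta / 2) = N * e.
Proof. by rewrite powRD ?powRr1 ?(ltW N0)//; apply/implyP => _; rewrite gt_eqF. Qed.

Let Nq : N `^ (2 + delta) = N ^+ 2 * e ^+ 2.
Proof.
rewrite (_ : 2 + delta = (1 + delta / 2) + (1 + delta / 2)); last by field.
by rewrite powRD ?Nr; [ring|apply/implyP => _; rewrite gt_eqF].
Qed.

Let cq_le : (2 / (N * f)) `^ (2 + delta) <= 8 / (N ^+ 2 * e ^+ 2 * phi).
Proof.
have /andP[d0 d1] := dl.
have Nf : 0 < N * f by rewrite mulr_gt0.
rewrite powRM ?invr_ge0 ?(ltW Nf)// powR_invr// powRM ?(ltW N0) ?(ltW f0)// Nq -/phi.
have D0 : 0 < N ^+ 2 * e ^+ 2 * phi by rewrite !mulr_gt0.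
rewrite ler_pM2r ?invr_gt0//.
apply: (@le_trans _ _ (2 `^ 3%:R)); first by apply: ler_powR; lra.
by rewrite powR_mulrn//; lra.
Qed.

Section one_vector.
Context dW (T1 : measurableType dW) (W : probability T1 R) (Z : T1 -> 'I_p -> R).
Hypothesis hZ : matched W Z S.
Variables (mu nu2 nuq gam : R).
Local Open Scope ereal_scope.
Hypothesis hmu : \int[W]_w (quadf S (Z w) `^ (1 + delta / 2))%:E <= (mu * phi)%:E.
Hypothesis hnu2 : \int[W]_w (((sumsq (Z w) - \tr S) / f)%R ^+ 2)%:E <= nu2%:E.
Hypothesis hnuq :
  \int[W]_w (`|(sumsq (Z w) - \tr S) / f|%R `^ (2 + delta))%:E <= nuq%:E.
Hypothesis hgam :
  \int[W]_w \int[P]_w' (`|dotv (X 0%N w') (Z w) / f|%R `^ (2 + delta))%:E <= gam%:E.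

Let mZ a : measurable_fun setT (fun w => Z w a). Proof. by case: hZ. Qed.
Let mX a : measurable_fun setT (fun w => X 0%N w a). Proof. by case: hX. Qed.

Let D w : R := ((sumsq (Z w) - \tr S) / f)%R.
Let c4 : R := (12288 * (8 + mq) * pq / (N * e * phi))%R.
Let c6 : R := (12288 * pq / (N * e ^+ 2 * phi))%R.

Let G z := \int[P]_w (`|dotv (X 0%N w) z| `^ (2 + delta))%:E.

Let Gn z := \int[P]_w (`|dotv (X 0%N w) z / f|%R `^ (2 + delta))%:E.

Let GE z : G z = phi%:E * Gn z.
Proof.
rewrite /Gn -integral_scaler.
- apply: eq_integral => w _; congr (_%:E).
  rewrite -powRM ?(ltW f0)//; congr (_ `^ _)%R.
  by rewrite normrM normfV (gtr0_norm f0) mulrC divfK ?gt_eqF.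
- have := mX; rewrite /dotv => ?; mfun.
- by move=> w; exact: powR_ge0.
- exact: ltW.
Qed.

Let mGn : measurable_fun setT (fun w => Gn (Z w)).
Proof.
apply: (@measurable_integral_snd _ _ _ _ _ P
  (fun z : T1 * T => (`|dotv (X 0%N z.2) (Z z.1) / f| `^ (2 + delta))%:E)); last first.
  by move=> z; rewrite lee_fin powR_ge0.
have ma a : measurable_fun setT (fun z : T1 * T => X 0%N z.2 a).
  exact: (measurableT_comp (mX a) measurable_snd).
have mb a : measurable_fun setT (fun z : T1 * T => Z z.1 a).
  exact: (measurableT_comp (mZ a) measurable_fst).
rewrite /dotv; mfun.
Qed.

Let mG : measurable_fun setT (fun w => G (Z w)).
Proof.
rewrite (_ : (fun w => G (Z w)) = fun w => phi%:E * Gn (Z w)); last first.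
  by apply/funext => w; rewrite GE.
exact: measurable_funeM.
Qed.

Let quadf0 z : (0 <= quadf S z)%R. Proof. exact: (quadf_factor_ge0 AA). Qed.

Let bound_le w : (exchange_bound S N f psi delta alpha mq (Z w) <=
  (4 * psi ^+ 2 * alpha / (N * f ^+ 2)) * quadf S (Z w) +
  (c4 * quadf S (Z w) `^ (1 + delta / 2) +
  ((psi ^+ 2 / 2 * (alpha^-1 + 1) / N ^+ 2) * D w ^+ 2 +
  ((24 * pq / (N ^+ 2 * e ^+ 2)) * `|D w| `^ (2 + delta) + c4 * phi))))%R.
Proof.
have /andP[d0 d1] := dl.
rewrite /exchange_bound /taylor_remainder.
have -> : ((N * f)^-1 * (sumsq (Z w) - \tr S) = N^-1 * D w)%R.
  by rewrite /D invfM -mulrA (mulrC f^-1)%R.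
rewrite normr0 powR0; last by rewrite gt_eqF//; lra.
rewrite normrM (@powRM _ `|N^-1|%R `|D w|%R)//.
have -> : (`|N^-1|%R `^ (2 + delta) = (N ^+ 2 * e ^+ 2)^-1)%R.
  by rewrite gtr0_norm ?invr_gt0// powR_invr// Nq.
set x := quadf S (Z w); have x0 : (0 <= x)%R by exact: quadf0.
have f20 : (0 < f ^+ 2)%R by exact: exprn_gt0.
have fr : ((f ^+ 2) `^ (1 + delta / 2) = phi)%R.
  rewrite (_ : 1 + delta / 2 = (2 + delta) / 2)%R; last by field.
  by rewrite powR_sqr_half// ltW.
have xf : ((N * (x + f ^+ 2)) `^ (1 + delta / 2) <=
   N * e * (8 * (x `^ (1 + delta / 2) + phi)))%R.
  rewrite powRM ?(ltW N0) ?addr_ge0 ?(ltW f20)// Nr.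
  apply: ler_wpM2l; first by nneg.
  have := @powR_normD_le R x (f ^+ 2) (1 + delta / 2) ltac:(apply/andP; split; lra).
  rewrite (ger0_norm x0) (ger0_norm (ltW f20)) (ger0_norm (addr_ge0 x0 (ltW f20))) fr.
  exact.
have cq := cq_le.
set c := ((2 / (N * f)) `^ _)%R in cq *; set y := (x `^ _)%R in xf *.
have K30 : (0 <= 192 * pq * (8 + mq))%R.
  by nneg.
have y0 : (0 <= y)%R by exact: powR_ge0.
have cq0 : (0 <= c)%R by exact: powR_ge0.
set u := ((N * (x + f ^+ 2)) `^ _)%R in xf *.
have u0 : (0 <= u)%R by exact: powR_ge0.
have H1 : (192 * pq * c * (8 + mq) * u <= c4 * (y + phi))%R.
  have h : (c * u <= (8 / (N ^+ 2 * e ^+ 2 * phi)) * (N * e * (8 * (y + phi))))%R.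
    exact: ler_pM.
  have h' := ler_wpM2l K30 h.
  apply: (@le_trans _ _ (192 * pq * (8 + mq) * (c * u))%R); first by rewrite le_eqVlt; apply/orP; left; apply/eqP; ring.
  apply: (le_trans h'); rewrite le_eqVlt; apply/orP; left; apply/eqP.
  by rewrite /c4; field; rewrite !gt_eqF.
have H2 : (psi ^+ 2 * alpha * (2 / (N * f)) ^+ 2 * (N * x) =
   4 * psi ^+ 2 * alpha / (N * f ^+ 2) * x)%R by field; rewrite !gt_eqF.
have H3 : (psi ^+ 2 / 2 * (alpha * 0 ^+ 2 + (alpha^-1 + 1) * (N^-1 * D w) ^+ 2) =
   psi ^+ 2 / 2 * (alpha^-1 + 1) / N ^+ 2 * D w ^+ 2)%R by field; rewrite !gt_eqF.
rewrite H2 H3 -/pq.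
have := H1; rewrite mulrDr => {}H1.
lra.
Qed.

Lemma exchange_error_integral k m : (0 <= m)%R -> (k%:R + m <= N)%R ->
  \int[P]_w \int[Q]_w' \int[W]_w1 (exchange_error S N f psi delta alpha
      (hybrid X xi A (Num.sqrt m) k (w, w')) (Z w1))%:E <=
  (N^-1 * total_error mu nu2 nuq gam)%:E.
Proof.
move=> m0 km; have /andP[d0 d1] := dl.
rewrite (@tonelli3 _ _ _ _ _ _ _ P Q W (fun w w' w1 =>
  (exchange_error S N f psi delta alpha (hybrid X xi A (Num.sqrt m) k (w, w')) (Z w1))%:E)).
- have G0 z : 0 <= G z by apply: integral_ge0 => *; rewrite lee_fin powR_ge0.
  have c60 : (0 <= c6)%R by rewrite /c6; nneg.
  have c40 : (0 <= c4)%R.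
    by rewrite /c4; nneg.
  have mq_ : measurable_fun setT (fun w => quadf S (Z w)) by rewrite /quadf; mfun.
  have mD : measurable_fun setT D by rewrite /D /sumsq; mfun.
  pose B w : R := (4 * psi ^+ 2 * alpha / (N * f ^+ 2) * quadf S (Z w) +
    (c4 * quadf S (Z w) `^ (1 + delta / 2) +
    ((psi ^+ 2 / 2 * (alpha^-1 + 1) / N ^+ 2) * D w ^+ 2 +
    ((24 * pq / (N ^+ 2 * e ^+ 2)) * `|D w| `^ (2 + delta) + c4 * phi))))%R.
  have k1 : (0 <= 4 * psi ^+ 2 * alpha / (N * f ^+ 2))%R.
    by nneg.
  have k2 : (0 <= psi ^+ 2 / 2 * (alpha^-1 + 1) / N ^+ 2)%R.
    by nneg.
  have k3 : (0 <= 24 * pq / (N ^+ 2 * e ^+ 2))%R.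
    by nneg.
  have k4 : (0 <= c4 * phi)%R by nneg.
  have B0 w : (0 <= B w)%R.
    have := quadf0 (Z w) => ?; rewrite /B; nneg.
  have mB : measurable_fun setT B by rewrite /B; mfun.
  apply: (@le_trans _ _ (\int[W]_w1 ((B w1)%:E + c6%:E * G (Z w1)))).
    apply: ge0_integral_mono => w1.
      by apply: integral_ge0 => *; apply: integral_ge0 => *; rewrite lee_fin taylor_remainder_ge0.
    apply: le_trans (exchange_error_le hX hxi AA hX0 N0 f0 psi0 alpha0 dl mqE (Z w1) m0 km) _.
    apply: leeD; first by rewrite lee_fin; exact: bound_le.
    apply: lee_wpmul2r; first exact: G0.
    rewrite lee_fin -/pq.
    have h := ler_wpM2l (ltac:(by nneg) : (0 <= 8 * N * (192 * pq))%R) cq_le.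
    rewrite mulrA; apply: (le_trans h); rewrite le_eqVlt; apply/orP; left; apply/eqP.
    by rewrite /c6; field; rewrite !gt_eqF.
  rewrite ge0_integralD//; [|by move=> *; rewrite lee_fin|exact/measurable_EFinP|
    by move=> *; rewrite mule_ge0|exact: measurable_funeM].
  have -> : \int[W]_w1 (c6%:E * G (Z w1)) = c6%:E * \int[W]_w1 G (Z w1).
    by apply: ge0_integralZl_EFin.
  have hG : \int[W]_w G (Z w) <= (phi * gam)%:E.
    under eq_integral do rewrite GE.
    have Gn0 z : 0 <= Gn z by apply: integral_ge0 => *; rewrite lee_fin powR_ge0.
    have -> : \int[W]_w (phi%:E * Gn (Z w)) = phi%:E * \int[W]_w Gn (Z w).
      by apply: ge0_integralZl_EFin; [exact: measurableT|move=> *; exact: Gn0|exact: mGn|exact: ltW].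
    by rewrite EFinM lee_wpmul2l// lee_fin ltW.
  have hq : \int[W]_w (quadf S (Z w))%:E <= (f ^+ 2)%:E by rewrite (matched_quadf_mean hZ) trS2.
  have hB := @integral_comb_le _ _ _ W _ _ _ _ _ _ _ _ (c4 * phi)%R _ _ _ _
    mq_ (ltac:(by mfun) : measurable_fun setT (fun w => quadf S (Z w) `^ (1 + delta / 2))%R)
    (ltac:(by mfun) : measurable_fun setT (fun w => D w ^+ 2)%R)
    (ltac:(by mfun) : measurable_fun setT (fun w => `|D w| `^ (2 + delta))%R)
    (fun w => quadf0 (Z w)) (fun w => powR_ge0 _ _) (fun w => sqr_ge0 _) (fun w => powR_ge0 _ _)
    k1 c40 k2 k3 k4 hq hmu hnu2 hnuq.
  apply: le_trans (leeD hB (lee_wpmul2l _ hG)) _; first by rewrite lee_fin.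
  rewrite -EFinM -EFinD lee_fin le_eqVlt; apply/orP; left; apply/eqP.
  by rewrite /total_error /c4 /c6; field; rewrite !gt_eqF.
- have := measurable_error_hybrid hX hxi A n f psi delta alpha hZ (Num.sqrt m) k.
  by congr (measurable_fun _ _); apply/funext => -[[w w'] w1].
- by move=> *; rewrite lee_fin taylor_remainder_ge0.
Qed.

End one_vector.
End total_error.

(** The tangent bound [powR_le_affine], with exponent 1/r at (F/m)^r, is integrated. Stated in the
    extended reals, it leaves the right side free to be infinite. *)
Lemma jensen_powR {R : realType} d (T : measurableType d) (P : probability T R)
    (F : T -> R) (m r : R) : measurable_fun setT F -> (forall w, 0 <= F w) -> 1 <= r ->
  (\int[P]_w (F w)%:E = m%:E -> (m `^ r)%:E <= \int[P]_w (F w `^ r)%:E)%E.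
Proof.
move=> mF F0 r1 Fm.
have m0 : 0 <= m by rewrite -lee_fin -Fm; apply: integral_ge0 => w _; rewrite lee_fin.
have r0 : 0 < r by lra.
have I0 : (0 <= \int[P]_w (F w `^ r)%:E)%E by apply: integral_ge0 => w _; rewrite lee_fin powR_ge0.
move: m0; rewrite le_eqVlt => /predU1P[<-|m0]; first by rewrite powR0 ?gt_eqF.
have pm0 : 0 < m `^ r by exact: powR_gt0.
have ri : 0 < r^-1 <= 1 by rewrite invr_gt0 r0/= invf_le1.
have /andP[ri0 ri1] := ri.
have pt w : F w <= m * (1 - r^-1) + m / r / m `^ r * F w `^ r.
  have := @powR_le_affine R r^-1 ((F w / m) `^ r) ri (powR_ge0 _ _).
  rewrite -powRrM mulfV ?gt_eqF// powRr1 ?divr_ge0 ?(ltW m0)//.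
  rewrite powRM ?invr_ge0 ?(ltW m0)// powR_invr//.
  rewrite ler_pdivrMr// => /le_trans; apply; rewrite le_eqVlt; apply/orP; left; apply/eqP.
  by field; rewrite !gt_eqF.
have mr : measurable_fun setT (fun w => F w `^ r) by mfun.
have c0 : 0 <= m / r / m `^ r by rewrite !divr_ge0 ?(ltW m0) ?(ltW r0) ?(ltW pm0).
have k0 : 0 <= m * (1 - r^-1) by rewrite mulr_ge0 ?(ltW m0)// subr_ge0.
have : (\int[P]_w (F w)%:E <= (m * (1 - r^-1))%:E + (m / r / m `^ r)%:E * \int[P]_w (F w `^ r)%:E)%E.
  rewrite -integral_scaler//; last by move=> w; exact: powR_ge0.
  rewrite -[X in (X + _)%E](prob_integral_cst P) -integral_addr//.
  - by apply: ge0_integral_mono => w; rewrite lee_fin.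
  - by mfun.
  - by move=> w; rewrite mulr_ge0 ?powR_ge0.
rewrite Fm; move: I0; case: (\int[P]_w (F w `^ r)%:E)%E => [I| |] //; last by move=> *; rewrite leey.
rewrite -EFinM -EFinD !lee_fin => I0 H.
have h : m / r <= m / r / m `^ r * I by lra.
have mr0 : 0 < m / r by rewrite divr_gt0.
have : m / r * (m `^ r) <= m / r / m `^ r * I * m `^ r by rewrite ler_pM2r.
rewrite (_ : m / r / m `^ r * I * m `^ r = m / r * I); first by rewrite ler_pM2l.
by field; rewrite !gt_eqF.
Qed.

(** One constant for all Gaussian moments, fixed before the model: each integrand is at most 8 (1 +
    x^8), and the 1 added to the witness ensures H >= 1. *)
Lemma gaussian_moments {R : realType} (delta : R) : 0 < delta <= 1 ->
  exists2 H : R, 1 <= H &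
  [/\ (\int[@normal_prob R 0 1]_x (`|x| `^ (2 + delta))%:E <= H%:E)%E,
      (\int[@normal_prob R 0 1]_x (`|x ^+ 2 - 1| `^ (2 + delta))%:E <= H%:E)%E,
      (\int[@normal_prob R 0 1]_x ((x ^+ 2 - 1) ^+ 2)%:E <= H%:E)%E &
      (\int[@normal_prob R 0 1]_x (x ^+ 4)%:E <= H%:E)%E].
Proof.
move=> /andP[d0 d1].
have [M M0 HM] := @gaussian_moment8 R.
have cube (t : R) : 0 <= t -> (1 + t) ^+ 3 <= 8 * (1 + t ^+ 4).
  move=> t0; have [t1|t1] := leP t 1.
    have h : (1 + t) ^+ 3 <= 2 ^+ 3 by rewrite lerXn2r ?nnegrE; lra.
    have : 0 <= t ^+ 4 by rewrite exprn_ge0.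
    lra.
  have h : (1 + t) ^+ 3 <= (2 * t) ^+ 3 by rewrite lerXn2r ?nnegrE; lra.
  have h2 : t ^+ 3 <= t ^+ 4 by rewrite ler_weXn2l// ltW.
  have : (2 * t) ^+ 3 = 8 * t ^+ 3 by ring.
  lra.
have x8 (x : R) : (x ^+ 2) ^+ 4 = x ^+ 8 by rewrite -exprM.
have pw (x u : R) : `|u| <= 1 + x ^+ 2 -> `|u| `^ (2 + delta) <= 8 * (1 + x ^+ 8).
  move=> ux; have x20 := sqr_ge0 x.
  apply: (@le_trans _ _ ((1 + x ^+ 2) `^ (2 + delta))).
    by apply: ge0_ler_powR; rewrite ?nnegrE//; lra.
  apply: (@le_trans _ _ ((1 + x ^+ 2) `^ 3%:R)); first by apply: ler_powR; lra.
  by rewrite powR_mulrn ?addr_ge0// -x8; exact: cube.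
have sq1 (x : R) : `|x ^+ 2 - 1| <= 1 + x ^+ 2.
  by rewrite ler_norml; have := sqr_ge0 x => ?; apply/andP; split; lra.
have ab1 (x : R) : `|x| <= 1 + x ^+ 2.
  rewrite -[x ^+ 2]real_normK ?num_real//; have := sqr_ge0 (`|x| - 1); have := normr_ge0 x.
  by move=> ? ?; have := sqr_ge0 `|x| => ?; lra.
have q12 (x : R) : 1 <= 1 + x ^+ 2 by rewrite lerDl sqr_ge0.
have two (x u : R) : `|u| <= 1 + x ^+ 2 -> `|u| ^+ 2 <= 8 * (1 + x ^+ 8).
  move=> ux; have x20 := sqr_ge0 x.
  apply: (@le_trans _ _ ((1 + x ^+ 2) ^+ 2)); first by rewrite lerXn2r ?nnegrE ?addr_ge0.
  apply: (@le_trans _ _ ((1 + x ^+ 2) ^+ 3)); first by rewrite ler_weXn2l.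
  by rewrite -x8; exact: cube.
have up (f : R -> R) : measurable_fun setT f -> (forall x, 0 <= f x <= 8 * (1 + x ^+ 8)) ->
    (\int[@normal_prob R 0 1]_x (f x)%:E <= (8 * M + 1)%:E)%E.
  move=> mf fle; apply: (le_trans (gaussian_le_moment8 mf _ HM fle)) => //.
  by rewrite lee_fin lerDl.
exists (8 * M + 1); first by rewrite lerDr mulr_ge0.
split; apply: up; try by mfun.
- by move=> x; rewrite powR_ge0/= pw.
- by move=> x; rewrite powR_ge0/= pw.
- by move=> x; rewrite sqr_ge0/= -[leLHS]real_normK ?num_real// two.
- move=> x; have -> : x ^+ 4 = `|x ^+ 2| ^+ 2 by rewrite real_normK ?num_real// -exprM.
  by rewrite sqr_ge0/= two// ger0_norm ?sqr_ge0// lerDr.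
Qed.

(** * Moments of the Gaussian comparison vector *)

Section gaussian_image_moments.
Context {R : realType} d (T : measurableType d) (Q : probability T R) (p : nat).
Variable xi : 'I_p -> T -> R.
Hypothesis hxi : iid_std_normal Q xi.
Variables (A S : 'M[R]_p) (lam : 'I_p -> R) (f delta H : R).
Hypotheses (AA : A *m A^T = S) (AtA : A^T *m A = diag_mx (\row_j lam j)).
Hypotheses (f0 : 0 < f) (lam2 : \sum_j lam j ^+ 2 = f ^+ 2).
Hypothesis dl : 0 < delta <= 1.
Hypothesis H1 : 1 <= H.
Hypothesis HM :
  [/\ (\int[@normal_prob R 0 1]_x (`|x| `^ (2 + delta))%:E <= H%:E)%E,
      (\int[@normal_prob R 0 1]_x (`|x ^+ 2 - 1| `^ (2 + delta))%:E <= H%:E)%E,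
      (\int[@normal_prob R 0 1]_x ((x ^+ 2 - 1) ^+ 2)%:E <= H%:E)%E &
      (\int[@normal_prob R 0 1]_x (x ^+ 4)%:E <= H%:E)%E].

Let Y := gauss_image xi A.
Let a j := lam j / f.

Let a21 : \sum_j a j ^+ 2 = 1.
Proof.
under eq_bigr do rewrite /a exprMn; rewrite -mulr_suml lam2 exprVn mulfV//.
by rewrite expf_neq0// gt_eqF.
Qed.

Let mxi j : measurable_fun setT (xi j). Proof. by case: hxi. Qed.

Lemma sumsq_gauss_image w : sumsq (Y w) = \sum_j lam j * xi j w ^+ 2.
Proof.
rewrite /sumsq /Y /gauss_image /linear_image.
transitivity (\sum_i \sum_j (A^T *m A) i j * (xi i w * xi j w)).
  under eq_bigr do rewrite expr2 mulr_suml.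
  rewrite exchange_big/=; apply: eq_bigr => i _.
  under eq_bigr do rewrite mulr_sumr.
  rewrite exchange_big/=; apply: eq_bigr => j _.
  rewrite mxE mulr_suml; apply: eq_bigr => k _.
  by rewrite mxE /gauss_vec; ring.
apply: eq_bigr => i _; rewrite (bigD1 i)//= big1 => [|j /negbTE ij].
  by rewrite AtA !mxE eqxx mulr1n addr0 expr2.
by rewrite AtA !mxE eq_sym ij mulr0n mul0r.
Qed.

Lemma trace_factor : \tr S = \sum_j lam j.
Proof.
rewrite -AA mxtrace_mulC AtA /mxtrace; apply: eq_bigr => j _.
by rewrite !mxE eqxx mulr1n.
Qed.

Lemma quadf_gauss_image w : quadf S (Y w) = \sum_j lam j ^+ 2 * xi j w ^+ 2.
Proof.
rewrite (quadf_factor AA); apply: eq_bigr => j _; rewrite -exprMn; congr (_ ^+ 2).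
rewrite /Y /gauss_image /linear_image.
transitivity (\sum_i (A^T *m A) j i * xi i w).
  under eq_bigr do rewrite mulr_sumr.
  rewrite exchange_big/=; apply: eq_bigr => i _.
  rewrite mxE mulr_suml; apply: eq_bigr => k _.
  by rewrite mxE /gauss_vec; ring.
rewrite (bigD1 j)//= big1 => [|i /negbTE ij]; first by rewrite AtA !mxE eqxx mulr1n addr0.
by rewrite AtA !mxE eq_sym ij mulr0n mul0r.
Qed.

Lemma normalized_sumsq_gauss_image w :
  (sumsq (Y w) - \tr S) / f = \sum_j lam j / f * (xi j w ^+ 2 - 1).
Proof.
rewrite sumsq_gauss_image trace_factor -sumrB mulr_suml.
by apply: eq_bigr => j _; field; rewrite gt_eqF.
Qed.

Let phi j (x : R) : R := a j * (x ^+ 2 - 1).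
Let mphi j : measurable_fun setT (phi j). Proof. by rewrite /phi; mfun. Qed.

Let phi2 j : (\int[Q]_w (phi j (xi j w) ^+ 2)%:E <= (a j ^+ 2 * H)%:E)%E.
Proof.
rewrite (integral_std_normal hxi j (f := fun x => (phi j x ^+ 2)%:E)); [|by mfun; exact: mphi|by move=> x; rewrite lee_fin sqr_ge0].
under eq_integral do rewrite /phi exprMn.
rewrite integral_scaler; [|by mfun|by move=> x; exact: sqr_ge0|exact: sqr_ge0].
by rewrite [leRHS]EFinM lee_wpmul2l ?lee_fin ?sqr_ge0//; case: HM.
Qed.

Let iphi j : Q.-integrable setT (fun w => (phi j (xi j w))%:E).
Proof.
have i1 : Q.-integrable setT (EFin \o (fun w => 1 + phi j (xi j w) ^+ 2)).
  apply/integrableP; split.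
    by apply/measurable_EFinP; mfun; exact: (measurableT_comp (mphi j) (mxi j)).
  apply: (@le_lt_trans _ _ (\int[Q]_w (1 + phi j (xi j w) ^+ 2)%:E)%E).
    apply: ge0_integral_mono => w //=.
    by rewrite lee_fin ger0_norm ?addr_ge0 ?sqr_ge0.
  have mp : measurable_fun setT (fun w => phi j (xi j w)) by exact: (measurableT_comp (mphi j) (mxi j)).
  rewrite integral_addr; [|by mfun|by mfun|by []|by move=> w; exact: sqr_ge0].
  rewrite (prob_integral_cst Q).
  by apply: le_lt_trans (leeD2l _ (phi2 j)) _; rewrite -EFinD ltry.
apply: (le_integrable _ _ _ i1) => //.
  by apply/measurable_EFinP; exact: (measurableT_comp (mphi j) (mxi j)).
move=> w _; rewrite /= lee_fin [leRHS]ger0_norm ?addr_ge0 ?sqr_ge0//.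
rewrite ler_norml; set u := phi j _; have := sqr_ge0 (u - 1); have := sqr_ge0 (u + 1).
have := sqr_ge0 u.
by move=> *; apply/andP; split; lra.
Qed.

Let phi_mean j : (\int[Q]_w (phi j (xi j w))%:E = 0)%E.
Proof.
have i2 : Q.-integrable setT (fun w => (xi j w ^+ 2)%:E).
  apply/integrableP; split; first by mfun.
  under eq_integral do rewrite gee0_abs ?lee_fin ?sqr_ge0//.
  rewrite (integral_std_normal hxi j (f := fun x => (x ^+ 2)%:E)); [|by mfun|by move=> x; rewrite lee_fin sqr_ge0].
  by rewrite gaussian_moment2 ltry.
have i1 : Q.-integrable setT (EFin \o cst (1 : R)) by exact: finite_measure_integrable_cst.
have i3 := integrableB measurableT i2 i1.
under eq_integral do rewrite /phi EFinM EFinB.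
rewrite integralZl// integralB//.
rewrite (integral_std_normal hxi j (f := fun x => (x ^+ 2)%:E)); [|by mfun|by move=> x; rewrite lee_fin sqr_ge0].
by rewrite gaussian_moment2 (prob_integral_cst Q) subee// mule0.
Qed.

Let indep_xi (s : seq 'I_p) (B : 'I_p -> set (measurableTypeR R)) : uniq s ->
  (forall i, measurable (B i)) ->
  Q (\big[setI/setT]_(i <- s) ((xi i : T -> measurableTypeR R) @^-1` B i)) =
  (\prod_(i <- s) Q ((xi i : T -> measurableTypeR R) @^-1` B i))%E.
Proof. by move=> us mB; case: hxi => _ _; apply. Qed.

Let D w := (sumsq (Y w) - \tr S) / f.

Let DE w : D w = \sum_(j <- index_enum 'I_p) phi j (xi j w).
Proof. exact: normalized_sumsq_gauss_image. Qed.

Lemma gauss_image_centered2 : (\int[Q]_w (((sumsq (Y w) - \tr S) / f) ^+ 2)%:E <= H%:E)%E.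
Proof.
have := @indep_sum_sqr _ _ _ _ _ _ _ _ (mxi : forall i, measurable_fun setT (xi i : T -> measurableTypeR R)) indep_xi phi mphi iphi phi_mean _ phi2 (index_enum 'I_p) (index_enum_uniq _).
rewrite -mulr_suml a21 mul1r => /(le_trans _); apply.
by under eq_integral do rewrite -/(D _) DE.
Qed.

(** Rosenthal for the sum of a_j (xi_j^2 - 1) with variance bound [H]. As the a_j^2 sum to 1, each
    |a_j| is at most 1 and |a_j|^q <= a_j^2, so the sum of the q-th moments is at most [H], whatever
    the spectrum. *)
Lemma gauss_image_centeredq :
  (\int[Q]_w (`|(sumsq (Y w) - \tr S) / f| `^ (2 + delta))%:E <= (8 * H ^+ 2 + 8 * H)%:E)%E.
Proof.
have /andP[d0 d1] := dl.
have H0 : 0 < H by exact: lt_le_trans ltr01 H1.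
have := @indep_sum_powR _ _ _ _ _ _ _ _ (mxi : forall i, measurable_fun setT (xi i : T -> measurableTypeR R)) indep_xi phi mphi iphi phi_mean _ phi2 delta H (index_enum 'I_p) dl H0 (index_enum_uniq _).
rewrite -mulr_suml a21 mul1r => /(_ (lexx _)).
under [X in (X <= _)%E -> _]eq_integral do rewrite -DE.
move=> /le_trans; apply; rewrite [leRHS]EFinD; apply: leeD.
  rewrite lee_fin -mulrA ler_pM2l// expr2 ler_pM2r//.
  apply: (@le_trans _ _ (H `^ 1)); first by apply: ler_powR; [exact: H1|lra].
  by rewrite powRr1// ltW.
rewrite [leRHS]EFinM lee_wpmul2l//.
apply: (@le_trans _ _ (\sum_j (a j ^+ 2 * H)%:E)%E); last by rewrite sumEFin -mulr_suml a21 mul1r.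
apply: lee_sum => j _.
rewrite (integral_std_normal hxi j (f := fun x => (`|phi j x| `^ (2 + delta))%:E)); [|by mfun; exact: mphi|by move=> x; rewrite lee_fin powR_ge0].
have aj1 : `|a j| <= 1.
  rewrite -(@ler_pXn2r _ 2)// ?nnegrE// expr1n real_normK ?num_real// -a21.
  by rewrite (bigD1 j)//= lerDl sumr_ge0// => i _; exact: sqr_ge0.
have ajq : `|a j| `^ (2 + delta) <= a j ^+ 2.
  rewrite powR2D// real_normK ?num_real// ler_piMr ?sqr_ge0//.
  apply: (@le_trans _ _ (1 `^ delta)); last by rewrite powR1.
  by apply: ge0_ler_powR; rewrite ?nnegrE ?(ltW d0).
under eq_integral do rewrite /phi normrM powRM//.
rewrite integral_scaler; [|by mfun|by move=> x; exact: powR_ge0|exact: powR_ge0].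
rewrite [leRHS]EFinM; apply: lee_pmul => //; rewrite ?lee_fin ?powR_ge0//; last by case: HM.
by apply: integral_ge0 => *; rewrite lee_fin powR_ge0.
Qed.

(** The form is f^2 B with B the mean of the xi_j^2 under the weights a_j^2; then B^(1 + delta/2) <=
    1 + B^2, and B^2 is at most the weighted mean of the xi_j^4. *)
Lemma gauss_image_quadf :
  (\int[Q]_w (quadf S (Y w) `^ (1 + delta / 2))%:E <= ((1 + H) * f `^ (2 + delta))%:E)%E.
Proof.
have /andP[d0 d1] := dl.
pose B w := \sum_j a j ^+ 2 * (xi j w ^+ 2).
have B0 w : 0 <= B w by apply: sumr_ge0 => j _; rewrite mulr_ge0 ?sqr_ge0.
have QB w : quadf S (Y w) = f ^+ 2 * B w.
  rewrite quadf_gauss_image /B mulr_sumr; apply: eq_bigr => j _; rewrite /a.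
  by field; rewrite gt_eqF.
have fr : (f ^+ 2) `^ (1 + delta / 2) = f `^ (2 + delta).
  rewrite (_ : 1 + delta / 2 = (2 + delta) / 2); last by field.
  by rewrite powR_sqr_half// ltW.
have pt w : quadf S (Y w) `^ (1 + delta / 2) <=
    f `^ (2 + delta) * (1 + \sum_j a j ^+ 2 * xi j w ^+ 4).
  rewrite QB powRM ?sqr_ge0// fr ler_wpM2l ?powR_ge0//.
  apply: (@le_trans _ _ (1 + B w ^+ 2)).
    have [b1|b1] := leP (B w) 1.
      apply: (@le_trans _ _ 1); last by rewrite lerDl sqr_ge0.
      apply: (@le_trans _ _ (1 `^ (1 + delta / 2))); last by rewrite powR1.
      by apply: ge0_ler_powR; rewrite ?nnegrE//; lra.
    apply: (@le_trans _ _ (B w `^ 2%:R)); first by apply: ler_powR; lra.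
    by rewrite powR_mulrn// lerDr.
  rewrite lerD2l; apply: le_trans (weighted_mean_sqr _ (fun j => sqr_ge0 (a j)) a21) _.
  by apply: ler_sum => j _; rewrite -exprM.
have m4 : measurable_fun setT (fun w => \sum_j a j ^+ 2 * xi j w ^+ 4) by mfun.
have p4 w : 0 <= \sum_j a j ^+ 2 * xi j w ^+ 4.
  by apply: sumr_ge0 => j _; rewrite mulr_ge0 ?sqr_ge0 ?exprn_even_ge0.
apply: (@le_trans _ _ (\int[Q]_w (f `^ (2 + delta) * (1 + \sum_j a j ^+ 2 * xi j w ^+ 4))%:E)%E).
  by apply: ge0_integral_mono => w; rewrite lee_fin ?powR_ge0.
rewrite integral_scaler; [|by mfun|by move=> w; rewrite addr_ge0|exact: powR_ge0].
rewrite integral_addr; [|by mfun|by mfun|by []|by []].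
rewrite (prob_integral_cst Q) mulrC [leRHS]EFinM lee_wpmul2l ?lee_fin ?powR_ge0// [leRHS]EFinD leeD2l//.
under eq_integral do rewrite -sumEFin.
rewrite ge0_integral_sum//; last 2 first.
- by move=> j; mfun.
- by move=> j w _; rewrite lee_fin mulr_ge0 ?sqr_ge0 ?exprn_even_ge0.
apply: (@le_trans _ _ (\sum_j (a j ^+ 2 * H)%:E)%E); last by rewrite sumEFin -mulr_suml a21 mul1r.
apply: lee_sum => j _.
rewrite (integral_std_normal hxi j (f := fun x => (a j ^+ 2 * x ^+ 4)%:E)); [|by mfun|by move=> x; rewrite lee_fin mulr_ge0 ?sqr_ge0 ?exprn_even_ge0].
rewrite integral_scaler; [|by mfun|by move=> x; rewrite exprn_even_ge0|exact: sqr_ge0].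
by rewrite [leRHS]EFinM lee_wpmul2l ?lee_fin ?sqr_ge0//; case: HM.
Qed.

End gaussian_image_moments.

(** * From smoothed to Kolmogorov distance *)

Section smoothing.
Context {R : realType} d (T : measurableType d) (P : probability T R).
Local Open Scope ereal_scope.

Lemma prob_le_integral (A : set T) (g : T -> R) : measurable A ->
  (forall w, 0 <= g w)%R -> (forall w, A w -> 1 <= g w)%R -> P A <= \int[P]_w (g w)%:E.
Proof.
move=> mA g0 g1; rewrite -[X in P X](setIT A) -integral_indic//.
apply: ge0_integral_mono => w; rewrite lee_fin ?indicE ?ler0n//.
by case: (boolP (w \in A)) => [|_]; [rewrite inE => /g1|exact: g0].
Qed.

Lemma integral_le_prob (A : set T) (g : T -> R) : measurable A ->
  (forall w, 0 <= g w <= 1)%R -> (forall w, ~ A w -> g w = 0)%R -> \int[P]_w (g w)%:E <= P A.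
Proof.
move=> mA g01 g0; rewrite -[X in P X](setIT A) -integral_indic//.
apply: ge0_integral_mono => w; rewrite lee_fin; have /andP[h0 h1] := g01 w => //.
rewrite indicE; case: (boolP (w \in A)) => // /negP wA.
by rewrite g0// => Aw; apply: wA; rewrite inE.
Qed.

End smoothing.

Lemma measurable_le_set {R : realType} d (T : measurableType d) (V : T -> R) t :
  measurable_fun setT V -> measurable [set w | V w <= t].
Proof.
move=> mV; rewrite (_ : [set w | _] = setT `&` V @^-1` `]-oo, t]); first exact: mV.
by apply/seteqP; split => w /=; rewrite in_itv/= => // -[].
Qed.

(** [cutoff] is 1 up to 0 and vanishes from 3 on, so the smoothed indicator at level t lies between
    the indicators at t and at t + 3 / psi. One inequality uses the level t, the other t - 3 / psi;
    in both the shift is paid by the law of [U], whose windows are controlled by [a]. *)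
Lemma kolmogorov_smoothing {R : realType} d (T : measurableType d) (P : probability T R)
    d' (T' : measurableType d') (Q : probability T' R) (V : T -> R) (U : T' -> R)
    (psi a b : R) :
  measurable_fun setT V -> measurable_fun setT U -> 0 < psi ->
  (forall t, \int[P]_w (cutoff (psi * (V w - t)))%:E <=
     \int[Q]_w (cutoff (psi * (U w - t)))%:E + b%:E)%E ->
  (forall t, \int[Q]_w (cutoff (psi * (U w - t)))%:E <=
     \int[P]_w (cutoff (psi * (V w - t)))%:E + b%:E)%E ->
  (forall t, Q [set w | (`|U w - t| <= 3 / psi)%R] <= a%:E)%E ->
  forall t, `|fine (P [set w | V w <= t]) - fine (Q [set w | U w <= t])| <= a + b.
Proof.
move=> mV mU psi0 hPQ hQP hQ t.
have mVt s := measurable_le_set s mV; have mUt s := measurable_le_set s mU.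
have mD s : measurable [set w | `|U w - s| <= 3 / psi].
  apply: measurable_le_set; apply: (measurableT_comp (@normr_measurable _ setT)).
  exact: measurable_funB.
have P3 : 0 < 3 / psi by rewrite divr_gt0.
have c01 (x : R) : 0 <= cutoff x <= 1 by have [] := @cutoff_bounds R x.
have c0 (x : R) : 0 <= cutoff x by have /andP[] := c01 x.
have low d1 (T1 : measurableType d1) (W : probability T1 R) (Z : T1 -> R) s :
    measurable_fun setT Z ->
    (W [set w | (Z w <= s)%R] <= \int[W]_w (cutoff (psi * (Z w - s)))%:E)%E.
  move=> mZ; apply: prob_le_integral => [|w|w /= Zs]; [exact: measurable_le_set|exact: c0|].
  by rewrite cutoff_eq1// pmulr_rle0// subr_le0.
have up d1 (T1 : measurableType d1) (W : probability T1 R) (Z : T1 -> R) s :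
    measurable_fun setT Z ->
    (\int[W]_w (cutoff (psi * (Z w - s)))%:E <= W [set w | (Z w <= s + 3 / psi)%R])%E.
  move=> mZ; apply: integral_le_prob => [|w|w /= /negP]; [exact: measurable_le_set|exact: c01|].
  rewrite -ltNge => Zs; rewrite cutoff_eq0// mulrC -ler_pdivrMr//.
  by move: (ltW Zs); rewrite addrC -lerBrDr.
have win s : (Q [set w | (U w <= s + 3 / psi)%R] <= Q [set w | (U w <= s)%R] + a%:E)%E.
  apply: (@le_trans _ _ (Q ([set w | (U w <= s)%R] `|` [set w | (`|U w - s| <= 3 / psi)%R]))).
    apply: le_measure; rewrite ?inE//; first exact: measurableU.
    move=> w /= us; have [h|h] := leP (U w) s; [by left|right].
    by rewrite /= ger0_norm; lra.
  apply: le_trans (measureU2 _ (mUt s) (mD s)) _.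
  exact: leeD2l (hQ s).
have toR d1 (T1 : measurableType d1) (W : probability T1 R) (B : set T1) :
    measurable B -> W B = (fine (W B))%:E.
  by move=> mB; rewrite fineK// fin_num_measure.
have h1 : (P [set w | (V w <= t)%R] <= Q [set w | (U w <= t)%R] + a%:E + b%:E)%E.
  apply: le_trans (low _ _ P V t mV) _; apply: le_trans (hPQ t) _.
  by rewrite leeD2r//; apply: le_trans (up _ _ Q U t mU) (win t).
have h2 : (Q [set w | (U w <= t)%R] <= P [set w | (V w <= t)%R] + b%:E + a%:E)%E.
  have := win (t - 3 / psi); rewrite subrK => /le_trans; apply; rewrite leeD2r//.
  apply: le_trans (low _ _ Q U _ mU) _; apply: le_trans (hQP _) _; rewrite leeD2r//.
  by have := up _ _ P V (t - 3 / psi) mV; rewrite subrK.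
rewrite (toR _ _ P)// (toR _ _ Q)// -!EFinD !lee_fin in h1 h2.
by rewrite ler_norml; apply/andP; split; lra.
Qed.

Lemma fine_root_powR {R : realType} (I : \bar R) (q : R) : 0 < q -> (0 <= I)%E ->
  I \is a fin_num -> I = ((fine I `^ q^-1) `^ q)%:E.
Proof.
move=> q0 I0 If; rewrite -powRrM mulVf ?gt_eqF// powRr1 ?fineK//.
exact: fine_ge0.
Qed.

(** * The model: factorisation of Sigma and finiteness of its moments *)

Section model_facts.
Context {R : realType} d (T : measurableType d) (P : probability T R) (p : nat).
Variables (X : nat -> T -> 'I_p -> R) (delta : R) (lam : 'I_p -> R).
Hypothesis dl : 0 < delta <= 1.
Hypothesis hm : model_hyps P X delta lam.

Local Notation S := (Sigma P X).
Local Notation f := (ff P X).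

Let hX : iid_vec P X. Proof. by case: hm. Qed.
Let mX i a : measurable_fun setT (fun w => X i w a). Proof. by case: hX. Qed.

Lemma model_matched : matched P (X 0%N) S.
Proof.
have iX a : P.-integrable setT (fun w => (X 0%N w a ^+ 2)%:E) by case: hm => _ [].
split => //; first by case: hm => _ [_ []].
move=> a b; rewrite mxE /Ex fineK//; apply: integrable_fin_num => //.
exact: integrable_mul_sqr.
Qed.

Let hX0 := model_matched.

Lemma Sigma_sym : S^T = S.
Proof.
apply/matrixP => a b; rewrite !mxE /Ex; congr fine.
by apply: eq_integral => w _; rewrite mulrC.
Qed.

Let trS2E : \tr (S *m S) = \sum_a \sum_b S a b ^+ 2.
Proof.
apply: eq_bigr => a _; rewrite mxE; apply: eq_bigr => b _.
have -> : S b a = S a b by rewrite -[in LHS]Sigma_sym [LHS]mxE.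
by rewrite expr2.
Qed.

Let trS2_gt0 : 0 < \tr (S *m S).
Proof.
have S0 a : 0 <= \sum_b S a b ^+ 2 by apply: sumr_ge0 => b _; exact: sqr_ge0.
rewrite trS2E lt_neqAle sumr_ge0// andbT; apply/eqP => /esym/eqP.
rewrite psumr_eq0// => /allP h; have : S != 0 by case: hm => _ [_ [_ []]].
case/eqP; apply/matrixP => a b; rewrite [RHS]mxE.
have := h a (mem_index_enum a); rewrite psumr_eq0; last by move=> *; exact: sqr_ge0.
by move=> /allP /(_ b (mem_index_enum b)); rewrite sqrf_eq0 => /eqP.
Qed.

Lemma ff_gt0 : 0 < f. Proof. by rewrite sqrtr_gt0. Qed.

Lemma ff_sqr : \tr (S *m S^T) = f ^+ 2.
Proof. by rewrite Sigma_sym sqr_sqrtr// ltW. Qed.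

Lemma model_factorization : exists A : 'M[R]_p,
  [/\ A *m A^T = S, A^T *m A = diag_mx (\row_j lam j) & \sum_j lam j ^+ 2 = f ^+ 2].
Proof.
have [||x|A [AA AtA _]] := @psd_factorization R p S lam.
- exact: Sigma_sym.
- by case: hm => _ [_ [_ [_ []]]].
- have := matched_quadf_ge0 hX0 (fun a => x 0 a); rewrite mxE.
  congr (0 <= _); rewrite /quadf exchange_big/=; apply: eq_bigr => b _.
  by rewrite !mxE mulr_suml.
exists A; split => //; rewrite -ff_sqr Sigma_sym -AA.
rewrite mulmxA mxtrace_mulC !mulmxA AtA -mulmxA AtA /mxtrace.
apply: eq_bigr => j _; rewrite mul_diag_mx !mxE eqxx mulr1n -expr2 //.
Qed.

Local Notation q := (2 + delta).
Let q0 : 0 < q. Proof. by have /andP[] := dl; lra. Qed.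
Let f0 := ff_gt0.

Let Kint_fin : Kint P X q \is a fin_num.
Proof.
rewrite ge0_fin_numE; last by apply: integral_ge0 => *; rewrite lee_fin powR_ge0.
by have [_ [_ [_ [_ [_ [_ [K _]]]]]]] := hm; exact: K.
Qed.

Let Dint_fin : Dint P X q \is a fin_num.
Proof.
rewrite ge0_fin_numE; last by apply: integral_ge0 => *; rewrite lee_fin powR_ge0.
by have [_ [_ [_ [_ [_ [_ [_ D]]]]]]] := hm; exact: D.
Qed.

Lemma Kmom_powR : Kint P X q = (Kmom P X delta `^ q)%:E.
Proof.
by apply: fine_root_powR => //; apply: integral_ge0 => *; rewrite lee_fin powR_ge0.
Qed.

Lemma Dmom_powR : Dint P X q = (Dmom P X delta `^ q)%:E.
Proof.
by apply: fine_root_powR => //; apply: integral_ge0 => *; rewrite lee_fin powR_ge0.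
Qed.

Let mD : measurable_fun setT (fun w => (sumsq (X 0%N w) - f1 P X) / f).
Proof.
have ms := measurable_sumsq hX0.
by mfun.
Qed.

(** [fine] sends +oo to 0, so finiteness has to be proved before [Kmom P X 0] can stand for the
    second moment; it follows from x^2 <= 1 + x^q. *)
Lemma Kmom0_sqr :
  (\int[P]_w (((sumsq (X 0%N w) - \tr S) / f) ^+ 2)%:E = (Kmom P X 0 ^+ 2)%:E)%E.
Proof.
have E2 : (\int[P]_w (((sumsq (X 0%N w) - \tr S) / f) ^+ 2)%:E = Kint P X (2 + 0))%E.
  apply: eq_integral => w _; rewrite addr0 powR_mulrn//.
  by rewrite real_normK ?num_real.
have K0 : (0 <= Kint P X (2 + 0))%E by apply: integral_ge0 => *; rewrite lee_fin powR_ge0.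
have Kf : Kint P X (2 + 0) \is a fin_num.
  rewrite ge0_fin_numE// -E2.
  apply: (@le_lt_trans _ _ (\int[P]_w (1 + `|(sumsq (X 0%N w) - f1 P X) / f| `^ q)%:E)%E).
    apply: ge0_integral_mono => w; rewrite lee_fin ?sqr_ge0//.
    rewrite -/(f1 P X) -[leLHS]real_normK ?num_real//.
    move: (`|_ / f|) (normr_ge0 ((sumsq (X 0%N w) - f1 P X) / f)) => x x0.
    have [x1|x1] := leP x 1.
      have : x ^+ 2 <= 1 by rewrite expr_le1.
      by have := powR_ge0 x q; lra.
    have : x `^ 2%:R <= x `^ q by apply: ler_powR; [exact: ltW|have /andP[] := dl; lra].
    by rewrite powR_mulrn//; lra.
  rewrite integral_addr; [|by mfun|by mfun|by []|by move=> w; exact: powR_ge0].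
  by rewrite (prob_integral_cst P) -/(Kint P X q) -(fineK Kint_fin) ltry.
rewrite E2 /Kmom -powR_mulrn ?powR_ge0//.
rewrite {1}(@fine_root_powR R (Kint P X (2 + 0)) (2 + 0) ltac:(by rewrite addr0) K0 Kf).
by congr (_%:E); congr (_ `^ _); exact: addr0.
Qed.

Let mXv i : measurable_fun setT (X i : T -> vec R p).
Proof. by apply: measurable_vec => a; exact: mX. Qed.

(** X_2 becomes a copy of X_1 integrated separately, the form in which the error estimates produce
    D_delta. *)
Lemma Dint_iterated : (\int[P]_w \int[P]_w' (`|dotv (X 0%N w') (X 0%N w) / f| `^ q)%:E =
  (Dmom P X delta `^ q)%:E)%E.
Proof.
rewrite -Dmom_powR.
pose phi (z : vec R p * vec R p) : \bar R := (`|dotv z.1 z.2 / f| `^ q)%:E.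
have sp : joint_split P (X 0%N : T -> vec R p) (X 1%N : T -> vec R p) (X 0%N : T -> vec R p).
  apply: (past_split mXv _ (isT : uniq (1%N :: [:: 0%N]))) => //.
  - by move=> s B us mB; case: hX => _ _; apply.
  - exact: (measurable_past (mem_head 0%N [::])).
  - by move=> B mB; case: hX => _ H _; exact: H.
have mphi : measurable_fun setT phi.
  have m1 a : measurable_fun setT (fun z : vec R p * vec R p => z.1 a).
    exact: (measurableT_comp (measurable_coord a) measurable_fst).
  have m2 a : measurable_fun setT (fun z : vec R p * vec R p => z.2 a).
    exact: (measurableT_comp (measurable_coord a) measurable_snd).
  by rewrite /phi /dotv; mfun.
transitivity (\int[P]_w \int[P]_w' phi (X 0%N w, X 0%N w'))%E.
  apply: eq_integral => w _; apply: eq_integral => w' _; rewrite /phi/=.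
  by congr ((`|_ / _| `^ _)%:E); apply: eq_bigr => a _; rewrite mulrC.
have phi0 z : (0 <= phi z)%E by rewrite lee_fin powR_ge0.
by have <- := joint_split_integral (phi := phi) sp mphi phi0.
Qed.

Let quadf0 z : 0 <= quadf S z. Proof. exact: matched_quadf_ge0 hX0 z. Qed.

Let mquad : measurable_fun setT (fun w => quadf S (X 0%N w)).
Proof. by rewrite /quadf; mfun. Qed.

Let qh : q / 2 = 1 + delta / 2. Proof. by field. Qed.

(** Finiteness comes from D_delta: x^T Sigma x is the mean of (X^T x)^2, so by Jensen its power q/2
    is at most the mean of |X^T x|^q, and integration over x gives f^q D_delta^q. *)
Lemma Mquad_integral :
  (\int[P]_w (quadf S (X 0%N w) `^ (1 + delta / 2))%:E = (Mquad P X q)%:E)%E.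
Proof.
have /andP[d0 d1] := dl.
rewrite /Mquad qh.
have I0 : (0 <= \int[P]_w (quadf S (X 0%N w) `^ (1 + delta / 2))%:E)%E.
  by apply: integral_ge0 => w _; rewrite lee_fin powR_ge0.
suff ltoo : (\int[P]_w (quadf S (X 0%N w) `^ (1 + delta / 2))%:E < +oo)%E.
  by rewrite fineK; [exact: erefl|rewrite (ge0_fin_numE I0); exact: ltoo].
have md (z : 'I_p -> R) : measurable_fun setT (fun w' => dotv (X 0%N w') z) by rewrite /dotv; mfun.
apply: (@le_lt_trans _ _ (\int[P]_w ((f `^ q)%:E * \int[P]_w' (`|dotv (X 0%N w') (X 0%N w) / f| `^ q)%:E))%E).
  apply: ge0_integral_mono => w; first by rewrite lee_fin powR_ge0.
  rewrite -integral_scaler; [|by have := md (X 0%N w); move=> ?; mfun|by move=> *; exact: powR_ge0|exact: powR_ge0].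
  have mdw := md (X 0%N w).
  have HJ := @jensen_powR R d T P (fun w' => dotv (X 0%N w') (X 0%N w) ^+ 2) (quadf S (X 0%N w)) (1 + delta / 2)
    ltac:(by mfun) (fun w' => sqr_ge0 _) ltac:(lra).
  apply: le_trans (HJ _) _.
    rewrite -(matched_dotv2 hX0); apply: eq_integral => w' _.
    by congr ((_ ^+ 2)%:E); apply: eq_bigr => a _; rewrite mulrC.
  apply: ge0_integral_mono => w'; rewrite lee_fin ?powR_ge0//.
  rewrite -qh -[in leLHS]real_normK ?num_real// powR_sqr_half//.
  by rewrite -powRM ?(ltW f0)// normrM normfV (gtr0_norm f0) mulrC divfK ?gt_eqF.
rewrite ge0_integralZl_EFin.
- by rewrite Dint_iterated -EFinM ltry.
- exact: measurableT.
- by move=> w _; apply: integral_ge0 => *; rewrite lee_fin powR_ge0.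
- apply: (@measurable_integral_snd _ _ _ _ _ P
    (fun z : T * T => (`|dotv (X 0%N z.2) (X 0%N z.1) / f| `^ q)%:E)); last first.
    by move=> z; rewrite lee_fin powR_ge0.
  have ma a : measurable_fun setT (fun z : T * T => X 0%N z.2 a).
    exact: (measurableT_comp (mX 0%N a) measurable_snd).
  have mb a : measurable_fun setT (fun z : T * T => X 0%N z.1 a).
    exact: (measurableT_comp (mX 0%N a) measurable_fst).
  by rewrite /dotv; mfun.
- exact: powR_ge0.
Qed.

Lemma Mquad_ge : f `^ q <= Mquad P X q.
Proof.
have /andP[d0 d1] := dl.
rewrite -lee_fin -Mquad_integral.
have mean : (\int[P]_w (quadf S (X 0%N w))%:E = (f ^+ 2)%:E)%E.
  by rewrite (matched_quadf_mean hX0) ff_sqr.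
have := @jensen_powR R d T P (fun w => quadf S (X 0%N w)) (f ^+ 2) (1 + delta / 2)
  mquad (fun w => quadf0 _) ltac:(lra) mean.
by rewrite -qh powR_sqr_half// ltW.
Qed.

Lemma Rn_partial_sum n w : (0 < n)%N ->
  Rn P X n w = (sumsq (partial_sum X n w) / n%:R - \tr S) / f.
Proof.
move=> n0; rewrite /Rn /f1; congr ((_ - _) / _).
rewrite /sumsq mulr_sumr mulr_suml; apply: eq_bigr => a _.
rewrite /partial_sum -(big_mkord xpredT (fun i => X i w a)) /index_iota subn0.
by field; rewrite pnatr_eq0 -lt0n.
Qed.

End model_facts.

(** Here s = sqrt n, e = n^(delta/2), [p2] and [pq] are powers of psi, and the two lines are the
    errors for X and for its Gaussian counterpart. From mu >= 1 follows pq / e <= L and then, as e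
    <= s, p2 / s <= L; this absorbs the terms without a moment of X. The multiples of H^2 L add up
    to less than 6 * 10^5. *)
Lemma total_error_arith {R : realType} (s e p2 pq K0 mu H nuq gam L al : R) :
  0 < e -> 1 <= e -> e <= s -> 0 <= p2 -> p2 <= pq -> 0 <= K0 -> 1 <= mu -> 1 <= H ->
  p2 * K0 / s <= L -> p2 * K0 ^+ 2 / s ^+ 2 <= L -> pq * mu / e <= L ->
  pq * nuq / (s ^+ 2 * e ^+ 2) <= L -> pq * gam / e ^+ 2 <= L ->
  al = (K0 + 1) / s ->
  (4 * p2 * al + 12288 * (8 + H) * pq * (mu + 1) / e + p2 / 2 * (al^-1 + 1) * K0 ^+ 2 / s ^+ 2 +
    24 * pq * nuq / (s ^+ 2 * e ^+ 2) + 12288 * pq * gam / e ^+ 2) +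
  (4 * p2 * al + 12288 * (8 + H) * pq * ((1 + H) + 1) / e + p2 / 2 * (al^-1 + 1) * H / s ^+ 2 +
    24 * pq * (8 * H ^+ 2 + 8 * H) / (s ^+ 2 * e ^+ 2) + 12288 * pq * (H * mu) / e ^+ 2)
  <= 1000 * 1000 * H ^+ 2 * L.
Proof.
move=> e0 e1 es p20 p2q K00 mu1 H1 hA hB hT hD hE alE.
have s0 : 0 < s by exact: lt_le_trans es.
have k1 : 0 < K0 + 1 by rewrite ltr_wpDl.
have pq0 : 0 <= pq by exact: le_trans p2q.
have T0 : 0 <= pq * mu / e by rewrite divr_ge0 ?mulr_ge0 ?(ltW e0)//; lra.
have L0 : 0 <= L by exact: le_trans hT.
have se : s^-1 <= e^-1 by rewrite lef_pV2.
have ie1 : e^-1 <= 1 by rewrite invf_le1.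
have ie0 : 0 < e^-1 by rewrite invr_gt0.
have is0 : 0 < s^-1 by rewrite invr_gt0.
have pe : pq / e <= L.
  by apply: le_trans hT; rewrite ler_wpM2r ?(ltW ie0)// ler_peMr.
have ps : p2 / s <= L by apply: le_trans pe; apply: ler_pM => //; exact: ltW.
have HH : H <= H ^+ 2 by rewrite expr2 ler_peMr//; lra.
have HL : L <= H * L by rewrite ler_peMl.
have HHL : H * L <= H ^+ 2 * L by rewrite ler_wpM2r.
have a1 : p2 * al <= 2 * L.
  rewrite (_ : p2 * al = p2 * K0 / s + p2 / s); last by rewrite alE; field; rewrite gt_eqF.
  lra.
have b1 : pq * (mu + 1) / e <= 2 * L.
  rewrite (_ : pq * (mu + 1) / e = pq * mu / e + pq / e); last by ring.
  lra.
have ali : al^-1 = s / (K0 + 1) by rewrite alE invf_div.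
(* Since al^-1 = s / (K0 + 1), the product al^-1 K0^2 / s^2 is at most K0 / s, a term of [L]. *)
have c1 : p2 / 2 * (al^-1 + 1) * K0 ^+ 2 / s ^+ 2 <= L.
  have : p2 / s * (K0 ^+ 2 / (K0 + 1)) <= p2 / s * K0.
    apply: ler_wpM2l; first by rewrite divr_ge0 ?(ltW s0).
    by rewrite ler_pdivrMr// expr2 ler_wpM2l// lerDl.
  rewrite (_ : p2 / 2 * (al^-1 + 1) * K0 ^+ 2 / s ^+ 2 =
    (p2 / s * (K0 ^+ 2 / (K0 + 1)) + p2 * K0 ^+ 2 / s ^+ 2) / 2); last first.
    by rewrite ali; field; rewrite !gt_eqF.
  rewrite (_ : p2 / s * K0 = p2 * K0 / s); last by ring.
  lra.
have c2 : p2 / 2 * (al^-1 + 1) * H / s ^+ 2 <= H * L.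
  have u1 : s / (K0 + 1) <= s by rewrite ler_pdivrMr// ler_peMr ?(ltW s0)// lerDr.
  have u2 : 1 <= s by exact: le_trans es.
  have u3 : (al^-1 + 1) / 2 <= s by rewrite ali; lra.
  have u4 : p2 * H / s ^+ 2 * ((al^-1 + 1) / 2) <= p2 * H / s ^+ 2 * s.
    by rewrite ler_wpM2l// divr_ge0 ?sqr_ge0// mulr_ge0//; lra.
  rewrite (_ : p2 / 2 * (al^-1 + 1) * H / s ^+ 2 = p2 * H / s ^+ 2 * ((al^-1 + 1) / 2)); last by ring.
  apply: (le_trans u4); rewrite (_ : p2 * H / s ^+ 2 * s = H * (p2 / s)); last by field; rewrite gt_eqF.
  by rewrite ler_wpM2l//; lra.
have b2 : pq * ((1 + H) + 1) / e <= (2 + H) * L.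
  rewrite (_ : pq * ((1 + H) + 1) / e = (2 + H) * (pq / e)); last by ring.
  by rewrite ler_wpM2l//; lra.
have d2 : pq * (8 * H ^+ 2 + 8 * H) / (s ^+ 2 * e ^+ 2) <= (8 * H ^+ 2 + 8 * H) * L.
  rewrite (_ : pq * (8 * H ^+ 2 + 8 * H) / (s ^+ 2 * e ^+ 2) =
    (8 * H ^+ 2 + 8 * H) * (pq / e * (s^-1 ^+ 2 * e^-1))); last by field; rewrite !gt_eqF.
  rewrite ler_wpM2l//; first by lra.
  apply: le_trans pe; apply: ler_piMr; first by rewrite divr_ge0// ltW.
  rewrite mulr_ile1 ?sqr_ge0 ?(ltW ie0)// expr_le1//; first lra.
  exact: ltW.
have e2 : pq * (H * mu) / e ^+ 2 <= H * L.
  rewrite (_ : pq * (H * mu) / e ^+ 2 = H * (pq * mu / e * e^-1)); last by field; rewrite gt_eqF.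
  rewrite ler_wpM2l//; first lra.
  by apply: le_trans hT; rewrite ler_piMr.
have H8 : 0 <= 8 + H by lra.
have {}b1 := ler_wpM2l H8 b1; have {}b2 := ler_wpM2l H8 b2.
have w1 : (8 + H) * (2 * L) <= 18 * (H ^+ 2 * L).
  by rewrite (_ : _ * (2 * L) = 16 * L + 2 * (H * L)); [lra|ring].
have w2 : (8 + H) * ((2 + H) * L) <= 27 * (H ^+ 2 * L).
  by rewrite (_ : _ * (_ * L) = 16 * L + 10 * (H * L) + H ^+ 2 * L); [lra|ring].
have d3 : (8 * H ^+ 2 + 8 * H) * L <= 16 * (H ^+ 2 * L).
  by rewrite (_ : _ * L = 8 * (H ^+ 2 * L) + 8 * (H * L)); [lra|ring].
rewrite (_ : 12288 * (8 + H) * pq * (mu + 1) / e = 12288 * ((8 + H) * (pq * (mu + 1) / e))); last by ring.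
rewrite (_ : 12288 * (8 + H) * pq * ((1 + H) + 1) / e = 12288 * ((8 + H) * (pq * ((1 + H) + 1) / e))); last by ring.
rewrite -!(mulrA 4 p2) -!(mulrA 24 pq) -!(mulrA 24 (pq * _)) -!(mulrA 12288 pq) -!(mulrA 12288 (pq * _)) -(mulrA (1000 * 1000)).
lra.
Qed.

Lemma cconst_ge0 {R : realType} (r : R) : 0 <= cconst r.
Proof. by rewrite /cconst mulr_ge0// ?sqrtr_ge0 ?powR_ge0. Qed.

Lemma dconst_ge0 {R : realType} (r : R) : 0 <= dconst r.
Proof. by rewrite /dconst mulr_ge0// ?sqrtr_ge0 ?sqr_ge0. Qed.

Lemma le_sum5 {R : realDomainType} (x1 x2 x3 x4 x5 : R) :
  0 <= x1 -> 0 <= x2 -> 0 <= x3 -> 0 <= x4 -> 0 <= x5 ->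
  forall x, x = x1 + x2 + x3 + x4 + x5 ->
  (x1 <= x /\ x2 <= x) /\ [/\ x3 <= x, x4 <= x & x5 <= x].
Proof. by move=> h1 h2 h3 h4 h5 x ->; split; split; lra. Qed.

Lemma scaled_powR_integral {R : realType} d (T : measurableType d) (P : probability T R)
    (g : T -> R) (f r : R) : measurable_fun setT g -> 0 < f ->
  (\int[P]_w (`|g w / f| `^ r)%:E = ((f `^ r)^-1)%:E * \int[P]_w (`|g w| `^ r)%:E)%E.
Proof.
move=> mg f0; rewrite -integral_scaler; [|by mfun|by move=> w; exact: powR_ge0|by rewrite invr_ge0 powR_ge0].
apply: eq_integral => w _; congr (_%:E).
rewrite normrM powRM// normfV (gtr0_norm f0) powR_invr//; exact: mulrC.
Qed.

(** * The distance for a given psi >= 1 *)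

Section kolmogorov_bound.
Context {R : realType} d (T : measurableType d) (P : probability T R) (p : nat).
Variables (X : nat -> T -> 'I_p -> R) (delta : R) (lam : 'I_p -> R).
Hypothesis dl : 0 < delta <= 1.
Hypothesis hm : model_hyps P X delta lam.
Context d' (T' : measurableType d') (Q : probability T' R) (xi : 'I_p -> T' -> R).
Hypothesis hxi : iid_std_normal Q xi.
Variable H : R.
Hypothesis H1 : 1 <= H.
Hypothesis HM :
  [/\ (\int[@normal_prob R 0 1]_x (`|x| `^ (2 + delta))%:E <= H%:E)%E,
      (\int[@normal_prob R 0 1]_x (`|x ^+ 2 - 1| `^ (2 + delta))%:E <= H%:E)%E,
      (\int[@normal_prob R 0 1]_x ((x ^+ 2 - 1) ^+ 2)%:E <= H%:E)%E &
      (\int[@normal_prob R 0 1]_x (x ^+ 4)%:E <= H%:E)%E].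
Variables (n : nat) (psi : R).
Hypotheses (n0 : (0 < n)%N) (psi1 : 1 <= psi).

Local Notation S := (Sigma P X).
Local Notation f := (ff P X).
Local Notation q := (2 + delta).

Let hX : iid_vec P X. Proof. by case: hm. Qed.
Let mX i a : measurable_fun setT (fun w => X i w a). Proof. by case: hX. Qed.
Let hX0 : matched P (X 0%N) S. Proof. exact: model_matched hm. Qed.
Let f0 : 0 < f. Proof. exact: ff_gt0 hm. Qed.
Let fq0 : 0 < f `^ q. Proof. exact: powR_gt0. Qed.
Let psi0 : 0 < psi. Proof. exact: lt_le_trans psi1. Qed.
Let N : R := n%:R.
Let N0 : 0 < N. Proof. by rewrite ltr0n. Qed.
Let N1 : 1 <= N. Proof. by rewrite ler1n. Qed.
Let mu := Mquad P X q / f `^ q.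
Let mu1 : 1 <= mu. Proof. by rewrite ler_pdivlMr// mul1r; exact: Mquad_ge dl hm. Qed.
Let s := Num.sqrt N.
Let s0 : 0 < s. Proof. by rewrite sqrtr_gt0. Qed.
Let e := N `^ (delta / 2).
Let K0 := Kmom P X 0.
Let K00 : 0 <= K0. Proof. exact: powR_ge0. Qed.
(** The AM-GM terms are of order psi^2 alpha and psi^2 K_0^2 / (alpha n), and this weight makes both
    at most of order psi^2 (K_0 + 1) / sqrt n. The added 1 also keeps 1 / alpha below sqrt n, which
    the Gaussian counterpart needs when K_0 is small. *)
Let alpha := (K0 + 1) / s.
Let alpha0 : 0 < alpha. Proof. by rewrite divr_gt0// ltr_wpDl. Qed.

Let totX := total_error n psi delta alpha H mu (K0 ^+ 2) (Kmom P X delta `^ q) (Dmom P X delta `^ q).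
Let totY := total_error n psi delta alpha H (1 + H) H (8 * H ^+ 2 + 8 * H) (H * mu).

Let L := Ldelta P X delta n psi.

(** The tilded quantities only enlarge the moments, [cconst] and [dconst] being nonnegative; psi >=
    1 gives psi^2 <= psi^q. *)
Lemma total_errors_le : totX + totY <= 1000 * 1000 * H ^+ 2 * L.
Proof.
have /andP[d0 d1] := dl.
have s2 : s ^+ 2 = N by rewrite sqr_sqrtr// ltW.
have e1 : 1 <= e.
  apply: (@le_trans _ _ (N `^ 0)); first by rewrite powRr0.
  by apply: ler_powR => //; lra.
have e0 : 0 < e by exact: lt_le_trans e1.
have es : e <= s by rewrite /s -powR12_sqrt ?(ltW N0)//; apply: ler_powR => //; lra.
have Nd : N `^ delta = e ^+ 2 by rewrite /e -powR_mulrn ?powR_ge0// -powRrM; congr (_ `^ _); field.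
have Nq1 : N `^ (q - 1) = N * e ^+ 2.
  rewrite (_ : q - 1 = 1 + delta); last by ring.
  by rewrite powRD ?powRr1 ?(ltW N0) ?Nd//; apply/implyP => _; rewrite gt_eqF.
have K0t0 : K0 <= K0t P X by rewrite lerDl cconst_ge0.
have Kd : Kmom P X delta `^ q <= Kdt P X delta `^ q.
  by apply: ge0_ler_powR; rewrite ?nnegrE ?addr_ge0 ?powR_ge0 ?cconst_ge0 ?lerDl ?cconst_ge0//; lra.
have Dd : Dmom P X delta `^ q <= Ddt P X delta `^ q.
  by apply: ge0_ler_powR; rewrite ?nnegrE ?addr_ge0 ?powR_ge0 ?dconst_ge0 ?lerDl ?dconst_ge0//; lra.
have pq0 : 0 < psi `^ q by exact: powR_gt0.
have p2 : psi ^+ 2 <= psi `^ q.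
  rewrite powR2D// ?(ltW psi0)// ler_peMr ?sqr_ge0//.
  apply: (@le_trans _ _ (psi `^ 0)); first by rewrite powRr0.
  by apply: ler_powR; [exact: psi1|exact: ltW].
have LE : L = psi ^+ 2 * K0t P X ^+ 2 / N + psi ^+ 2 * K0t P X / s +
    psi `^ q * Kdt P X delta `^ q / (N * e ^+ 2) + psi `^ q * mu / e +
    psi `^ q * Ddt P X delta `^ q / e ^+ 2.
  rewrite /L /Ldelta -/N -/s -/e Nq1 Nd /mu; field.
  by rewrite !gt_eqF.
have K0tg : 0 <= K0t P X by exact: le_trans K0t0.
have l1 : 0 <= psi ^+ 2 * K0t P X ^+ 2 / N by nneg.
have l2 : 0 <= psi ^+ 2 * K0t P X / s by nneg.
have l3 : 0 <= psi `^ q * Kdt P X delta `^ q / (N * e ^+ 2).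
  by nneg.
have l4 : 0 <= psi `^ q * mu / e.
  have mu0 : 0 <= mu by exact: le_trans mu1.
  by nneg.
have l5 : 0 <= psi `^ q * Ddt P X delta `^ q / e ^+ 2.
  by nneg.
have [[g1 g2] [g3 g4 g5]] := le_sum5 l1 l2 l3 l4 l5 LE.
have hA : psi ^+ 2 * K0 / s <= L.
  by apply: le_trans g2; rewrite ler_wpM2r ?invr_ge0 ?(ltW s0)// ler_wpM2l ?sqr_ge0.
have hB : psi ^+ 2 * K0 ^+ 2 / N <= L.
  by apply: le_trans g1; rewrite ler_wpM2r ?invr_ge0 ?(ltW N0)// ler_wpM2l ?sqr_ge0// lerXn2r.
have hD : psi `^ q * Kmom P X delta `^ q / (N * e ^+ 2) <= L.
  by apply: le_trans g3; apply: ler_wpM2r; [nneg|apply: ler_wpM2l; [exact: ltW|exact: Kd]].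
have hE : psi `^ q * Dmom P X delta `^ q / e ^+ 2 <= L.
  by apply: le_trans g5; apply: ler_wpM2r; [nneg|apply: ler_wpM2l; [exact: ltW|exact: Dd]].
rewrite -s2 in hB hD.
have := @total_error_arith R s e (psi ^+ 2) (psi `^ q) K0 mu H (Kmom P X delta `^ q)
  (Dmom P X delta `^ q) L alpha e0 e1 es (sqr_ge0 _) p2 K00 mu1 H1 hA hB g4 hD hE erefl.
by rewrite s2.
Qed.

Section factor.
Variable A : 'M[R]_p.
Hypotheses (AA : A *m A^T = S) (AtA : A^T *m A = diag_mx (\row_j lam j))
  (lam2 : \sum_j lam j ^+ 2 = f ^+ 2).
Let Y := gauss_image xi A.
Let hY : matched Q Y S. Proof. exact: matched_gauss_image. Qed.
Let mY a : measurable_fun setT (fun w => Y w a). Proof. exact: (measurable_gauss_image hxi A a). Qed.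

(** Given X, the product X^T Y is centred Gaussian with variance X^T Sigma X, so its q-th moment is
    a Gaussian constant times the power q/2 of that form. *)
Lemma cross_moment_le :
  (\int[Q]_w \int[P]_w' (`|dotv (X 0%N w') (Y w) / f| `^ q)%:E <= (H * mu)%:E)%E.
Proof.
have /andP[d0 d1] := dl.
have [Hq _ _ _] := HM.
rewrite (@fubini_tonelli _ _ _ _ _ Q P
  (fun z : T' * T => (`|dotv (X 0%N z.2) (Y z.1) / f| `^ q)%:E)); last 2 first.
- have ma a : measurable_fun setT (fun z : T' * T => X 0%N z.2 a).
    exact: (measurableT_comp (mX 0%N a) measurable_snd).
  have mb a : measurable_fun setT (fun z : T' * T => Y z.1 a).
    exact: (measurableT_comp (mY a) measurable_fst).
  by rewrite /dotv; mfun.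
- by move=> z; rewrite lee_fin powR_ge0.
have mq : measurable_fun setT (fun w => quadf S (X 0%N w)) by rewrite /quadf; mfun.
apply: (@le_trans _ _ (\int[P]_w (((f `^ q)^-1 * H) * quadf S (X 0%N w) `^ (1 + delta / 2))%:E)%E).
  apply: ge0_integral_mono => w; first by apply: integral_ge0 => *; rewrite lee_fin powR_ge0.
  have md : measurable_fun setT (fun w' => dotv (X 0%N w) (Y w')) by rewrite /dotv; mfun.
  rewrite (scaled_powR_integral Q q md f0).
  have := gauss_image_powR hxi AA (X 0%N w) (ltac:(lra) : 0 <= q) Hq.
  have dC (x y : 'I_p -> R) : dotv x y = dotv y x by apply: eq_bigr => a _; rewrite mulrC.
  under eq_integral do rewrite dC.
  rewrite (_ : q / 2 = 1 + delta / 2); last by field.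
  move=> h; rewrite -mulrA EFinM (mulrC H).
  by apply: lee_wpmul2l => //; rewrite lee_fin invr_ge0 powR_ge0.
have c0 : 0 <= (f `^ q)^-1 * H by rewrite mulr_ge0 ?invr_ge0 ?powR_ge0//; exact: le_trans H1.
rewrite integral_scaler; [|by mfun|by move=> w; exact: powR_ge0|exact: c0].
rewrite (Mquad_integral dl hm) -EFinM lee_fin /mu le_eqVlt; apply/orP; left; apply/eqP.
by field; rewrite gt_eqF.
Qed.

Let E := N^-1 * (totX + totY).

Let tot0 m2 v2 vq g : 0 <= m2 -> 0 <= v2 -> 0 <= vq -> 0 <= g ->
  0 <= total_error n psi delta alpha H m2 v2 vq g.
Proof.
move=> h1 h2 h3 h4; have ha := ltW alpha0; have hN := ltW N0.
have hH : 0 <= H by exact: le_trans H1.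
by rewrite /total_error; nneg.
Qed.

Let totX0 : 0 <= totX.
Proof. by apply: tot0; rewrite ?sqr_ge0 ?powR_ge0//; exact: le_trans mu1. Qed.

Let totY0 : 0 <= totY.
Proof.
have hH : 0 <= H by exact: le_trans H1.
have hmu : 0 <= mu by exact: le_trans mu1.
by apply: tot0; nneg.
Qed.

Let EX k m : 0 <= m -> k%:R + m <= N ->
  (\int[P]_w \int[Q]_w' \int[P]_w1 (exchange_error S N f psi delta alpha
      (hybrid X xi A (Num.sqrt m) k (w, w')) (X 0%N w1))%:E <= E%:E)%E.
Proof.
move=> m0 km; have [Hq _ _ _] := HM.
apply: (@le_trans _ _ (N^-1 * totX)%:E); last first.
  by rewrite lee_fin ler_wpM2l ?invr_ge0 ?(ltW N0)// lerDl.
apply: (exchange_error_integral hX hxi AA hX0 n0 f0 psi0 alpha0 dl Hq (ff_sqr hm) hX0 _ _ _ _ m0 km).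
- by rewrite (Mquad_integral dl hm) /mu divfK// gt_eqF.
- by rewrite (Kmom0_sqr dl hm).
- by rewrite -(Kmom_powR dl hm).
- by rewrite (Dint_iterated dl hm).
Qed.

Let EY k m : 0 <= m -> k%:R + m <= N ->
  (\int[P]_w \int[Q]_w' \int[Q]_w1 (exchange_error S N f psi delta alpha
      (hybrid X xi A (Num.sqrt m) k (w, w')) (Y w1))%:E <= E%:E)%E.
Proof.
move=> m0 km; have [Hq _ _ _] := HM.
apply: (@le_trans _ _ (N^-1 * totY)%:E); last first.
  by rewrite lee_fin ler_wpM2l ?invr_ge0 ?(ltW N0)// lerDr.
apply: (exchange_error_integral hX hxi AA hX0 n0 f0 psi0 alpha0 dl Hq (ff_sqr hm) hY _ _ _ _ m0 km).
- exact: (gauss_image_quadf hxi AA AtA f0 lam2 dl HM).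
- exact: (gauss_image_centered2 hxi AA AtA f0 lam2 HM).
- exact: (gauss_image_centeredq hxi AA AtA f0 lam2 dl H1 HM).
- exact: cross_moment_le.
Qed.

Let V := Rn P X n.
Let U w := \sum_j lam j / f * (xi j w ^+ 2 - 1).

Let smooth_V t w : smooth_ind S N f psi t (partial_sum X n w) = cutoff (psi * (V w - t)).
Proof. by rewrite /smooth_ind /V Rn_partial_sum. Qed.

Let smooth_U t w : smooth_ind S N f psi t (fun a => s * Y w a) = cutoff (psi * (U w - t)).
Proof.
have E0 : sumsq (fun a => s * Y w a) / N = sumsq (Y w).
  rewrite /sumsq mulr_suml; apply: eq_bigr => a _.
  by rewrite exprMn sqr_sqrtr ?(ltW N0)// mulrC mulKf ?gt_eqF.
by rewrite /smooth_ind E0 (normalized_sumsq_gauss_image xi AA AtA f0 w).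
Qed.

Lemma kolmogorov_factor_bound t :
  `|fine (P [set w | V w <= t]) - fine (Q [set w | U w <= t])| <=
  153 * Num.sqrt (3 / psi) + N * (2 * E).
Proof.
apply: (kolmogorov_smoothing _ _ psi0) => {t} [||t|t|t].
- rewrite /V (_ : Rn P X n = fun w => (sumsq (partial_sum X n w) / N - \tr S) / f); last first.
    by apply/funext => w; exact: Rn_partial_sum.
  have mS := measurable_partial_sum hX n.
  by rewrite /sumsq; mfun.
- have mx j : measurable_fun setT (xi j) by case: hxi.
  by rewrite /U; mfun.
- have [h _] := lindeberg_exchange hX hxi AA hX0 t n0 f0 psi0 alpha0 dl EX EY.
  under eq_integral do rewrite -smooth_V.
  by under [X in (_ <= X + _)%E]eq_integral do rewrite -smooth_U.
- have [_ h] := lindeberg_exchange hX hxi AA hX0 t n0 f0 psi0 alpha0 dl EX EY.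
  under eq_integral do rewrite -smooth_U.
  by under [X in (_ <= X + _)%E]eq_integral do rewrite -smooth_V.
- have a1 : \sum_j (lam j / f) ^+ 2 = 1.
    under eq_bigr do rewrite exprMn; rewrite -mulr_suml lam2 exprVn mulfV//.
    by rewrite expf_neq0// gt_eqF.
  have P3 : 0 < 3 / psi by rewrite divr_gt0.
  (* The centring in [U] shifts the level by the sum of the lam_j / f. *)
  have := gaussian_form_anticoncentration hxi a1 (t + \sum_j lam j / f) P3.
  apply: le_trans; rewrite le_eqVlt; apply/orP; left; apply/eqP; congr (Q _).
  apply/funext => w /=.
  have -> // : \sum_j lam j / f * xi j w ^+ 2 - (t + \sum_j lam j / f) = U w - t.
  rewrite opprD addrA addrAC -sumrB; congr (_ - _).
  by apply: eq_bigr => j _; ring.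
Qed.

End factor.

Lemma KSdist_le :
  KSdist P X Q xi lam n <= 306 * psi `^ (- (1 / 2)) + 2 * (1000 * 1000 * H ^+ 2) * L.
Proof.
have [A [AA AtA lam2]] := model_factorization hm.
apply: ge_sup; first by exists (`|fine (P [set w | Rn P X n w <= 0]) -
  fine (Q [set w | \sum_(j < p) lam j / ff P X * (xi j w ^+ 2 - 1) <= 0])|); exists 0.
move=> _ [t _ <-]; apply: le_trans (kolmogorov_factor_bound AA AtA lam2 t) _.
have -> : N * (2 * (N^-1 * (totX + totY))) = 2 * (totX + totY) by field; rewrite gt_eqF.
(* From sqrt 3 <= 2; hence 306 = 2 * 153. *)
have s3 : Num.sqrt (3 / psi) <= 2 * psi `^ (- (1 / 2)).
  rewrite sqrtrM// sqrtrV ?(ltW psi0)//.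
  have -> : psi `^ (- (1 / 2)) = (Num.sqrt psi)^-1.
    by rewrite powRN mul1r powR12_sqrt// ltW.
  rewrite ler_wpM2r ?invr_ge0 ?sqrtr_ge0//.
  rewrite -(@ler_pXn2r _ 2)// ?nnegrE ?sqrtr_ge0// sqr_sqrtr//.
  by rewrite expr2; lra.
apply: lerD; last by rewrite -[leRHS]mulrA ler_wpM2l//; exact: total_errors_le.
have -> : 306 * psi `^ (- (1 / 2)) = 153 * (2 * psi `^ (- (1 / 2))) by ring.
by rewrite ler_wpM2l.
Qed.

End kolmogorov_bound.

(** * Uniform constant and asymptotic regime *)

Section distance.
Context {R : realType} d (T : measurableType d) (P : probability T R) (p : nat).
Variable X : nat -> T -> 'I_p -> R.
Context d' (T' : measurableType d') (Q : probability T' R) (xi : 'I_p -> T' -> R).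
Variables (lam : 'I_p -> R) (n : nat).
Hypothesis mRn : measurable_fun setT (Rn P X n).
Hypothesis mxi : forall j, measurable_fun setT (xi j).

Let fine01 d1 (T1 : measurableType d1) (W : probability T1 R) (B : set T1) :
  measurable B -> 0 <= fine (W B) <= 1.
Proof.
move=> mB; have WB : W B = (fine (W B))%:E by rewrite fineK// fin_num_measure.
by rewrite fine_ge0//= -lee_fin -WB probability_le1.
Qed.

Let diff_le1 t : `|fine (P [set w | Rn P X n w <= t]) -
    fine (Q [set w | \sum_(j < p) lam j / ff P X * (xi j w ^+ 2 - 1) <= t])| <= 1.
Proof.
have mU : measurable_fun setT (fun w => \sum_(j < p) lam j / ff P X * (xi j w ^+ 2 - 1)) by mfun.
have /andP[a0 a1] := fine01 P (measurable_le_set t mRn).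
have /andP[b0 b1] := fine01 Q (measurable_le_set t mU).
by rewrite ler_norml; apply/andP; split; lra.
Qed.

(** A real [sup] dominates the elements of a set only once the set is known to be bounded above,
    here by 1 as differences of probabilities; nonnegativity depends on this. *)
Lemma KSdist_le1 : 0 <= KSdist P X Q xi lam n <= 1.
Proof.
apply/andP; split; last first.
  apply: ge_sup; last by move=> _ [t _ <-]; exact: diff_le1.
  by eexists; exists 0.
apply: le_trans (normr_ge0 _) _; apply: ub_le_sup; last by exists 0.
by exists 1 => _ [t _ <-]; exact: diff_le1.
Qed.

End distance.

Lemma measurable_Rn {R : realType} d (T : measurableType d) (P : probability T R) (p : nat)
    (X : nat -> T -> 'I_p -> R) n : iid_vec P X -> measurable_fun setT (Rn P X n).
Proof.
move=> [mX _ _]; have mS a : measurable_fun setT (fun w => \sum_(i < n) X i w a).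
  by apply: measurable_sum => i; exact: mX.
by rewrite /Rn /sumsq; mfun.
Qed.

Lemma powR_invsqrt {R : realType} (x : R) : 0 <= x -> x `^ (- (1 / 2)) = (Num.sqrt x)^-1.
Proof. by move=> x0; rewrite powRN mul1r powR12_sqrt. Qed.

(** For psi >= 1 the equation turns the term in L into a multiple of psi^(-1/2). For psi < 1 the
    bound exceeds 1 and the distance never does. *)
Lemma KSdist_bound {R : realType} (delta : R) : 0 < delta <= 1 ->
  exists2 C : R, 0 < C &
    forall (d : measure_display) (T : measurableType d) (P : probability T R)
      (p : nat) (X : nat -> T -> 'I_p -> R) (lam : 'I_p -> R)
      (d' : measure_display) (T' : measurableType d') (Q : probability T' R)
      (xi : 'I_p -> T' -> R) (n : nat) (psi : R),
      model_hyps P X delta lam -> iid_std_normal Q xi ->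
      (0 < n)%N -> 0 < psi ->
      Ldelta P X delta n psi = psi `^ (- (1 / 2)) ->
      KSdist P X Q xi lam n <= C * psi `^ (- (1 / 2)).
Proof.
move=> dl; have [H H1 HM] := gaussian_moments dl.
have c0 : 0 <= 2 * (1000 * 1000 * H ^+ 2) by nneg.
exists (306 + 2 * (1000 * 1000 * H ^+ 2)); first by apply: ltr_wpDr; [exact: c0|rewrite ltr0n].
move=> d T P p X lam d' T' Q xi n psi hm hxi n0 psi0 Leq.
have [psi1|psi1] := leP 1 psi.
  by have := KSdist_le dl hm hxi H1 HM n0 psi1; rewrite Leq -mulrDl.
have mR : measurable_fun setT (Rn P X n) by apply: measurable_Rn; case: hm.
have mx j : measurable_fun setT (xi j) by case: hxi.
have /andP[_ K1] := KSdist_le1 Q lam mR mx.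
apply: (le_trans K1); rewrite powR_invsqrt ?(ltW psi0)//.
rewrite -[leLHS]mulr1; apply: ler_pM => //.
  by rewrite -[leLHS]addr0 lerD// ler1n.
rewrite invf_ge1 ?sqrtr_gt0//.
by rewrite -(sqrtr1 R) ler_wsqrtr// ltW.
Qed.

(** If psi < M, the powers of psi on the left are at most M^3, so the left side is at most 3 M^3
    sqrt A, which the threshold on [A] makes smaller than 1 / M; but the right side is at least 1 /
    M. *)
Lemma psi_lower_bound {R : realType} (delta A K B M psi : R) : 0 < delta <= 1 ->
  0 <= A -> K <= A -> 0 <= B <= A -> 0 < psi -> 1 <= M -> A < (3 * M ^+ 4)^-1 ^+ 2 ->
  psi ^+ 2 * (K + Num.sqrt K) + psi `^ (2 + delta) * B = psi `^ (- (1 / 2)) ->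
  M <= psi.
Proof.
move=> /andP[d0 d1] A0 KA /andP[B0 BA] psi0 M1 Asmall eq; rewrite leNgt; apply/negP => psiM.
have M0 : 0 < M by exact: lt_le_trans M1.
have M4 : 1 <= M ^+ 4 by rewrite exprn_ege1.
have sA : Num.sqrt A < (3 * M ^+ 4)^-1.
  have c0 : 0 < (3 * M ^+ 4)^-1 by rewrite invr_gt0 mulr_gt0 ?exprn_gt0.
  by rewrite -(ger0_norm (ltW c0)) -sqrtr_sqr ltr_sqrt// exprn_gt0.
have sA0 := sqrtr_ge0 A.
have sA1 : Num.sqrt A <= 1.
  by apply: (le_trans (ltW sA)); rewrite invf_le1 ?mulr_gt0 ?exprn_gt0//; lra.
have AsA : A <= Num.sqrt A by rewrite -[leLHS](sqr_sqrtr A0) expr2 ler_piMr.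
have sK : Num.sqrt K <= Num.sqrt A by exact: ler_wsqrtr.
have M3 : 0 <= M ^+ 3 by rewrite exprn_ge0// ltW.
have p2 : psi ^+ 2 <= M ^+ 3.
  apply: (@le_trans _ _ (M ^+ 2)); first by rewrite lerXn2r ?nnegrE// ltW.
  by rewrite ler_weXn2l.
have pq : psi `^ (2 + delta) <= M ^+ 3.
  apply: (@le_trans _ _ (M `^ (2 + delta))).
    by apply: ge0_ler_powR; rewrite ?nnegrE ?(ltW psi0) ?(ltW M0) ?(ltW psiM)//; lra.
  by rewrite -powR_mulrn ?(ltW M0)//; apply: ler_powR => //; lra.
have u1 : psi ^+ 2 * (K + Num.sqrt K) <= M ^+ 3 * (2 * Num.sqrt A).
  apply: (@le_trans _ _ (psi ^+ 2 * (2 * Num.sqrt A))).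
    by rewrite ler_wpM2l ?sqr_ge0//; lra.
  by rewrite ler_wpM2r// mulr_ge0.
have u2 : psi `^ (2 + delta) * B <= M ^+ 3 * Num.sqrt A.
  by apply: ler_pM => //; [exact: powR_ge0|exact: le_trans AsA].
have u3 : M^-1 <= psi `^ (- (1 / 2)).
  rewrite powR_invsqrt ?(ltW psi0)// lef_pV2 ?posrE ?sqrtr_gt0//.
  apply: (@le_trans _ _ (Num.sqrt (M ^+ 2))); last by rewrite sqrtr_sqr ger0_norm// ltW.
  by apply: ler_wsqrtr; apply: (le_trans (ltW psiM)); rewrite expr2 ler_peMr// ltW.
have u4 : M^-1 <= M ^+ 3 * (3 * Num.sqrt A) by lra.
have : M ^+ 3 * (3 * Num.sqrt A) < M ^+ 3 * (3 * (3 * M ^+ 4)^-1).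
  by rewrite ltr_pM2l ?exprn_gt0// ltr_pM2l.
rewrite (_ : M ^+ 3 * (3 * (3 * M ^+ 4)^-1) = M^-1); first by rewrite ltNge u4.
by field; rewrite gt_eqF.
Qed.

Lemma psi_ge {R : realType} d (T : measurableType d) (P : probability T R) (p : nat)
    (X : nat -> T -> 'I_p -> R) (delta M psi : R) (n : nat) :
  0 < delta <= 1 -> (0 < n)%N -> 0 < psi -> 1 <= M ->
  Acond P X delta n < (3 * M ^+ 4)^-1 ^+ 2 ->
  Ldelta P X delta n psi = psi `^ (- (1 / 2)) -> M <= psi.
Proof.
move=> dl n0 psi0 M1 As eq.
have N0 : 0 < n%:R :> R by rewrite ltr0n.
set B1 := Kdt P X delta `^ (2 + delta) / n%:R `^ (2 + delta - 1).
set B2 := Mquad P X (2 + delta) / (n%:R `^ (delta / 2) * ff P X `^ (2 + delta)).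
set B3 := Ddt P X delta `^ (2 + delta) / n%:R `^ delta.
set K := K0t P X ^+ 2 / n%:R.
have K0 : 0 <= K by rewrite divr_ge0 ?sqr_ge0 ?(ltW N0).
have B10 : 0 <= B1 by rewrite divr_ge0 ?powR_ge0.
have B20 : 0 <= B2.
  rewrite divr_ge0 ?mulr_ge0 ?powR_ge0// fine_ge0// integral_ge0// => w _.
  by rewrite lee_fin powR_ge0.
have B30 : 0 <= B3 by rewrite divr_ge0 ?powR_ge0.
have AE : Acond P X delta n = K + B1 + B2 + B3 by [].
have A0 : 0 <= Acond P X delta n by rewrite AE !addr_ge0.
have K0t0 : 0 <= K0t P X by rewrite addr_ge0 ?powR_ge0 ?cconst_ge0.
(* The term with 1 / sqrt n in L is the square root of the one with 1 / n, so that smallness of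
   [Acond] controls both. *)
have sK : Num.sqrt K = K0t P X / Num.sqrt n%:R.
  by rewrite /K sqrtrM ?sqr_ge0// sqrtr_sqr ger0_norm// sqrtrV ?(ltW N0).
apply: (@psi_lower_bound _ delta (Acond P X delta n) K (B1 + B2 + B3)) => //.
- by rewrite AE -!addrA lerDl !addr_ge0.
- by rewrite !addr_ge0//= AE -!addrA lerDr.
- by rewrite sK.
Qed.

(** In the second part the index [m] of the array is the sample size, so m = 0 carries no equation
    and is avoided by going far enough along the sequence. *)
Theorem mainTheorem2 (R : realType) (delta : R) : 0 < delta <= 1 ->
  (exists C : R,
    forall (d : measure_display) (T : measurableType d) (P : probability T R)
      (p : nat) (X : nat -> T -> 'I_p -> R) (lam : 'I_p -> R)
      (d' : measure_display) (T' : measurableType d') (Q : probability T' R)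
      (xi : 'I_p -> T' -> R) (n : nat) (psi : R),
      model_hyps P X delta lam -> iid_std_normal Q xi ->
      (0 < n)%N -> 0 < psi ->
      Ldelta P X delta n psi = psi `^ (- (1 / 2)) ->
      KSdist P X Q xi lam n <= C * psi `^ (- (1 / 2)))
  /\
  (forall (d : nat -> measure_display) (T : forall m, measurableType (d m))
      (P : forall m, probability (T m) R)
      (p : nat -> nat) (X : forall m, nat -> T m -> 'I_(p m) -> R)
      (lam : forall m, 'I_(p m) -> R)
      (d' : nat -> measure_display) (T' : forall m, measurableType (d' m))
      (Q : forall m, probability (T' m) R)
      (xi : forall m, 'I_(p m) -> T' m -> R) (psi : nat -> R),
      (forall m, model_hyps (P m) (X m) delta (lam m)) ->
      (forall m, iid_std_normal (Q m) (xi m)) ->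
      (forall m, (0 < m)%N ->
         0 < psi m /\ Ldelta (P m) (X m) delta m (psi m) = psi m `^ (- (1 / 2))) ->
      (fun m => Acond (P m) (X m) delta m) @ \oo --> 0 ->
      psi @ \oo --> +oo /\
      (fun m => KSdist (P m) (X m) (Q m) (xi m) (lam m) m) @ \oo --> 0).
Proof.
move=> dl; have [C C0 HC] := KSdist_bound dl.
split; first by exists C.
move=> d T P p X lam d' T' Q xi psi hm hxi hpsi hA.
have psi_oo M : 1 <= M -> \forall m \near \oo, (0 < m)%N /\ M <= psi m.
  move=> M1; have M0 : 0 < M by exact: lt_le_trans M1.
  have e0 : 0 < (3 * M ^+ 4)^-1 ^+ 2 by rewrite exprn_gt0// invr_gt0 mulr_gt0 ?exprn_gt0.
  near=> m; have m0 : (0 < m)%N by near: m; exists 1%N.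
  split => //; have [psi0 eq] := hpsi m m0.
  apply: (psi_ge dl m0 psi0 M1 _ eq).
  by near: m; exact: (cvgr_lt _ hA).
split.
  apply/cvgryPge => M; have := psi_oo (Num.max 1 M); rewrite le_max lexx => /(_ isT).
  by apply: filterS => m [_]; rewrite ge_max => /andP[].
apply/cvgr0Pnorm_le => e e0.
(* psi >= (C / e)^2 gives C psi^(-1/2) <= e; the extra 1 meets the condition 1 <= M. *)
have := psi_oo (1 + (C / e) ^+ 2); rewrite lerDl sqr_ge0 => /(_ isT).
apply: filterS => m [m0 Mpsi]; have [psi0 eq] := hpsi m m0.
have mR : measurable_fun setT (Rn (P m) (X m) m) by apply: measurable_Rn; case: (hm m).
have mx j : measurable_fun setT (xi m j) by case: (hxi m).
have /andP[KS0 _] := KSdist_le1 (Q m) (lam m) mR mx.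
rewrite ger0_norm//; apply: le_trans (HC _ _ _ _ _ _ _ _ _ _ _ _ (hm m) (hxi m) m0 psi0 eq) _.
rewrite powR_invsqrt ?(ltW psi0)// ler_pdivrMr ?sqrtr_gt0// mulrC -ler_pdivrMr//.
rewrite -[leLHS]ger0_norm ?divr_ge0 ?(ltW C0) ?(ltW e0)// -sqrtr_sqr.
by apply: ler_wsqrtr; apply: le_trans Mpsi; rewrite lerDr.
Unshelve. all: by end_near.
Qed.
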